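(* Let $n\ge 2$, $m\in\{1,\ldots,n-1\}$, $q\in\mathbb{R}$ with $q\neq 0$, and $p>\max\{m,mq\}$. If $K,L\in\mathcal{K}^n_{(o)}$ and $\alpha,\beta>0$, then $$\widetilde{\Psi}_{m,q}(\alpha\cdot K+_p\beta\cdot L)^{\frac{p}{mq}}\geq \alpha\,\widetilde{\Psi}_{m,q}(K)^{\frac{p}{mq}}+\beta\,\widetilde{\Psi}_{m,q}(L)^{\frac{p}{mq}},$$ and equality holds if and only if $K$ and $L$ are dilates. In addition, if $q>0$, then this inequality, including the characterization of equality, holds for any convex bodies $K,L\in\mathcal{K}^n_o$.
   Context: A convex body is a compact convex set with non-empty interior. $\mathcal{K}^n_o$ is the family of compact convex sets in $\mathbb{R}^n$ containing the origin $o$; $\mathcal{K}^n_{(o)}$ is the family of convex bodies with $o$ in the interior. $h_K(u)=\max_{x\in K}\langle x,u\rangle$ is the support function. $\mathcal{H}^m$ is $m$-dimensional Hausdorff measure, ${\rm G}(n,m)$ the Grassmannian of linear $m$-planes in $\mathbb{R}^n$, and $\nu_{n,m}$ its Haar probability measure. For $q\ne 0$, $$\widetilde{\Psi}_{m,q}(K)=\int_{{\rm G}(n,m)}\mathcal{H}^m(\xi\cap K)^q\,d\nu_{n,m}(\xi).$$ For $p>0$, $\alpha,\beta\geq 0$ and $K,L\in\mathcal{K}^n_o$, the $L_p$ linear combination is $$\alpha\cdot K+_p\beta\cdot L=\{x\in\mathbb{R}^n:\langle x,u\rangle\le(\alpha h_K(u)^p+\beta h_L(u)^p)^{1/p}\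 \forall u\in S^{n-1}\}.$$ $K$ and $L$ are dilates if $K=\lambda L$ for some $\lambda>0$. *)

(* Defs.v *)
From HB Require Import structures.
From mathcomp Require Import all_boot all_order all_algebra.
From mathcomp Require Import all_classical all_reals all_analysis.

Set Implicit Arguments.
Unset Strict Implicit.
Unset Printing Implicit Defensive.

Import Order.TTheory GRing.Theory Num.Theory.
Import numFieldNormedType.Exports.

Local Open Scope classical_set_scope.
Local Open Scope ring_scope.

(* The points of R^n are the row vectors 'rV[R]_n. The library norm on them is
   the max norm; its topology is the usual one, but Euclidean lengths have to
   be taken from [edot]. *)
Definition edot (R : realType) (n : nat) (x y : 'rV[R]_n) : R :=
  \sum_(i < n) x ord0 i * y ord0 i.

Definition enorm (R : realType) (n : nat) (x : 'rV[R]_n) : R :=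
  Num.sqrt (edot x x).

Definition convex_body (R : realType) (n : nat) (K : set 'rV[R]_n) : Prop :=
  [/\ compact K, convex_set (K : set (convex_lmodType 'rV[R]_n))
    & interior K !=set0].

Definition support_fun (R : realType) (n : nat) (K : set 'rV[R]_n)
    (u : 'rV[R]_n) : R :=
  sup [set edot x u | x in K].

Definition Lp_comb (R : realType) (n : nat) (p alpha beta : R)
    (K L : set 'rV[R]_n) : set 'rV[R]_n :=
  [set x | forall u : 'rV[R]_n, enorm u = 1 ->
    edot x u <= (alpha * support_fun K u `^ p + beta * support_fun L u `^ p)
                  `^ p^-1].

Definition dilates (R : realType) (n : nat) (K L : set 'rV[R]_n) : Prop :=
  exists2 lambda : R, 0 < lambda & K = [set lambda *: x | x in L].

(* Volume of the m-dimensional Euclidean unit ball,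
   pi^(m/2) / Gamma(m/2 + 1), through its two-step recurrence. *)
Fixpoint unit_ball_volume (R : realType) (m : nat) : R :=
  match m with
  | 0 => 1
  | 1 => 2
  | k.+2 => 2 * pi / k.+2%:R * unit_ball_volume R k
  end.

(* -oo on the empty set *)
Definition diam (R : realType) (n : nat) (A : set 'rV[R]_n) : \bar R :=
  ereal_sup [set (enorm (x - y))%:E | x in A & y in A].

(* The empty set is singled out so that it also weighs 0 for m = 0. *)
Definition hausdorff_weight (R : realType) (n m : nat) (A : set 'rV[R]_n) :
    \bar R :=
  if A == set0 then 0%E
  else ((unit_ball_volume R m / 2 ^+ m)%:E * diam A ^+ m)%E.

Definition hausdorff_premeasure (R : realType) (n m : nat) (delta : R)
    (A : set 'rV[R]_n) : \bar R :=
  ereal_inf [set (\sum_(0 <= i <oo) hausdorff_weight m (F i))%E | F in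
    [set F : (set 'rV[R]_n)^nat | A `<=` \bigcup_i F i /\
      forall i, (diam (F i) <= delta%:E)%E]].

(* The limit as delta -> 0+ is a supremum, by monotonicity in delta. *)
Definition hausdorff_measure (R : realType) (n m : nat) (A : set 'rV[R]_n) :
    \bar R :=
  ereal_sup [set hausdorff_premeasure m delta A | delta in [set d : R | 0 < d]].

(* G(n,m); the proof argument makes the type inhabited, as measurable types
   have to be. *)
Definition grassmannian (R : realType) (n m : nat) of (m <= n)%N : Type :=
  {U : {vspace 'rV[R]_n} | \dim U == m}.

Lemma grassmannian_inh (R : realType) (n m : nat) (h : (m <= n)%N) :
  exists U : {vspace 'rV[R]_n}, \dim U == m.
Proof.
set b := vbasis (fullv : {vspace 'rV[R]_n}).
have sb : size b = n by rewrite size_tuple dimvf /dim /= mul1n.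
exists <<take m b>>%VS.
have fr : free (take m b).
  have := basis_free (vbasisP (fullv : {vspace 'rV[R]_n})).
  by rewrite -[X in free X](cat_take_drop m) => /catl_free.
by move: fr; rewrite /free => /eqP ->; rewrite size_takel// sb.
Qed.

Lemma mulmxr_injP (R : realType) (k m n : nat) (M : 'M[R]_(m, n)) :
  row_free M -> lker (linfun (mulmxr M : 'M[R]_(k, m) -> 'M[R]_(k, n))) == 0%VS.
Proof.
move=> fM; apply/lker0P => x y; rewrite !lfunE /=; exact: row_free_inj.
Qed.

Definition row_space (R : realType) (n m : nat) (M : 'M[R]_(m, n)) :
    {vspace 'rV[R]_n} :=
  limg (linfun (mulmxr M : 'rV[R]_m -> 'rV[R]_n)).

Lemma dim_row_space (R : realType) (n m : nat) (M : 'M[R]_(m, n)) :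
  row_free M -> \dim (row_space M) == m.
Proof.
move=> fM; rewrite /row_space limg_dim_eq ?(eqP (mulmxr_injP _ fM)) ?capv0//.
by rewrite dimvf /dim /= mul1n.
Qed.

Section grassmannian_topology.
Context (R : realType) (n m : nat) (h : (m <= n)%N).
Local Notation G := (grassmannian R h).

HB.instance Definition _ := Choice.on G.
HB.instance Definition _ :=
  isPointed.Build G (exist _ (xchoose (grassmannian_inh R h))
                      (xchooseP (grassmannian_inh R h))).

(* G(n,m) carries the quotient topology of the space of m x n matrices of
   rank m under M |-> row_space M. *)
Definition frames (A : set G) : set 'M[R]_(m, n) :=
  [set M | exists2 U : G, A U & val U = row_space M].

Definition grassmannian_open (A : set G) : Prop :=
  open (frames A : set (subspace [set M : 'M[R]_(m, n) | row_free M])).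

Let openT : grassmannian_open setT.
Proof.
rewrite /grassmannian_open -open_subspaceIT (_ : _ `&` _ = [set M | row_free M]).
  exact: open_subspaceT.
apply/seteqP; split => M /=; first by case.
by move=> fM; split => //; exists (exist _ (row_space M) (dim_row_space fM)).
Qed.

Let openI : setI_closed grassmannian_open.
Proof.
move=> A B oA oB; rewrite /grassmannian_open.
rewrite (_ : frames (A `&` B) = frames A `&` frames B); first exact: openI.
apply/seteqP; split=> M /=; first by case=> U [AU BU] UM; split; exists U.
move=> [[U AU UM] [V BV VM]]; exists U => //; split=> //.
by rewrite (_ : U = V)//; apply: val_inj; rewrite /= UM VM.
Qed.

Let open_bigU (I : Type) (f : I -> set G) :
  (forall i, grassmannian_open (f i)) -> grassmannian_open (\bigcup_i f i).
Proof.
move=> of_; rewrite /grassmannian_open.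
rewrite (_ : frames _ = \bigcup_i frames (f i)).
  by apply: bigcup_open => i _; exact: of_.
apply/seteqP; split=> M /=; first by case=> U [i _ fU] UM; exists i => //; exists U.
by move=> [i _ [U fU UM]]; exists U => //; exists i.
Qed.

HB.instance Definition _ := isOpenTopological.Build G openT openI open_bigU.

Definition borel_grassmannian : Type := g_sigma_algebraType (@open G).
HB.instance Definition _ := Measurable.on borel_grassmannian.

(* Image of a set of planes under the isometry x |-> x *m O. *)
Definition rotate (O : 'M[R]_n) (A : set G) : set G :=
  [set V | exists2 U : G, A U &
    val V = (linfun (mulmxr O : 'rV[R]_n -> 'rV[R]_n) @: val U)%VS].

End grassmannian_topology.

Arguments borel_grassmannian R {n m} h.

(* nu_{n,m}: the unique Borel probability measure on G(n,m) which is invariant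
   under the orthogonal group. *)
Definition haar_probability (R : realType) (n m : nat) (h : (m <= n)%N)
    (nu : probability (borel_grassmannian R h) R) : Prop :=
  forall O : 'M[R]_n, O *m O^T = 1%:M ->
  forall A : set (borel_grassmannian R h), measurable A ->
    nu (rotate O A) = nu A.

(* The library power satisfies 0 `^ q = 0 for q < 0. This value plays no role
   when o is an interior point of K: all sections have positive measure. *)
Definition Psi (R : realType) (n m : nat) (h : (m <= n)%N)
    (nu : probability (borel_grassmannian R h) R) (q : R)
    (K : set 'rV[R]_n) : \bar R :=
  (\int[nu]_xi
     (hausdorff_measure m ([set` (val xi : {vspace 'rV[R]_n})] `&` K) `^ q))%E.

(* Main.v *)
(* In a fixed plane xi the Brunn-Minkowski inequality is proved directly for
   Hausdorff measure, which only requires its translation invariance and homogeneity, and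
   the finiteness and positivity of the measure of the unit cube. By Hölder's
   inequality the L_p combination M of K and L contains every s K + t L such that
   s x + t y <= (alpha x^p + beta y^p)^(1/p) for all x, y >= 0, so the m-th root of
   the volume of sections by xi is superadditive in the L_p sense. As p > m q, the
   q-th power of the volume is a concave function (convex, if q < 0) of the p-th
   power of that root; applying this with weights adapted to the values of Psi at K
   and L and integrating over xi gives the inequality.

   In case of equality, for almost all xi the roots of the sections of K and L are
   in a ratio a / b independent of xi and the section of M is no larger than its
   subset s K + t L, where (s, t) is the Hölder normal at (a, b). Hence both
   agree, and in every direction the strictness of Hölder's inequality forces the
   support functions of the two sections to be in the ratio a / b, so that the
   sections of K and (a / b) L coincide. If K and (a / b) L were different, an open
   ball would lie in one and avoid the other; but the planes that meet a given open
   set have positive measure. *)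
From HB Require Import structures.
Require Import Defs.
From mathcomp Require Import all_boot all_order all_algebra.
From mathcomp Require Import all_classical all_reals all_analysis.
From mathcomp Require Import measurable_realfun.
From mathcomp Require Import finmap ring lra.

Set Implicit Arguments.
Unset Strict Implicit.
Unset Printing Implicit Defensive.

Import Order.TTheory GRing.Theory Num.Theory.
Import numFieldNormedType.Exports.

Local Open Scope classical_set_scope.
Local Open Scope ring_scope.

(** * Euclidean norm *)

(** Hausdorff measure is at hand only as an outer measure. Additivity comes from sets at positive
    distance, continuity from above from nested sets with separated shells; together they give
    superadditivity across coordinate hyperplanes, on which an induction over finite unions of boxes
    runs.

    The weights arise as follows. Write $\Psi(K)=F(a)$ and $\Psi(L)=F(b)$, where $F(t)=(ct^m)^q$ and
    $c$ is the measure of the unit cube, and let $d$ be the weighted $l_p$ mean of $a$ and $b$.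
    Jensen's inequality at $(k/a)^p$ and $(l/b)^p$ with weight $\theta=\alpha a^p/d^p$ compares the
    integrand of $M$ with an expression that is linear in the integrands of $K$ and $L$ and has
    integral exactly $F(d)$. The power $p/(mq)$ turns $F(d)$ into the right-hand side; for $q<0$ the
    comparison and this power both reverse the order.

    For $q>0$ the origin may be a boundary point, so that sections may have measure 0. This is why
    Hölder normals at $a=0$ or $b=0$ and Jensen's inequality at 0 are treated, and why the equality
    case looks at planes through a ball contained in one of the bodies. *)

Section euclidean_norm.
Context (R : realType) (n : nat).
Implicit Types x y : 'rV[R]_n.

Lemma edotC x y : edot x y = edot y x.
Proof. by apply: eq_bigr => i _; rewrite mulrC. Qed.

Lemma edotDl x y z : edot (x + y) z = edot x z + edot y z.
Proof. by rewrite /edot -big_split; apply: eq_bigr => i _; rewrite mxE mulrDl. Qed.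

Lemma edotZl a x y : edot (a *: x) y = a * edot x y.
Proof. by rewrite /edot mulr_sumr; apply: eq_bigr => i _; rewrite mxE mulrA. Qed.

Lemma edotDr x y z : edot z (x + y) = edot z x + edot z y.
Proof. by rewrite edotC edotDl !(edotC z). Qed.

Lemma edotZr a x y : edot x (a *: y) = a * edot x y.
Proof. by rewrite edotC edotZl edotC. Qed.

Lemma edotNl x y : edot (- x) y = - edot x y.
Proof. by rewrite -scaleN1r edotZl mulN1r. Qed.

Lemma edotNr x y : edot x (- y) = - edot x y.
Proof. by rewrite -scaleN1r edotZr mulN1r. Qed.

Lemma edot0l x : edot 0 x = 0.
Proof. by rewrite -(scale0r x) edotZl mul0r. Qed.

Lemma edot0r x : edot x 0 = 0.
Proof. by rewrite edotC edot0l. Qed.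

Lemma edotE x y : edot x y = (x *m y^T) ord0 ord0.
Proof. by rewrite mxE; apply: eq_bigr => i _; rewrite mxE. Qed.

Lemma edot_ge0 x : 0 <= edot x x.
Proof. by apply: sumr_ge0 => i _; rewrite -expr2 sqr_ge0. Qed.

Lemma edot_eq0 x : (edot x x == 0) = (x == 0).
Proof.
apply/idP/eqP => [|->]; last by rewrite edot0l.
rewrite psumr_eq0 => [/allP h|i _]; last by rewrite -expr2 sqr_ge0.
apply/rowP => i; rewrite mxE; apply/eqP.
by have := h i (mem_index_enum _); rewrite /= mulf_eq0 orbb.
Qed.

Lemma sqr_enorm x : enorm x ^+ 2 = edot x x.
Proof. by rewrite sqr_sqrtr ?edot_ge0. Qed.

Lemma enorm_ge0 x : 0 <= enorm x.
Proof. exact: sqrtr_ge0. Qed.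

Lemma enorm_eq0 x : (enorm x == 0) = (x == 0).
Proof. by rewrite -edot_eq0 -sqr_enorm sqrf_eq0. Qed.

Lemma enormZ a x : enorm (a *: x) = `|a| * enorm x.
Proof.
by rewrite /enorm edotZl edotZr mulrA -expr2 sqrtrM ?sqr_ge0// sqrtr_sqr.
Qed.

Lemma enorm0 : enorm (0 : 'rV[R]_n) = 0.
Proof. by apply/eqP; rewrite enorm_eq0. Qed.

Lemma enormN x : enorm (- x) = enorm x.
Proof. by rewrite -scaleN1r enormZ normrN1 mul1r. Qed.

Lemma edot_le_enorm x y : edot x y <= enorm x * enorm y.
Proof.
have [->|y0] := eqVneq y 0; first by rewrite edot0r enorm0 mulr0.
have [->|x0] := eqVneq x 0; first by rewrite edot0l enorm0 mul0r.
have ny : 0 < enorm y by rewrite lt_neqAle eq_sym enorm_eq0 y0 enorm_ge0.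
have nx : 0 < enorm x by rewrite lt_neqAle eq_sym enorm_eq0 x0 enorm_ge0.
have := edot_ge0 (enorm y *: x - enorm x *: y).
rewrite edotDl !edotDr !edotNl !edotNr !edotZl !edotZr (edotC y x) -!sqr_enorm.
move=> h; have : 0 <= (2 * enorm x * enorm y) * (enorm x * enorm y - edot x y).
  by move: h; congr (_ <= _); ring.
by rewrite pmulr_rge0 ?subr_ge0// !mulr_gt0.
Qed.

Lemma enormD x y : enorm (x + y) <= enorm x + enorm y.
Proof.
rewrite -(@ler_pXn2r _ 2)// ?nnegrE ?addr_ge0 ?enorm_ge0//.
rewrite sqr_enorm edotDl !edotDr (edotC y x) -!sqr_enorm.
have := edot_le_enorm x y; nra.
Qed.

Lemma ler_norm_coord x i : `|x ord0 i| <= `|x|.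
Proof.
rewrite [leRHS]/Num.norm /= mx_normrE.
by apply/bigmax_geP; right => /=; exists (ord0, i).
Qed.

Lemma norm_rV_le x (e : R) : 0 <= e -> (forall i, `|x ord0 i| <= e) -> `|x| <= e.
Proof.
move=> e0 h; rewrite [leLHS]/Num.norm /= mx_normrE; apply/bigmax_leP; split => //.
by move=> [i j] _ /=; rewrite (ord1 i).
Qed.

Lemma norm_rV_lt x (e : R) : 0 < e -> (forall i, `|x ord0 i| < e) -> `|x| < e.
Proof.
move=> e0 h; rewrite [ltLHS]/Num.norm /= mx_normrE; apply/bigmax_ltP; split => //.
by move=> [i j] _ /=; rewrite (ord1 i).
Qed.

Lemma norm_le_enorm x : `|x| <= enorm x.
Proof.
apply: norm_rV_le => [|i]; first exact: enorm_ge0.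
rewrite -(@ler_pXn2r _ 2)// ?nnegrE ?enorm_ge0// sqr_enorm real_normK ?num_real//.
rewrite /edot (bigD1 i)//= -expr2 lerDl.
by apply: sumr_ge0 => j _; rewrite -expr2 sqr_ge0.
Qed.

Lemma enorm_le_norm x : enorm x <= n%:R * `|x|.
Proof.
rewrite -(@ler_pXn2r _ 2)// ?nnegrE ?enorm_ge0 ?mulr_ge0// sqr_enorm.
apply: (@le_trans _ _ (n%:R * `|x| ^+ 2)).
  rewrite (_ : n%:R * _ = \sum_(i < n) `|x| ^+ 2); last first.
    by rewrite sumr_const card_ord mulr_natl.
  apply: ler_sum => i _.
  by rewrite -expr2 -(real_normK (num_real (x ord0 i))) ler_pXn2r ?nnegrE// ler_norm_coord.
rewrite exprMn ler_wpM2r ?sqr_ge0//.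
by rewrite -natrX ler_nat -{1}(expn1 n); case: (n) => // k; rewrite leq_pexp2l.
Qed.

End euclidean_norm.

(** * Hausdorff measure *)

Lemma lee_expe (R : realType) (x y : \bar R) k :
  (0 <= x -> x <= y -> x ^+ k <= y ^+ k)%E.
Proof.
move=> x0 xy; elim: k => // k ih; rewrite !expeS.
by apply: lee_pmul => //; exact: expe_ge0.
Qed.

Lemma expeMl (R : realType) (r : R) (x : \bar R) k :
  ((r%:E * x) ^+ k = (r ^+ k)%:E * x ^+ k)%E.
Proof.
elim: k => [|k ih]; first by rewrite !expe0 mule1.
by rewrite !expeS ih exprS EFinM muleACA.
Qed.

Lemma unit_ball_volume_gt0 (R : realType) m : 0 < unit_ball_volume R m.
Proof.
have [k] := ubnP m; elim: k m => // k ih [|[|m]] //= mk.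
by rewrite !mulr_gt0 ?invr_gt0 ?ltr0n ?pi_gt0// ih// -ltnS ltnW.
Qed.

Section diameter.
Context (R : realType) (n : nat).
Implicit Types A B : set 'rV[R]_n.

Lemma enorm_le_diam A x y : A x -> A y -> ((enorm (x - y))%:E <= diam A)%E.
Proof. by move=> Ax Ay; apply: ereal_sup_ubound; exists x => //; exists y. Qed.

Lemma diam_le A (d : \bar R) :
  (forall x y, A x -> A y -> ((enorm (x - y))%:E <= d)%E) -> (diam A <= d)%E.
Proof. by move=> h; apply: ge_ereal_sup => _ [x Ax [y Ay <-]]; exact: h. Qed.

Lemma diam_ge0 A : A !=set0 -> (0 <= diam A)%E.
Proof.
by case=> x Ax; rewrite (le_trans _ (enorm_le_diam Ax Ax))// lee_fin enorm_ge0.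
Qed.

Lemma diamS A B : A `<=` B -> (diam A <= diam B)%E.
Proof. by move=> AB; apply: diam_le => x y /AB Bx /AB By; exact: enorm_le_diam. Qed.

Lemma diam0 : diam (set0 : set 'rV[R]_n) = -oo%E.
Proof. by apply/eqP; rewrite -leeNy_eq; apply: diam_le. Qed.

End diameter.

Lemma diam_image (R : realType) (n n' : nat) (f : 'rV[R]_n -> 'rV[R]_n') (L : R)
    (A : set 'rV[R]_n) : 0 < L ->
  (forall x y, A x -> A y -> enorm (f x - f y) <= L * enorm (x - y)) ->
  (diam (f @` A) <= L%:E * diam A)%E.
Proof.
move=> L0 fL; apply: diam_le => _ _ [x Ax <-] [y Ay <-].
apply: (@le_trans _ _ (L * enorm (x - y))%:E); first by rewrite lee_fin fL.
by rewrite EFinM lee_pmul2l ?ltry ?lte_fin// enorm_le_diam.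
Qed.

Section hausdorff_weight.
Context (R : realType) (n m : nat).
Implicit Types A B : set 'rV[R]_n.
Local Notation kappa := (unit_ball_volume R m / 2 ^+ m).

Lemma kappa_gt0 : 0 < kappa.
Proof. by rewrite divr_gt0 ?unit_ball_volume_gt0. Qed.

Lemma hausdorff_weight_ge0 A : (0 <= hausdorff_weight m A)%E.
Proof.
rewrite /hausdorff_weight; case: ifPn => // /set0P A0.
apply: mule_ge0; first by rewrite lee_fin ltW// kappa_gt0.
by apply: expe_ge0; exact: diam_ge0.
Qed.

Lemma hausdorff_weight0 : hausdorff_weight m (set0 : set 'rV[R]_n) = 0%E.
Proof. by rewrite /hausdorff_weight eqxx. Qed.

Lemma hausdorff_weightS A B : A `<=` B ->
  (hausdorff_weight m A <= hausdorff_weight m B)%E.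
Proof.
move=> AB; have [->|/set0P[x Ax]] := eqVneq A set0.
  by rewrite hausdorff_weight0 hausdorff_weight_ge0.
have /set0P A0 : A !=set0 by exists x.
have /set0P B0 : B !=set0 by exists x; exact: AB.
rewrite /hausdorff_weight (negbTE A0) (negbTE B0).
rewrite lee_pmul2l ?ltry ?lte_fin ?kappa_gt0// lee_expe ?diamS//.
by apply: diam_ge0; exact/set0P.
Qed.

Lemma hausdorff_weight_le A (d : R) : 0 <= d -> (diam A <= d%:E)%E ->
  (hausdorff_weight m A <= (kappa * d ^+ m)%:E)%E.
Proof.
move=> d0 Ad; have [->|/[dup] A0 /set0P A0'] := eqVneq A set0.
  by rewrite hausdorff_weight0 lee_fin mulr_ge0 ?exprn_ge0// ltW// kappa_gt0.
rewrite /hausdorff_weight (negbTE A0) [leRHS]EFinM EFin_expe.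
by rewrite lee_pmul2l ?ltry ?lte_fin ?kappa_gt0// lee_expe// diam_ge0.
Qed.

End hausdorff_weight.

Lemma hausdorff_weight_image (R : realType) (n n' m : nat)
    (f : 'rV[R]_n -> 'rV[R]_n') (L : R) (A : set 'rV[R]_n) :
  0 < L ->
  (forall x y, A x -> A y -> enorm (f x - f y) <= L * enorm (x - y)) ->
  (hausdorff_weight m (f @` A) <= (L ^+ m)%:E * hausdorff_weight m A)%E.
Proof.
move=> L0 fL; have [->|/[dup] A0 /set0P[x Ax]] := eqVneq A set0.
  by rewrite image_set0 !hausdorff_weight0 mule0.
have /set0P B0 : f @` A !=set0 by exists (f x); exists x.
rewrite /hausdorff_weight (negbTE A0) (negbTE B0) muleCA.
rewrite lee_pmul2l ?ltry ?lte_fin ?kappa_gt0// -expeMl lee_expe//.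
  by apply: diam_ge0; exact/set0P.
exact: diam_image.
Qed.

Section hausdorff_outer_measure.
Context (R : realType) (n m : nat).
Implicit Types A B : set 'rV[R]_n.
Local Notation hp := (@hausdorff_premeasure R n m).

Local Notation discrete := (g_sigma_algebraType [set: set 'rV[R]_n]).

(* [hausdorff_premeasure] as the outer measure induced by a weight on all subsets:
   sets of too large a diameter get weight +oo. *)
Let weight_upto (delta : R) (A : set discrete) : \bar R :=
  if (diam (A : set 'rV[R]_n) <= delta%:E)%E
  then hausdorff_weight m (A : set 'rV[R]_n) else +oo%E.

Let weight_upto_ge0 delta A : (0 <= weight_upto delta A)%E.
Proof. by rewrite /weight_upto; case: ifP => // _; exact: hausdorff_weight_ge0. Qed.

Let hp_mu_ext delta : hp delta = mu_ext (weight_upto delta).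
Proof.
apply/funext => A; apply/eqP; rewrite eq_le; apply/andP; split.
  apply: le_ereal_inf_tmp => _ [F [mF AF] <-].
  have [h|/existsNP[i hi]] := pselect (forall i, (diam (F i : set 'rV_n) <= delta%:E)%E).
    apply: ereal_inf_lbound; exists F => //.
    by apply: eq_eseriesr => i _; rewrite /weight_upto h.
  rewrite (@eseries_pinfty _ _ xpredT i) ?leey//.
  - by move=> j _; rewrite -ltNye (lt_le_trans _ (weight_upto_ge0 _ _)).
  - by rewrite /weight_upto; case: ifP.
apply: le_ereal_inf_tmp => _ [F [AF Fd] <-].
apply: ereal_inf_lbound; exists F; first by split => // i; exact: sub_gen_smallest.
by apply: eq_eseriesr => i _; rewrite /weight_upto Fd.
Qed.

Lemma hausdorff_premeasure_ge0 delta A : (0 <= hp delta A)%E.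
Proof. by rewrite hp_mu_ext; apply: mu_ext_ge0; exact: weight_upto_ge0. Qed.

Lemma hausdorff_premeasure0 delta : hp delta set0 = 0%E.
Proof.
rewrite hp_mu_ext; apply: mu_ext0; last exact: weight_upto_ge0.
by rewrite /weight_upto diam0 leNye hausdorff_weight0.
Qed.

Lemma hausdorff_premeasureS delta A B : A `<=` B -> (hp delta A <= hp delta B)%E.
Proof. by move=> AB; rewrite hp_mu_ext; exact: le_mu_ext. Qed.

Lemma hausdorff_premeasure_sigma_subadditive delta : sigma_subadditive (hp delta).
Proof.
rewrite hp_mu_ext.
exact: (@mu_ext_sigma_subadditive _ discrete R _ (weight_upto_ge0 delta)).
Qed.

HB.instance Definition _ delta := isOuterMeasure.Build R 'rV[R]_n (hp delta)
  (hausdorff_premeasure0 delta) (hausdorff_premeasure_ge0 delta)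
  (@hausdorff_premeasureS delta) (@hausdorff_premeasure_sigma_subadditive delta).

Lemma hausdorff_premeasure_le_weight delta A : (diam A <= delta%:E)%E ->
  (hp delta A <= hausdorff_weight m A)%E.
Proof.
move=> Ad; apply: ereal_inf_lbound; exists (fun i => if i == 0%N then A else set0).
  split; first by move=> x Ax; exists 0%N.
  by case=> // i; rewrite diam0 leNye.
rewrite (@nneseriesD1 _ _ 0%N)//= => [|k _]; last exact: hausdorff_weight_ge0.
by rewrite eseries0 ?adde0// => -[|i] // _ _; rewrite hausdorff_weight0.
Qed.

Lemma le_hausdorff_premeasure delta delta' A : delta <= delta' ->
  (hp delta' A <= hp delta A)%E.
Proof.
move=> dd; apply: ereal_inf_le_tmp => x [F [AF Fd] <-]; exists F => //.
by split => // i; rewrite (le_trans (Fd i)).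
Qed.

Local Notation Hm := (@hausdorff_measure R n m).

Lemma hausdorff_premeasure_le_measure delta A : 0 < delta -> (hp delta A <= Hm A)%E.
Proof. by move=> d0; apply: ereal_sup_ubound; exists delta. Qed.

Lemma hausdorff_measure_le A (x : \bar R) :
  (forall delta, 0 < delta -> (hp delta A <= x)%E) -> (Hm A <= x)%E.
Proof. by move=> h; apply: ge_ereal_sup => _ [d d0 <-]; exact: h. Qed.

Let Hm0 : Hm set0 = 0%E.
Proof.
apply/eqP; rewrite eq_le; apply/andP; split.
  by apply: hausdorff_measure_le => d d0; rewrite hausdorff_premeasure0.
by rewrite -(hausdorff_premeasure0 1) hausdorff_premeasure_le_measure.
Qed.

Let Hm_ge0 A : (0 <= Hm A)%E.
Proof.
by rewrite (le_trans (hausdorff_premeasure_ge0 1 A))// hausdorff_premeasure_le_measure.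
Qed.

Let HmS A B : A `<=` B -> (Hm A <= Hm B)%E.
Proof.
move=> AB; apply: hausdorff_measure_le => d d0.
by rewrite (le_trans (hausdorff_premeasureS d AB))// hausdorff_premeasure_le_measure.
Qed.

Let Hm_sigma_subadditive : sigma_subadditive Hm.
Proof.
move=> F; apply: hausdorff_measure_le => d d0.
apply: (le_trans (hausdorff_premeasure_sigma_subadditive d F)).
apply: lee_nneseries => [i _ _|i _]; first exact: hausdorff_premeasure_ge0.
exact: hausdorff_premeasure_le_measure.
Qed.

HB.instance Definition _ := isOuterMeasure.Build R 'rV[R]_n Hm
  Hm0 Hm_ge0 HmS Hm_sigma_subadditive.

End hausdorff_outer_measure.

(** A cover of [A] of mesh [d / L] is carried to a cover of the image of mesh [d]. Its members are
    first cut down to [A], where alone [f] is known to be Lipschitz. *)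
Lemma hausdorff_measure_lipschitz (R : realType) (n n' m : nat)
    (f : 'rV[R]_n -> 'rV[R]_n') (L : R) (A : set 'rV[R]_n) : 0 < L ->
  (forall x y, A x -> A y -> enorm (f x - f y) <= L * enorm (x - y)) ->
  (hausdorff_measure m (f @` A) <= (L ^+ m)%:E * hausdorff_measure m A)%E.
Proof.
move=> L0 fL; apply: hausdorff_measure_le => d d0.
have Lm0 : 0 < L ^+ m by rewrite exprn_gt0.
apply: (@le_trans _ _ ((L ^+ m)%:E * hausdorff_premeasure m (d / L) A)%E); last first.
  by rewrite lee_pmul2l ?ltry ?lte_fin// hausdorff_premeasure_le_measure ?divr_gt0.
rewrite -lee_pdivrMl//; apply: le_ereal_inf_tmp => _ [F [AF Fd] <-].
rewrite lee_pdivrMl// -nneseriesZl => [|i _]; last exact: hausdorff_weight_ge0.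
apply: (@le_trans _ _ (\sum_(0 <= i <oo) hausdorff_weight m (f @` (F i `&` A)))%E).
  apply: ereal_inf_lbound; exists (fun i => f @` (F i `&` A)) => //; split.
    move=> _ [x Ax <-]; have [i _ Fix] := AF _ Ax.
    by exists i => //; exists x.
  move=> i; apply: (@le_trans _ _ (L%:E * diam (F i `&` A))%E).
    by apply: diam_image => // x y [_ Ax] [_ Ay]; exact: fL.
  apply: (@le_trans _ _ (L%:E * (d / L)%:E)%E).
    rewrite lee_pmul2l ?ltry ?lte_fin//.
    by apply: (le_trans _ (Fd i)); apply: diamS; exact: subIsetl.
  by rewrite -EFinM mulrC divfK// gt_eqF.
apply: lee_nneseries => [i _ _|i _]; first exact: hausdorff_weight_ge0.
apply: (@le_trans _ _ ((L ^+ m)%:E * hausdorff_weight m (F i `&` A))%E).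
  by apply: hausdorff_weight_image => // x y [_ Ax] [_ Ay]; exact: fL.
by rewrite lee_pmul2l ?ltry ?lte_fin//; apply: hausdorff_weightS; exact: subIsetl.
Qed.

(** * Hausdorff measure as a metric outer measure *)

Definition separated_sets (R : realType) (n : nat) (A B : set 'rV[R]_n) : Prop :=
  exists2 e : R, 0 < e & forall x y, A x -> B y -> e <= `|x - y|.

Section hausdorff_metric.
Context (R : realType) (n m : nat).
Implicit Types A B : set 'rV[R]_n.
Local Notation hp := (@hausdorff_premeasure R n m).
Local Notation Hm := (@hausdorff_measure R n m).

Lemma hausdorff_measureS A B : A `<=` B -> (Hm A <= Hm B)%E.
Proof. exact: le_outer_measure. Qed.

Lemma hausdorff_measure_ge0 A : (0 <= Hm A)%E.
Proof. exact: outer_measure_ge0. Qed.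

(** A cover of mesh at most [e / 2] has no member meeting both sets, so it splits into a cover of
    [A] and a cover of [B] without loss. *)
Lemma hausdorff_measure_sep A B : separated_sets A B ->
  (Hm A + Hm B <= Hm (A `|` B))%E.
Proof.
case=> e e0 AB.
have [->|oo] := eqVneq (Hm (A `|` B)) +oo%E; first exact: leey.
have fin C : C `<=` A `|` B -> Hm C \is a fin_num.
  move=> CU; rewrite ge0_fin_numE ?hausdorff_measure_ge0//.
  by rewrite (le_lt_trans (hausdorff_measureS CU))// ltey.
have finB : Hm B \is a fin_num by apply: fin; exact: subsetUr.
have fin_hp d : 0 < d -> hp d A \is a fin_num.
  move=> d0; rewrite ge0_fin_numE ?hausdorff_premeasure_ge0//.
  rewrite (le_lt_trans (hausdorff_premeasure_le_measure _ _ d0))//.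
  by rewrite -ge0_fin_numE ?hausdorff_measure_ge0//; apply: fin; exact: subsetUl.
(* Finiteness lets the two suprema over scales be bounded in turn, each with its own scale. *)
rewrite -leeBrDr//; apply: hausdorff_measure_le => d1 d10.
rewrite leeBrDr// addeC -leeBrDr ?fin_hp//; apply: hausdorff_measure_le => d2 d20.
rewrite leeBrDr ?fin_hp// addeC.
pose d := Num.min (Num.min d1 d2) (e / 2).
have d0 : 0 < d by rewrite !lt_min d10 d20/= divr_gt0.
apply: (le_trans _ (hausdorff_premeasure_le_measure _ _ d0)).
apply: (@le_trans _ _ (hp d A + hp d B)%E).
  by apply: leeD; apply: le_hausdorff_premeasure; rewrite !ge_min lexx ?orbT.
apply: le_ereal_inf_tmp => _ [F [ABF Fd] <-].
apply: (@le_trans _ _ (\sum_(0 <= i <oo) hausdorff_weight m (F i `&` A) +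
                       \sum_(0 <= i <oo) hausdorff_weight m (F i `&` B))%E).
  have bnd C : C `<=` A `|` B ->
      (hp d C <= \sum_(0 <= i <oo) hausdorff_weight m (F i `&` C))%E.
    move=> CAB; apply: ereal_inf_lbound; exists (fun i => F i `&` C) => //; split.
      by move=> x Cx; have [i _ Fix] := ABF _ (CAB _ Cx); exists i.
    by move=> i; rewrite (le_trans _ (Fd i))// diamS//; exact: subIsetl.
  by apply: leeD; apply: bnd; [exact: subsetUl | exact: subsetUr].
rewrite -nneseriesD; [|by move=> *; exact: hausdorff_weight_ge0..].
apply: lee_nneseries => [i _ _|i _]; first by rewrite adde_ge0 ?hausdorff_weight_ge0.
have [A0|/set0P[x [Fx Ax]]] := eqVneq (F i `&` A) set0.
  by rewrite A0 hausdorff_weight0 add0e hausdorff_weightS//; exact: subIsetl.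
suff -> : F i `&` B = set0.
  by rewrite hausdorff_weight0 adde0 hausdorff_weightS//; exact: subIsetl.
rewrite -subset0 => y [Fy By].
have := le_trans (enorm_le_diam Fx Fy) (Fd i); rewrite lee_fin => xyd.
have : e <= e / 2.
  rewrite (le_trans (AB _ _ Ax By))// (le_trans (norm_le_enorm _))//.
  by rewrite (le_trans xyd)// ge_min lexx orbT.
by lra.
Qed.

Lemma hausdorff_measure_cvg (A : (set 'rV[R]_n)^nat) (e : R) : 0 < e ->
  (Hm (A 0%N) < +oo)%E -> (forall k, A k.+1 `<=` A k) ->
  (forall k, separated_sets (A k `\` A k.+1) (A k.+2)) ->
  exists k, (Hm (A k) <= Hm (\bigcap_k A k) + e%:E)%E.
Proof.
move=> e0 Afin Adec Asep; pose S k := A k `\` A k.+1.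
have Amono i j : (i <= j)%N -> A j `<=` A i.
  elim: j => [|j ih]; first by rewrite leqn0 => /eqP->.
  by rewrite leq_eqVlt => /orP[/eqP->//|/ih h] x /Adec/h.
have step k : (Hm (S k) + Hm (A k.+2) <= Hm (A k))%E.
  rewrite (le_trans (hausdorff_measure_sep (Asep k)))// hausdorff_measureS//.
  by rewrite subUset; split; [exact: subDsetl | move=> x /Adec/Adec].
have alternate j N : (\sum_(k < N) Hm (S (j + k.*2)%N) + Hm (A (j + N.*2)%N) <= Hm (A j))%E.
  elim: N => [|N ih]; first by rewrite big_ord0 add0e addn0.
  rewrite big_ord_recr/= (le_trans _ ih)// -addeA leeD2l//.
  by rewrite doubleS !addnS step.
have bound N : (\sum_(k < N) Hm (S k) <= Hm (A 0%N) + Hm (A 0%N))%E.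
  apply: (@le_trans _ _ (\sum_(k < N.*2) Hm (S k))%E).
    rewrite -!(big_mkord xpredT (fun k => Hm (S k))).
    by apply: lee_sum_nneg_natr => [k _ _|]; rewrite ?hausdorff_measure_ge0// -addnn leq_addr.
  rewrite (_ : (\sum_(k < N.*2) _ = \sum_(k < N) Hm (S (0 + k.*2)%N)
                                   + \sum_(k < N) Hm (S (1 + k.*2)%N))%E); last first.
    elim: N => [|N ih]; first by rewrite !big_ord0 adde0.
    by rewrite doubleS !big_ord_recr/= ih add0n add1n -!addeA; congr (_ + _)%E;
       rewrite addeCA.
  apply: leeD.
    by rewrite (le_trans _ (alternate 0%N N))// leeDl ?hausdorff_measure_ge0.
  rewrite (@le_trans _ _ (Hm (A 1%N)))// ?hausdorff_measureS//.
  by rewrite (le_trans _ (alternate 1%N N))// leeDl ?hausdorff_measure_ge0.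
have sumS : (\sum_(0 <= k <oo) Hm (S k) < +oo)%E.
  apply: (@le_lt_trans _ _ (Hm (A 0%N) + Hm (A 0%N))%E); last by rewrite lte_add_pinfty.
  apply: lime_le; first by apply: is_cvg_nneseries => *; exact: hausdorff_measure_ge0.
  by near=> N; rewrite big_mkord bound.
have tail := @nneseries_tail_cvg _ _ xpredT sumS (fun k _ => hausdorff_measure_ge0 _).
have : \forall N \near \oo, (\sum_(N <= k <oo) Hm (S k) < e%:E)%E.
  apply: (tail [set x | (x < e%:E)%E]); apply: open_nbhs_nbhs; split.
    exact: open_ereal_lt_ereal.
  by rewrite /= lte_fin.
case=> N _ /(_ N (leqnn N)) /= NS; exists N.
apply: (@le_trans _ _ (Hm (\bigcap_k A k) + Hm (\bigcup_(k in ~` `I_N) S k))%E).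
  rewrite (le_trans _ (outer_measureU2 _ _ _))// hausdorff_measureS// => x ANx.
  have [h|/existsNP[j hj]] := pselect (forall k, A k x); first by left => k _.
  right.
  (* The first index at which [x] leaves the sequence identifies its shell; it exceeds [N] since [x]
     lies in [A N]. *)
  have ex : exists k, ~~ `[< A k x >] by exists j; apply/asboolPn.
  case: (ex_minnP ex) => k /asboolPn Akx mink.
  have Nk : (N < k)%N.
    by rewrite ltnNge; apply/negP => kN; apply: Akx; exact: Amono ANx.
  case: k Nk Akx mink => // k Nk Akx mink; exists k.
    by apply/negP; rewrite -leqNgt.
  split => //; apply: contrapT => /asboolPn /mink; by rewrite ltnn.
rewrite leeD2l// (le_trans _ (ltW NS))//.
exact: outer_measure_sigma_subadditive_tail.
Unshelve. all: by end_near. Qed.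

End hausdorff_metric.

Section similarity.
Context (R : realType) (n m : nat).
Implicit Types A B : set 'rV[R]_n.
Local Notation Hm := (@hausdorff_measure R n m).

Lemma hausdorff_measure_translate A (a : 'rV[R]_n) : Hm [set x + a | x in A] = Hm A.
Proof.
have h B (b : 'rV[R]_n) : (Hm [set (x + b)%R | x in B] <= Hm B)%E.
  have := @hausdorff_measure_lipschitz _ n n m (fun x => x + b) 1 B ltr01.
  rewrite expr1n mul1e; apply => x y _ _.
  by rewrite mul1r opprD addrACA subrr addr0.
apply/eqP; rewrite eq_le h/=.
rewrite -[X in (Hm X <= _)%E](_ : [set x - a | x in [set x + a | x in A]] = A)//.
rewrite image_comp; apply/seteqP; split => [_ [x Ax <-] /=|x Ax /=]; first by rewrite addrK.
by exists x => //=; rewrite addrK.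
Qed.

Lemma hausdorff_measure_scale A (t : R) : 0 < t ->
  Hm [set t *: x | x in A] = ((t ^+ m)%:E * Hm A)%E.
Proof.
have h B b : 0 < b -> (Hm [set b *: x | x in B] <= (b ^+ m)%:E * Hm B)%E.
  move=> b0; apply: hausdorff_measure_lipschitz => // x y _ _.
  by rewrite -scalerBr enormZ gtr0_norm.
move=> t0; apply/eqP; rewrite eq_le h//=.
have -> : t ^+ m = (t^-1 ^+ m)^-1 by rewrite exprVn invrK.
rewrite lee_pdivrMl ?exprn_gt0 ?invr_gt0//.
rewrite -[X in (Hm X <= _)%E](_ : [set t^-1 *: x | x in [set t *: x | x in A]] = A).
  by apply: h; rewrite invr_gt0.
rewrite image_comp; apply/seteqP; split => [_ [x Ax <-] /=|x Ax /=].
  by rewrite scalerA mulVf ?scale1r// gt_eqF.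
by exists x => //=; rewrite scalerA mulVf ?scale1r// gt_eqF.
Qed.

End similarity.

Lemma outer_measure_bigU (T : Type) (R : realType)
    (mu : {outer_measure set T -> \bar R}) (I : Type) (s : seq I) (P : pred I)
    (F : I -> set T) :
  (mu (\big[setU/set0]_(i <- s | P i) F i) <= \sum_(i <- s | P i) mu (F i))%E.
Proof.
elim: s => [|i s ih]; first by rewrite !big_nil outer_measure0.
rewrite !big_cons; case: ifP => // _.
by rewrite (le_trans (outer_measureU2 _ _ _))// leeD2l.
Qed.

(** * Boxes, grids and the measure of the unit cube *)

Section boxes.
Context (R : realType) (m : nat).
Implicit Types (a b x y : 'rV[R]_m).

Definition box a b : set 'rV[R]_m :=
  [set x | forall i, a ord0 i <= x ord0 i < b ord0 i].

Lemma box_translate a b c : [set x + c | x in box a b] = box (a + c) (b + c).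
Proof.
apply/seteqP; split => [_ [x hx <-] i|x hx]; first by rewrite !mxE lerD2r ltrD2r.
exists (x - c); rewrite ?subrK// => i.
by have := hx i; rewrite !mxE lerBrDr ltrBlDr.
Qed.

Lemma box_scale a b t : 0 < t -> [set t *: x | x in box a b] = box (t *: a) (t *: b).
Proof.
move=> t0; apply/seteqP; split => [_ [x hx <-] i|x hx].
  by rewrite !mxE ler_pM2l// ltr_pM2l.
exists (t^-1 *: x); last by rewrite scalerA mulfV ?scale1r// gt_eqF.
move=> i; have := hx i; rewrite !mxE => /andP[h1 h2].
by rewrite ler_pdivlMl// ltr_pdivrMl// h1 h2.
Qed.

(* Half-open cube of side h with corner a + h f; the cells tile the orthant at a. *)
Definition grid_cell (a : 'rV[R]_m) (h : R) N (f : {ffun 'I_m -> 'I_N}) : set 'rV[R]_m :=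
  box (a + h *: \row_i (f i)%:R) (a + h *: \row_i (f i).+1%:R).

Lemma grid_cell_diff a h N (f : {ffun 'I_m -> 'I_N}) x y : 0 < h -> grid_cell a h f x -> grid_cell a h f y ->
  `|x - y| <= h.
Proof.
move=> h0 hx hy; apply: norm_rV_le => [|i]; first exact: ltW.
have := hx i; have := hy i; rewrite !mxE -natr1 mulrDr mulr1 !addrA ler_norml.
move: (a ord0 i + _) (x ord0 i) (y ord0 i) => u v w /andP[? ?] /andP[? ?].
by apply/andP; split; lra.
Qed.

Lemma grid_cell_cover a h N x : 0 < h ->
  (forall i, a ord0 i <= x ord0 i < a ord0 i + N%:R * h) ->
  exists f : {ffun 'I_m -> 'I_N}, grid_cell a h f x.
Proof.
move=> h0 hx; pose t i := Num.trunc ((x ord0 i - a ord0 i) / h).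
have ti i : (t i)%:R * h <= x ord0 i - a ord0 i < (t i).+1%:R * h.
  have := hx i => /andP[h1 h2].
  by rewrite -ler_pdivlMr// -ltr_pdivrMr// truncn_itv// divr_ge0 ?subr_ge0// ltW.
have tN i : (t i < N)%N.
  rewrite -(ltr_nat R) -(ltr_pM2r h0); have := ti i; have := hx i.
  by move=> /andP[h1 h2] /andP[h3 h4]; rewrite (le_lt_trans h3)// ltrBlDl.
exists [ffun i => Ordinal (tN i)] => i; rewrite !mxE !ffunE/=.
by have := ti i; rewrite lerBrDl ltrBlDl !(mulrC h).
Qed.

(** Subtracting the least such index [k0] injects them into [W.+1] values, because any two of them
    differ by less than [2 * e * N]. *)
Lemma card_near_grid (N : nat) (x e : R) : (0 < N)%N -> 0 < e ->
  (#|[pred k : 'I_N | `|k%:R / N%:R - x| < e]|)%:R <= 2 * e * N%:R + 1.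
Proof.
move=> N0 e0; have N0' : 0 < N%:R :> R by rewrite ltr0n.
set P := [pred k : 'I_N | _].
have [P0|[k0 Pk0 mink]] : P =i pred0 \/ exists2 k0, P k0 & forall k, P k -> (k0 <= k)%N.
  have [k0 Pk0|P0] := pickP P; last by left.
  right; case: (arg_minnP (fun k : 'I_N => nat_of_ord k) Pk0) => k Pk mk.
  by exists k.
  by rewrite (eq_card P0) card0 addr_ge0// !mulr_ge0// ltW.
pose W := Num.trunc (2 * e * N%:R).
have eN : 0 <= 2 * e * N%:R by rewrite !mulr_ge0// ltW.
apply: (@le_trans _ _ (W.+1)%:R); last first.
  by rewrite -natr1 lerD2r; have /andP[] := truncn_itv eN.
rewrite ler_nat.
pose g (k : 'I_N) : 'I_W.+1 := inord (k - k0).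
apply: (@leq_trans #|[set g k | k in P]%SET|); last first.
  by rewrite (leq_trans (max_card _))// card_ord.
rewrite card_in_imset// => k k' Pk Pk' /(congr1 val) /=.
have kW j : P j -> (j - k0 < W.+1)%N.
  move=> Pj; rewrite -(ltr_nat R).
  have /andP[_] := truncn_itv eN; apply: le_lt_trans.
  rewrite natrB ?mink//; move: Pj Pk0; rewrite /= => Pj Pk0'.
  rewrite -ler_pdivrMr// mulrBl ltW//.
  rewrite (_ : _ - _ = (j%:R / N%:R - x) - (k0%:R / N%:R - x)); last by ring.
  by rewrite (le_lt_trans (ler_norm _))// (le_lt_trans (ler_normB _ _))// mulr2n mulrDl mul1r ltrD.
rewrite !inordK ?kW// => kk'.
apply/val_inj => /=; have := mink _ Pk; have := mink _ Pk' => h1 h2.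
by rewrite -(subnK h1) -(subnK h2) kk'.
Qed.

(** Volume by counting: of the [N ^ m] grid points of the cube, a max-norm ball of radius [e_ j]
    holds at most [(2 * e_ j * N + 1) ^ m]. Once [e_ j * N >= 1] this is at most
    [(3 * e_ j * N) ^ m], whence the factor 3. *)
Lemma cube_cover_volume (K : nat) (x_ : nat -> 'rV[R]_m) (e_ : nat -> R) :
  (forall j, 0 < e_ j) ->
  (forall x : 'rV[R]_m, (forall i, 0 <= x ord0 i <= 1) ->
     exists2 j, (j < K)%N & `|x - x_ j| < e_ j) ->
  1 <= \sum_(j < K) (3 * e_ j) ^+ m.
Proof.
move=> e0 cov.
have [N N0 Ne] : exists2 N, (0 < N)%N & forall j : 'I_K, 1 <= e_ j * N%:R.
  exists (\sum_(j < K) (Num.trunc (e_ j)^-1).+1).+1 => // j.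
  have ej := e0 j; rewrite -ler_pdivrMl// mulr1.
  have ej' : 0 <= (e_ j)^-1 by rewrite invr_ge0 ltW.
  have /andP[_ /ltW h] := truncn_itv ej'.
  rewrite (le_trans h)// ler_nat.
  by rewrite (bigD1 j)//= leqW// leq_addr.
have N0' : 0 < N%:R :> R by rewrite ltr0n.
pose pt (f : {ffun 'I_m -> 'I_N}) : 'rV[R]_m := \row_i ((f i)%:R / N%:R).
have ptQ f i : 0 <= pt f ord0 i <= 1.
  by rewrite mxE divr_ge0//= ler_pdivrMr// mul1r ler_nat ltnW.
pose S (j : 'I_K) := [set f : {ffun 'I_m -> 'I_N} | (`|pt f - x_ j| < e_ j)%R]%SET.
have : (N ^ m <= \sum_(j < K) #|S j|)%N.
  rewrite -{1}(card_ord N) -{1}(card_ord m) -card_ffun -cardsT.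
  apply: (@leq_trans #|(\bigcup_(j < K) S j)%SET|).
    apply: subset_leq_card; apply/fintype.subsetP => f _; apply/finset.bigcupP.
    by have [j jK h] := cov _ (ptQ f); exists (Ordinal jK); rewrite ?inE.
  elim/big_rec2: _ => [|j k A _ ih]; first by rewrite cards0.
  by rewrite (leq_trans (leq_card_setU _ _))// leq_add2l.
rewrite -(ler_nat R) natr_sum natrX => /le_trans h.
rewrite -(ler_pM2r (exprn_gt0 m N0')) mul1r mulr_suml.
apply: h; apply: ler_sum => j _.
rewrite -exprMn -mulrA.
apply: (@le_trans _ _ ((2 * e_ j * N%:R + 1) ^+ m)); last first.
  rewrite lerXn2r ?nnegrE ?addr_ge0 ?mulr_ge0// ?(ltW (e0 _))//.
  by have := Ne j; lra.
pose F i := [pred k : 'I_N | `|k%:R / N%:R - x_ j ord0 i| < e_ j].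
apply: (@le_trans _ _ (#|(family F : simpl_pred {ffun 'I_m -> 'I_N})|)%:R).
  rewrite ler_nat; apply: subset_leq_card; apply/fintype.subsetP => f.
  rewrite inE => hf; apply/familyP => i; rewrite inE.
  by apply: le_lt_trans hf; have := ler_norm_coord (pt f - x_ j) i; rewrite !mxE.
rewrite card_family foldrE big_map big_enum/= natr_prod.
rewrite -[m in leRHS]card_ord -prodr_const.
apply: ler_prod => i _; rewrite ler0n/=.
exact: card_near_grid.
Qed.

End boxes.

Section unit_cube.
Context (R : realType) (m : nat) (m_gt0 : (0 < m)%N).
Local Notation Hm := (@hausdorff_measure R m m).
Local Notation kappa := (unit_ball_volume R m / 2 ^+ m).

Definition unit_cube : set 'rV[R]_m := box 0 (const_mx 1).

(** The grid of mesh [1 / N] has [N ^ m] cells of Euclidean diameter at most [m / N], so the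
    premeasure is at most [kappa * m ^ m] at every scale. *)
Lemma hausdorff_measure_unit_cube_lty : (Hm unit_cube < +oo)%E.
Proof.
apply: (@le_lt_trans _ _ (kappa * m%:R ^+ m)%:E); last exact: ltry.
apply: hausdorff_measure_le => d d0.
pose N := (Num.trunc (m%:R / d)).+1.
have N0 : 0 < N%:R :> R by rewrite ltr0n.
have md : m%:R / N%:R <= d.
  rewrite ler_pdivrMr// mulrC -ler_pdivrMr// ltW//.
  by have /andP[] := @truncn_itv R (m%:R / d) (divr_ge0 (ler0n _ _) (ltW d0)).
have diamc (f : {ffun 'I_m -> 'I_N}) : (diam (grid_cell (0 : 'rV[R]_m) N%:R^-1 f) <= (m%:R / N%:R)%:E)%E.
  apply: diam_le => x y fx fy; rewrite lee_fin (le_trans (enorm_le_norm _))//.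
  by rewrite ler_wpM2l// (grid_cell_diff _ fx fy)// invr_gt0.
apply: (@le_trans _ _ (\sum_(f : {ffun 'I_m -> 'I_N})
    hausdorff_premeasure m d (grid_cell (0 : 'rV[R]_m) N%:R^-1 f))%E).
  rewrite (le_trans _ (outer_measure_bigU _ _ _ _))// le_outer_measure// => x Qx.
  have [||f fx] := @grid_cell_cover R m 0 N%:R^-1 N x.
  - by rewrite invr_gt0.
  - by move=> i; have := Qx i; rewrite !mxE mulfV ?gt_eqF// add0r.
  by rewrite -bigcup_seq; exists f => //=; rewrite mem_index_enum.
apply: (@le_trans _ _ (\sum_(f : {ffun 'I_m -> 'I_N}) (kappa * (m%:R / N%:R) ^+ m)%:E)%E).
  apply: lee_sum => f _; rewrite (le_trans (hausdorff_premeasure_le_weight _ _))//.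
    by rewrite (le_trans (diamc f))// lee_fin.
  by apply: hausdorff_weight_le => //; rewrite divr_ge0.
rewrite sumEFin sumr_const card_ffun !card_ord lee_fin expr_div_n.
by rewrite -[leLHS]mulr_natr natrX -!mulrA mulVf ?mulr1// expf_neq0// gt_eqF.
Qed.

(** Members of a countable cover are enlarged to open balls; by compactness of the closed cube
    finitely many suffice, and [cube_cover_volume] bounds the sum of the powers of their radii from
    below. *)
Lemma hausdorff_measure_closed_unit_cube_gt0 :
  (0 < Hm [set x : 'rV[R]_m | forall i, (0 <= x ord0 i <= 1)%R])%E.
Proof.
set Q := [set x | _].
have cQ : compact Q.
  rewrite [Q](_ : _ = [set v : 'rV[R]_m | forall i, `[0, 1]%classic (v ord0 i)]).
    by apply: (@rV_compact R m (fun=> `[0, 1]%classic)) => _; exact: segment_compact.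
  by apply/seteqP; split => x h i; have := h i; rewrite /= in_itv.
(* Total enlargement allowed: it keeps the sum of [6 ^+ m * r i ^+ m] at most 1/2, so that half of
   the volume 1 is left for the diameters. *)
pose s := (2 * 6 ^+ m)^-1 : R.
have s0 : 0 < s by rewrite invr_gt0 mulr_gt0 ?exprn_gt0.
suff h : ((kappa * (2 * 12 ^+ m)^-1)%:E <= hausdorff_premeasure m 1 Q)%E.
  apply: (lt_le_trans _ (le_trans h (hausdorff_premeasure_le_measure _ _ ltr01))).
  by rewrite lte_fin mulr_gt0 ?kappa_gt0// invr_gt0 mulr_gt0 ?exprn_gt0.
apply: le_ereal_inf_tmp => _ [F [QF Fd] <-].
pose d i := if F i == set0 then 0 else fine (diam (F i)).
have diamE i x : F i x -> diam (F i) = (d i)%:E.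
  move=> Fx; have F0 : F i !=set0 by exists x.
  rewrite /d ifF; last by apply/negbTE/set0P.
  by rewrite fineK// ge0_fin_numE ?diam_ge0// (le_lt_trans (Fd i))// ltry.
have d0 i : 0 <= d i.
  by rewrite /d; case: ifPn => // /set0P F0; rewrite fine_ge0// diam_ge0.
pose x_ i := xget 0 (F i).
pose r i := s / 2 ^+ i.+1.
have r0 i : 0 < r i by rewrite divr_gt0// exprn_gt0.
(* The summand [r i] keeps the radius positive, and the inclusion in the open ball strict, when
   [F i] is a single point. *)
pose e i := 2 * d i + r i.
have e0 i : 0 < e i by rewrite ltr_wpDl// mulr_ge0.
have Fball i x : F i x -> `|x - x_ i| < e i.
  move=> Fx; have Fxi : F i (x_ i) by apply: xgetPex; exists x.
  rewrite (le_lt_trans (norm_le_enorm _))//.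
  have := enorm_le_diam Fx Fxi; rewrite (diamE _ _ Fx) lee_fin => /le_lt_trans; apply.
  by rewrite /e; have := r0 i; have := d0 i; lra.
have [K covK] : exists K, forall x, Q x -> exists2 j, (j < K)%N & `|x - x_ j| < e j.
  move: cQ; rewrite compact_cover => /(_ nat setT (fun i => ball (x_ i) (e i))).
  case=> [i _||D _ QD].
  - exact: ball_open.
  - by move=> x /QF[i _ /Fball h]; exists i => //; rewrite -ball_normE /= distrC.
  exists (\max_(i <- D) i).+1 => x /QD[i /= iD]; rewrite -ball_normE /= distrC => h.
  by exists i => //; rewrite ltnS; apply: (@leq_bigmax_seq _ _ xpredT id).
have := @cube_cover_volume R m K x_ e e0 (fun x hx => covK x hx).
(* [e i] is at most twice the larger of [2 * d i] and [r i], which gives the factors 12 and 6. *)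
have ebnd i : (3 * e i) ^+ m <= 12 ^+ m * d i ^+ m + 6 ^+ m * r i ^+ m.
  rewrite -!exprMn; have [h|h] := leP (2 * d i) (r i).
    rewrite (@le_trans _ _ ((6 * r i) ^+ m))// ?lerDr ?exprn_ge0// ?mulr_ge0//.
    by have := ltW (r0 i) => ri; rewrite lerXn2r ?nnegrE ?mulr_ge0 ?(ltW (e0 i))// /e; lra.
  rewrite (@le_trans _ _ ((12 * d i) ^+ m))// ?lerDl ?exprn_ge0// ?mulr_ge0//; last exact: ltW.
  by have di := d0 i; rewrite lerXn2r ?nnegrE ?mulr_ge0 ?(ltW (e0 i))// /e; lra.
have sumr : \sum_(i < K) 6 ^+ m * r i ^+ m <= 2^-1.
  have rs : \sum_(i < K) r i <= s.
    suff -> : \sum_(i < K) r i = s - s / 2 ^+ K.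
      by rewrite gerBl divr_ge0 ?exprn_ge0// ltW.
    elim: (K) => [|k ih]; first by rewrite big_ord0 expr0 divr1 subrr.
    rewrite big_ord_recr/= ih /r exprS; field.
    by rewrite expf_neq0.
  rewrite -mulr_sumr (@le_trans _ _ (6 ^+ m * s))//; last first.
    by rewrite /s invfM mulrCA mulfV ?mulr1// expf_neq0.
  rewrite ler_wpM2l ?exprn_ge0// (le_trans _ rs)//; apply: ler_sum => i _.
  have r1 : r i <= 1.
    rewrite ler_pdivrMr ?exprn_gt0// mul1r (@le_trans _ _ 1)//.
      rewrite invf_le1 ?mulr_gt0 ?exprn_gt0//.
      have : 1 <= 6 ^+ m :> R by rewrite exprn_ege1// ler1n.
      by lra.
    by rewrite exprn_ege1// ler1n.
  by rewrite -[leRHS]expr1 ler_wiXn2l// ltW.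
move=> /le_trans h; have {}h := h _ (ler_sum _ (fun (i : 'I_K) _ => ebnd i)).
move: h; rewrite big_split/= -mulr_sumr => h1.
have {}h1 : (2 * 12 ^+ m)^-1 <= \sum_(i < K) d i ^+ m.
  rewrite invfM ler_pdivrMr ?exprn_gt0// mulrC; lra.
apply: (@le_trans _ _ (\sum_(i < K) (kappa * d i ^+ m)%:E)%E).
  by rewrite sumEFin lee_fin -mulr_sumr ler_wpM2l// ltW// kappa_gt0.
apply: (@le_trans _ _ (\sum_(i < K) hausdorff_weight m (F i))%E).
  apply: lee_sum => i _; have [F0|/set0P[x Fx]] := eqVneq (F i) set0.
    rewrite /d F0 eqxx expr0n gtn_eqF// mulr0; exact: hausdorff_weight_ge0.
  rewrite /hausdorff_weight ifF; last by apply/negbTE/set0P; exists x.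
  by rewrite (diamE _ _ Fx) -EFin_expe -EFinM.
rewrite -(big_mkord xpredT (fun i => hausdorff_weight m (F i))).
by apply: nneseries_lim_ge => i _ _; exact: hausdorff_weight_ge0.
Qed.

End unit_cube.

(** * Cutting along hyperplanes and the measure of boxes *)

Section cube_measure.
Context (R : realType) (m : nat) (m_gt0 : (0 < m)%N).
Implicit Types (a b x y : 'rV[R]_m) (A Y : set 'rV[R]_m).
Local Notation Hm := (@hausdorff_measure R m m).

(** Proportionality constant between Hausdorff measure and volume, extracted as a real number. *)
Definition cube_const : R := fine (Hm (@unit_cube R m)).

Lemma cube_constE : Hm (@unit_cube R m) = cube_const%:E.
Proof.
rewrite fineK// ge0_fin_numE ?hausdorff_measure_ge0//.
exact: hausdorff_measure_unit_cube_lty.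
Qed.

Lemma hausdorff_measure_cube a (h : R) : 0 < h ->
  Hm (box a (a + const_mx h)) = (cube_const * h ^+ m)%:E.
Proof.
move=> h0; rewrite mulrC EFinM -cube_constE -hausdorff_measure_scale//.
rewrite box_scale// scaler0 -[RHS](hausdorff_measure_translate _ _ a) box_translate add0r.
rewrite [_ + a]addrC; congr (Hm (box _ (_ + _))).
by apply/rowP => i; rewrite !mxE mulr1.
Qed.

(** The closed unit cube, known to have positive measure, lies in the half-open cube of side 2. *)
Lemma cube_const_gt0 : 0 < cube_const.
Proof.
rewrite -lte_fin -cube_constE.
rewrite -(@pmule_rgt0 _ (2 ^+ m)%:E) ?lte_fin ?exprn_gt0// -hausdorff_measure_scale//.
apply: (lt_le_trans (hausdorff_measure_closed_unit_cube_gt0 R m_gt0)).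
rewrite box_scale// hausdorff_measureS// => x hx i; rewrite !mxE mulr0 mulr1.
by have /andP[-> /le_lt_trans ->//] := hx i; rewrite ltr1n.
Qed.

Lemma hausdorff_measure_bounded_lty A (D : R) :
  (forall x, A x -> `|x| <= D) -> (Hm A < +oo)%E.
Proof.
move=> AD; pose D' := Num.max D 0 + 1.
have D0 : 0 < D' by rewrite ltr_wpDl// le_max lexx orbT.
apply: (@le_lt_trans _ _ (Hm (box (const_mx (- D')) (const_mx (- D') + const_mx (2 * D'))))).
  apply: hausdorff_measureS => x Ax i; rewrite !mxE.
  have := ler_norm_coord x i; have := AD _ Ax.
  have : D <= Num.max D 0 by rewrite le_max lexx.
  rewrite ler_norml => h1 h2 /andP[h3 h4]; apply/andP; split; rewrite /D'; lra.
by rewrite hausdorff_measure_cube ?ltry// mulr_gt0.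
Qed.

(** The nontrivial half of Carathéodory's criterion for a half-space. Removing the thin slab [A k]
    below the hyperplane leaves two separated parts, and the measure of the slabs tends to 0 because
    they decrease to the empty set. *)
Lemma hausdorff_measure_halfspaces Y (i : 'I_m) (t : R) :
  (Hm (Y `&` [set x | (x ord0 i < t)%R]) + Hm (Y `&` [set x | (t <= x ord0 i)%R])
   <= Hm Y)%E.
Proof.
have [->|Yoo] := eqVneq (Hm Y) +oo%E; first exact: leey.
have Yfin : (Hm Y < +oo)%E by rewrite ltey.
apply/lee_addgt0Pr => e e0.
pose A k := Y `&` [set x | t - k.+1%:R^-1 < x ord0 i < t].
have inv_lt k : (k.+2%:R^-1 < k.+1%:R^-1 :> R) by rewrite ltf_pV2 ?posrE ?ltr_nat.
have [||k|k Ak] := @hausdorff_measure_cvg R m m A e e0.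
- by rewrite (le_lt_trans _ Yfin)// hausdorff_measureS//; exact: subIsetl.
- move=> k x [Yx /andP[h1 h2]]; split => //; apply/andP; split => //.
  by apply: le_lt_trans h1; rewrite lerD2l lerN2 ltW// inv_lt.
- exists (k.+2%:R^-1 - k.+3%:R^-1); first by rewrite subr_gt0 inv_lt.
  move=> x y [[Yx /andP[h1 h2]] nAx] [Yy /andP[h3 h4]].
  rewrite distrC (le_trans _ (le_trans (ler_norm _) (ler_norm_coord (y - x) i)))// !mxE.
  have : x ord0 i <= t - k.+2%:R^-1.
    by rewrite leNgt; apply/negP => h; apply: nAx; split => //; apply/andP.
  move: h3; move: (k.+2%:R^-1) (k.+3%:R^-1) => c d; lra.
have A0 : \bigcap_k A k = set0.
  rewrite -subset0 => x Ax.
  have xt : 0 < t - x ord0 i.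
    by have [_ /= /andP[_]] := Ax 0%N I; rewrite subr_gt0.
  have zi : 0 <= (t - x ord0 i)^-1 by rewrite invr_ge0 ltW.
  have /andP[_ zN] := truncn_itv zi.
  have [_ /andP[h _]] := Ax (Num.trunc (t - x ord0 i)^-1) I.
  have : (Num.trunc (t - x ord0 i)^-1).+1%:R^-1 < t - x ord0 i.
    by rewrite -[ltRHS]invrK ltf_pV2 ?posrE ?invr_gt0// ltr0n.
  by move: h; move: (_%:R^-1) => c; lra.
rewrite A0 outer_measure0 add0e in Ak.
pose B := Y `&` [set x | x ord0 i <= t - k.+1%:R^-1].
pose C := Y `&` [set x | t <= x ord0 i].
apply: (@le_trans _ _ (Hm B + Hm (A k) + Hm C)%E).
  rewrite leeD2r// (le_trans _ (outer_measureU2 _ _ _))// hausdorff_measureS//.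
  move=> x [Yx /= xt]; have [h|h] := leP (x ord0 i) (t - k.+1%:R^-1).
    by left.
  by right; split => //=; rewrite h.
rewrite -addeA (addeC (Hm (A k))) addeA; apply: leeD => //.
apply: (@le_trans _ _ (Hm (B `|` C))).
  apply: hausdorff_measure_sep; exists k.+1%:R^-1; first by rewrite invr_gt0.
  move=> x y [Yx /= h1] [Yy /= h2].
  rewrite distrC (le_trans _ (le_trans (ler_norm _) (ler_norm_coord (y - x) i)))// !mxE.
  by move: h1; move: (_%:R^-1) => c; lra.
by apply: hausdorff_measureS => x [[]|[]].
Qed.

Definition set_coord (u : 'rV[R]_m) (i : 'I_m) (t : R) : 'rV[R]_m :=
  \row_j (if j == i then t else u ord0 j).

Lemma set_coordE u i t j : set_coord u i t ord0 j = if j == i then t else u ord0 j.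
Proof. by rewrite mxE. Qed.

Lemma set_coord_id u i : set_coord u i (u ord0 i) = u.
Proof. by apply/rowP => j; rewrite mxE; case: eqP => // ->. Qed.

Lemma hausdorff_measure_box_fin a b : Hm (box a b) \is a fin_num.
Proof.
rewrite ge0_fin_numE ?hausdorff_measure_ge0//.
apply: (@hausdorff_measure_bounded_lty _ (`|a| + `|b|)) => x hx.
apply: norm_rV_le => [|i]; first by rewrite addr_ge0.
have /andP[h1 h2] := hx i; have := ler_norm_coord a i; have := ler_norm_coord b i.
rewrite !ler_norml => /andP[h3 h4] /andP[h5 h6].
by have := normr_ge0 a; have := normr_ge0 b; move=> *; apply/andP; split; lra.
Qed.

Let v u := fine (Hm (box 0 u)).

Let vE u : Hm (box 0 u) = (v u)%:E.
Proof. by rewrite fineK// hausdorff_measure_box_fin. Qed.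

Let v_ge0 u : 0 <= v u.
Proof. by rewrite fine_ge0// hausdorff_measure_ge0. Qed.

Let shift_box u i t t' :
  Hm (box (set_coord 0 i t) (set_coord u i (t + t'))) = Hm (box 0 (set_coord u i t')).
Proof.
rewrite -[RHS](hausdorff_measure_translate _ _ (set_coord 0 i t)) box_translate add0r.
congr (Hm (box _ _)); apply/rowP => j; rewrite !mxE; case: ifP => _; last by rewrite addr0.
by rewrite addrC.
Qed.

Let le_v u i s t : s <= t -> v (set_coord u i s) <= v (set_coord u i t).
Proof.
move=> st; rewrite -lee_fin -!vE hausdorff_measureS// => x hx j.
have := hx j; rewrite !set_coordE; case: eqP => // _ /andP[-> h].
exact: lt_le_trans h st.
Qed.

Let v_subD u i s t : 0 <= s -> 0 <= t ->
  v (set_coord u i (s + t)) <= v (set_coord u i s) + v (set_coord u i t).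
Proof.
move=> s0 t0; rewrite -lee_fin EFinD -!vE -(shift_box u i s t).
rewrite (le_trans _ (outer_measureU2 _ _ _))// hausdorff_measureS// => x hx.
have [h|h] := ltP (x ord0 i) s; [left|right] => j; have := hx j.
  by rewrite !set_coordE; case: eqP => // -> /andP[-> _].
by rewrite !set_coordE !mxE; case: eqP => // -> /andP[_ ->]; rewrite h.
Qed.

Let v_supD u i s t : 0 <= s -> 0 <= t ->
  v (set_coord u i s) + v (set_coord u i t) <= v (set_coord u i (s + t)).
Proof.
move=> s0 t0; rewrite -lee_fin EFinD -!vE -(shift_box u i s t).
rewrite (le_trans _ (hausdorff_measure_halfspaces _ i s))// leeD// hausdorff_measureS//.
  move=> x hx; split => [j|/=]; have := hx _.
    move=> /(_ j); rewrite !set_coordE; case: eqP => // _ /andP[-> h]/=.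
    by rewrite (lt_le_trans h)// lerDl.
  by move=> /(_ i); rewrite set_coordE eqxx => /andP[].
move=> x hx; split => [j|/=]; have := hx _.
  move=> /(_ j); rewrite !set_coordE; case: eqP => // _; rewrite mxE => /andP[h ->].
  by rewrite (le_trans s0 h).
by move=> /(_ i); rewrite !set_coordE eqxx => /andP[].
Qed.

(** A monotone additive function on the half-line is linear; here the lower bound. Subadditivity
    bounds the value at [n * t] from above by [n] times that at [t], superadditivity and
    monotonicity bound it from below by [n * t - 1] times that at 1. *)
Let v_mul_le u i t : 0 <= t -> t * v (set_coord u i 1) <= v (set_coord u i t).
Proof.
move=> t0.
have v0 : v (set_coord u i 0) = 0.
  rewrite /v (_ : box _ _ = set0) ?outer_measure0// -subset0 => x /(_ i).
  by rewrite set_coordE eqxx mxE; case/andP => /le_lt_trans h /h; rewrite ltxx.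
have sub n : v (set_coord u i (n%:R * t)) <= n%:R * v (set_coord u i t).
  elim: n => [|n ih]; first by rewrite !mul0r v0.
  rewrite -natr1 mulrDl mul1r (le_trans (v_subD _ _ _ _))// ?mulr_ge0//.
  by rewrite mulrDl mul1r lerD2r.
have sup n : n%:R * v (set_coord u i 1) <= v (set_coord u i n%:R).
  elim: n => [|n ih]; first by rewrite mul0r.
  rewrite -natr1 mulrDl mul1r (le_trans _ (v_supD _ _ _ _))// ?ler01//.
  by rewrite lerD2r.
have main n : (n%:R * t - 1) * v (set_coord u i 1) <= n%:R * v (set_coord u i t).
  rewrite (le_trans _ (sub n))//.
  have /andP[h1 h2] := @truncn_itv R (n%:R * t) (mulr_ge0 (ler0n _ _) t0).
  rewrite (le_trans _ (le_v u i h1))// (le_trans _ (sup _))//.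
  by rewrite ler_wpM2r// lerBlDr ltW// natr1.
rewrite leNgt; apply/negP; rewrite -subr_gt0; set d := _ - _ => d0.
(* [main] amounts to [n * d <= v (set_coord u i 1)], which this [n] violates. *)
have := main (Num.trunc (v (set_coord u i 1) / d)).+1.
have /andP[_] := @truncn_itv R (v (set_coord u i 1) / d) (divr_ge0 (v_ge0 _) (ltW d0)).
set n := _.+1; rewrite ltr_pdivrMr// {1}/d; lra.
Qed.

(** From the unit cube, one edge after another is changed from 1 to its final length; in [step], the
    list [s] holds the coordinates still at length 1. *)
Lemma box_volume_le a b : (forall i, a ord0 i <= b ord0 i) ->
  ((cube_const * \prod_i (b ord0 i - a ord0 i))%:E <= Hm (box a b))%E.
Proof.
move=> ab; rewrite -(hausdorff_measure_translate _ _ (- a)) box_translate subrr.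
set u := b - a.
have u0 i : 0 <= u ord0 i by rewrite !mxE subr_ge0.
rewrite (eq_bigr (fun i => u ord0 i)) => [|i _]; last by rewrite !mxE.
rewrite vE lee_fin.
have step (s : seq 'I_m) : uniq s ->
    (\prod_(i <- s) u ord0 i) * v (\row_j if j \in s then 1 else u ord0 j) <= v u.
  elim: s => [_|i s ih /= /andP[is_ us]].
    rewrite big_nil mul1r (_ : \row_j _ = u)//; apply/rowP => j; by rewrite mxE.
  rewrite (le_trans _ (ih us))// big_cons [u ord0 i * _]mulrC -mulrA.
  rewrite ler_wpM2l//; first exact: prodr_ge0.
  set w := \row_j (if j \in s then _ else _).
  have wi : w ord0 i = u ord0 i by rewrite mxE (negbTE is_).
  rewrite -[in leRHS](set_coord_id w i) wi (le_trans _ (v_mul_le _ _ (u0 i)))//.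
  rewrite le_eqVlt; apply/orP; left; apply/eqP; congr (_ * v _).
  by apply/rowP => j; rewrite !mxE inE; case: eqP.
have := step (index_enum _) (index_enum_uniq _); rewrite mulrC.
rewrite (_ : \row_j _ = const_mx 1); last by apply/rowP => j; rewrite !mxE mem_index_enum.
by [].
Qed.

End cube_measure.

(** * The Brunn-Minkowski inequality *)

Section real_lemmas.
Context (R : realType).

Lemma exists_root (m : nat) (x : R) : (0 < m)%N -> 0 <= x ->
  exists2 r, 0 <= r & r ^+ m = x.
Proof.
move=> m0 x0; exists (x `^ m%:R^-1); first exact: powR_ge0.
by rewrite -powR_mulrn ?powR_ge0// -powRrM mulVf ?powRr1// pnatr_eq0 -lt0n.
Qed.

(** The Brunn-Minkowski inequality for two boxes: AM-GM for the ratios [u i / (u i + v i)] and for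
    [v i / (u i + v i)], whose arithmetic means add up to 1. *)
Lemma prod_root_superadditive (m : nat) (u v : 'I_m -> R) (s t : R) :
  (0 < m)%N -> (forall i, 0 < u i) -> (forall i, 0 < v i) -> 0 <= s -> 0 <= t ->
  s ^+ m = \prod_i u i -> t ^+ m = \prod_i v i ->
  (s + t) ^+ m <= \prod_i (u i + v i).
Proof.
move=> m0 u0 v0 s0 t0 su tv.
have w0 i : 0 < u i + v i by rewrite addr_gt0.
have [w w_ge0 wm] := exists_root m0 (prodr_ge0 _ (fun i _ => ltW (w0 i)) : 0 <= \prod_(i < m) (u i + v i)).
have w_gt0 : 0 < w.
  rewrite lt_neqAle w_ge0 andbT eq_sym; have : w ^+ m != 0.
    by rewrite wm gt_eqF// prodr_gt0.
  by rewrite expf_eq0 m0.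
have agm (z : 'I_m -> R) (r : R) : (forall i, 0 < z i) -> 0 <= r -> r ^+ m = \prod_i z i ->
    r / w <= (\sum_i z i / (u i + v i)) / m%:R.
  move=> z0 r0 rz; rewrite -(@ler_pXn2r _ m)// ?nnegrE ?divr_ge0 ?sumr_ge0//; last first.
    by move=> i _; rewrite divr_ge0// ltW.
  rewrite expr_div_n rz wm -prodf_div.
  have [] := @leif_AGM R 'I_m predT (fun i => z i / (u i + v i)) _.
    by move=> i _; rewrite /= divr_ge0// ltW.
  by rewrite card_ord.
rewrite -wm lerXn2r ?nnegrE ?addr_ge0//.
rewrite -[leRHS]mul1r -ler_pdivrMr// mulrDl.
rewrite (le_trans (lerD (agm u s u0 s0 su) (agm v t v0 t0 tv)))//.
rewrite -mulrDl -big_split/= (eq_bigr (fun=> 1)) => [|i _].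
  by rewrite sumr_const card_ord mulfV// pnatr_eq0 -lt0n.
by rewrite -mulrDl mulfV// gt_eqF.
Qed.

(** Length of the part of the edge from [a] to [c] that lies below [t]; its continuity feeds the
    intermediate value theorem in [cut_exists]. *)
Lemma continuous_clipped_length (c a : R) :
  continuous (fun t : R => Num.max 0 (Num.min c t - a)).
Proof.
under eq_fun => t do rewrite maxr_absE minr_absE.
have h : continuous (fun t : R => (c + t - `|c - t|) / 2 - a : R^o).
  move=> t; apply: cvgB; last exact: cvg_cst.
  apply: cvgM; [|exact: cvg_cst]; apply: cvgB.
    by apply: cvgD; [exact: cvg_cst | exact: cvg_id].
  by apply: cvg_norm; apply: cvgB; [exact: cvg_cst | exact: cvg_id].
move=> t; apply: cvgM; [|exact: cvg_cst]; apply: cvgD.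
  by apply: cvgD; [exact: cvg_cst | exact: h].
by apply: cvg_norm; apply: cvgB; [exact: cvg_cst | exact: h].
Qed.

End real_lemmas.

Definition set_add (V : zmodType) (A B : set V) : set V := [set x + y | x in A & y in B].

Lemma set_addC (V : zmodType) (A B : set V) : set_add A B = set_add B A.
Proof.
by apply/seteqP; split => _ [x Ax [y By <-]]; exists y => //; exists x => //; rewrite addrC.
Qed.

(** * Finite unions of disjoint boxes *)

Section box_lists.
Context (R : realType) (m : nat) (m_gt0 : (0 < m)%N).
Local Notation boxT := ('rV[R]_m * 'rV[R]_m)%type.
Local Notation Hm := (@hausdorff_measure R m m).
Local Notation c0 := (cube_const R m).
Implicit Types (b : boxT) (l : seq boxT).

Definition proper_box b := [forall i, b.1 ord0 i < b.2 ord0 i].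

(** Disjointness of proper half-open boxes, stated through the separating coordinate hyperplane that
    the induction cuts along. *)
Definition disjoint_boxes b b' :=
  [exists i, (b.2 ord0 i <= b'.1 ord0 i) || (b'.2 ord0 i <= b.1 ord0 i)].

Definition box_list l := all proper_box l && pairwise disjoint_boxes l.

Definition box_volume b := \prod_i (b.2 ord0 i - b.1 ord0 i).

Definition list_volume l := \sum_(b <- l) box_volume b.

Definition list_union l : set 'rV[R]_m := [set x | exists2 b, b \in l & box b.1 b.2 x].

Definition lower_box i t b : boxT := (b.1, set_coord b.2 i (Num.min (b.2 ord0 i) t)).
Definition upper_box i t b : boxT := (set_coord b.1 i (Num.max (b.1 ord0 i) t), b.2).
(** The filter drops the boxes that would degenerate, so that the remaining ones stay proper. *)
Definition lower_list i t l := [seq lower_box i t b | b <- l & b.1 ord0 i < t].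
Definition upper_list i t l := [seq upper_box i t b | b <- l & t < b.2 ord0 i].

Let sub_box b b' := forall i, b'.1 ord0 i <= b.1 ord0 i /\ b.2 ord0 i <= b'.2 ord0 i.

Let lower_sub i t b : sub_box (lower_box i t b) b.
Proof. by move=> j; rewrite /= set_coordE; split => //; case: eqP => // ->; rewrite ge_min lexx. Qed.

Let upper_sub i t b : sub_box (upper_box i t b) b.
Proof. by move=> j; rewrite /= set_coordE; split => //; case: eqP => // ->; rewrite le_max lexx. Qed.

Let disjoint_sub a b a' b' : sub_box a a' -> sub_box b b' ->
  disjoint_boxes a' b' -> disjoint_boxes a b.
Proof.
move=> aa bb /existsP[i /orP h]; apply/existsP; exists i; apply/orP.
have [? ?] := aa i; have [? ?] := bb i.
by case: h => h; [left|right]; lra.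
Qed.

Let box_list_map (g : boxT -> boxT) (P : pred boxT) l :
  (forall b, sub_box (g b) b) ->
  (forall b, P b -> proper_box b -> proper_box (g b)) ->
  box_list l -> box_list [seq g b | b <- l & P b].
Proof.
move=> gs gp /andP[lp ld]; apply/andP; split.
  rewrite all_map all_filter; apply: sub_all lp => b pb; apply/implyP => Pb.
  exact: gp.
rewrite pairwise_map pairwise_filter//.
by apply: sub_pairwise ld => a b; exact: disjoint_sub.
Qed.

Lemma lower_list_ok i t l : box_list l -> box_list (lower_list i t l).
Proof.
apply: box_list_map => // b bt /forallP pb; apply/forallP => j /=.
by rewrite set_coordE; case: eqP => // ->; rewrite lt_min pb.
Qed.

Lemma upper_list_ok i t l : box_list l -> box_list (upper_list i t l).
Proof.
apply: box_list_map => // b bt /forallP pb; apply/forallP => j /=.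
by rewrite set_coordE; case: eqP => // ->; rewrite gt_max pb.
Qed.

Lemma lower_list_union i t l :
  list_union (lower_list i t l) `<=` list_union l `&` [set x | x ord0 i < t].
Proof.
move=> x [_ /mapP[b + ->] /= hx]; rewrite mem_filter => /andP[bt bl]; split.
  exists b => // j; have := hx j; have := (lower_sub i t b j).2.
  by move=> /= h /andP[-> /lt_le_trans ->].
by have := hx i; rewrite set_coordE eqxx lt_min => /andP[_ /andP[]].
Qed.

Lemma upper_list_union i t l :
  list_union (upper_list i t l) `<=` list_union l `&` [set x | t <= x ord0 i].
Proof.
move=> x [_ /mapP[b + ->] /= hx]; rewrite mem_filter => /andP[bt bl]; split.
  exists b => // j; have := hx j; have := (upper_sub i t b j).1.
  by move=> /= h /andP[/(le_trans h) -> ->].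
by have := hx i; rewrite set_coordE eqxx ge_max => /andP[/andP[]].
Qed.

Let cofactor_volume i b := \prod_(j | j != i) (b.2 ord0 j - b.1 ord0 j).

(** A dropped box has clipped length 0. This absorbs the filter of [lower_list] and leaves a volume
    that is visibly continuous in [t]. *)
Let lower_volume i t b : proper_box b ->
  cofactor_volume i b * Num.max 0 (Num.min (b.2 ord0 i) t - b.1 ord0 i) =
  if b.1 ord0 i < t then box_volume (lower_box i t b) else 0.
Proof.
move=> /forallP pb; case: ifPn => bt.
  rewrite /box_volume (bigD1 i)//= set_coordE eqxx mulrC; congr (_ * _).
    by rewrite max_r// subr_ge0 le_min !ltW.
  by apply: eq_bigr => j /negbTE ji; rewrite set_coordE ji.
rewrite max_l ?mulr0// subr_le0 ge_min; apply/orP; right.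
by rewrite leNgt.
Qed.

Let upper_volume i t b : proper_box b ->
  cofactor_volume i b * Num.max 0 (b.2 ord0 i - Num.max (b.1 ord0 i) t) =
  if t < b.2 ord0 i then box_volume (upper_box i t b) else 0.
Proof.
move=> /forallP pb; case: ifPn => bt.
  rewrite /box_volume (bigD1 i)//= set_coordE eqxx mulrC; congr (_ * _).
    by rewrite max_r// subr_ge0 ge_max !ltW.
  by apply: eq_bigr => j /negbTE ji; rewrite set_coordE ji.
rewrite max_l ?mulr0// subr_le0 le_max; apply/orP; right.
by rewrite leNgt.
Qed.

Let lower_list_volume i t l : box_list l -> list_volume (lower_list i t l) =
  \sum_(b <- l) cofactor_volume i b * Num.max 0 (Num.min (b.2 ord0 i) t - b.1 ord0 i).
Proof.
move=> /andP[/allP lp _]; rewrite /list_volume big_map big_filter big_mkcond.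
by apply: eq_big_seq => b /lp pb; rewrite lower_volume.
Qed.

Lemma list_volume_cut i t l : box_list l ->
  list_volume l = list_volume (lower_list i t l) + list_volume (upper_list i t l).
Proof.
move=> ol; rewrite lower_list_volume//; case/andP: ol => /allP lp _.
rewrite /list_volume [in X in _ + X]big_map big_filter [in X in _ + X]big_mkcond.
rewrite -big_split/=; apply: eq_big_seq => b /lp pb; rewrite -upper_volume// -mulrDr.
rewrite /box_volume (bigD1 i)//= mulrC; congr (_ * _).
have /forallP/(_ i) := pb.
by case: (leP (b.2 ord0 i) t); case: (leP (b.1 ord0 i) t) => *;
   rewrite !maxEle; do ?case: ifPn; rewrite -?ltNge; lra.
Qed.

Lemma box_volume_gt0 b : proper_box b -> 0 < box_volume b.
Proof. by move=> /forallP pb; apply: prodr_gt0 => i _; rewrite subr_gt0. Qed.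

Lemma list_volume_gt0 l : box_list l -> l != [::] -> 0 < list_volume l.
Proof.
case: l => // b l /andP[/= /andP[pb pl] _] _; rewrite /list_volume big_cons.
rewrite ltr_pwDl ?box_volume_gt0//; rewrite big_seq.
by apply: sumr_ge0 => b' b'l; rewrite ltW// box_volume_gt0// (allP pl).
Qed.

Lemma list_volume_ge0 l : box_list l -> 0 <= list_volume l.
Proof.
have [->|l0] := eqVneq l [::]; first by rewrite /list_volume big_nil.
by move=> ol; rewrite ltW// list_volume_gt0.
Qed.

(** The volume below [t] runs continuously from 0 at [- D] to the whole at [D], where [D] bounds the
    coordinates of all corners. *)
Lemma cut_exists i l (theta : R) : box_list l -> 0 < theta < 1 ->
  exists t, list_volume (lower_list i t l) = theta * list_volume l.
Proof.
move=> ol /andP[th0 th1].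
pose f t := \sum_(b <- l) cofactor_volume i b * Num.max 0 (Num.min (b.2 ord0 i) t - b.1 ord0 i).
pose D := \sum_(b <- l) (`|b.1 ord0 i| + `|b.2 ord0 i|).
have Db b : b \in l -> - D <= b.1 ord0 i /\ b.2 ord0 i <= D.
  move=> bl; have h : `|b.1 ord0 i| + `|b.2 ord0 i| <= D.
    by rewrite /D (big_rem b)//= lerDl sumr_ge0// => *; rewrite addr_ge0.
  have := ler_norm (b.2 ord0 i); have := ler_norm (- b.1 ord0 i); rewrite normrN.
  by have := normr_ge0 (b.1 ord0 i); have := normr_ge0 (b.2 ord0 i); split; lra.
have fl : f (- D) = 0.
  rewrite /f big_seq big1// => b bl; have [h1 h2] := Db b bl.
  by rewrite max_l ?mulr0// subr_le0 ge_min h1 orbT.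
have fr : f D = list_volume l.
  case/andP: ol => /allP lp _; apply: eq_big_seq => b bl; have [h1 h2] := Db b bl.
  rewrite /box_volume (bigD1 i)//= mulrC min_l// max_r// subr_ge0 ltW//.
  by have /forallP := lp _ bl.
have cf : continuous f.
  move=> t; apply: cvg_big => [|b _]; first exact: add_continuous.
  by apply: cvgMl_tmp; exact: continuous_clipped_length.
have V0 := list_volume_ge0 ol.
have D0 : 0 <= D by apply: sumr_ge0 => *; rewrite addr_ge0.
have [|||t _ ft] := @IVT R f (- D) D (theta * list_volume l).
- by lra.
- exact: continuous_subspaceT.
- rewrite fl fr min_l// max_r// mulr_ge0 ?(ltW th0)//=.
  by rewrite ler_piMl// ltW.
- by exists t; rewrite lower_list_volume.
Qed.

Lemma size_lower_list i t l : (size (lower_list i t l) <= size l)%N.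
Proof. by rewrite size_map size_filter count_size. Qed.

Lemma size_upper_list i t l : (size (upper_list i t l) <= size l)%N.
Proof. by rewrite size_map size_filter count_size. Qed.

(** Cutting at the lower face of the farther of two disjoint boxes leaves each of them on one side
    only, so either half keeps a box and loses a box. *)
Lemma separating_cut l : box_list l -> (1 < size l)%N ->
  exists i t, [/\ lower_list i t l != [::], upper_list i t l != [::],
    (size (lower_list i t l) < size l)%N & (size (upper_list i t l) < size l)%N].
Proof.
have sz (P : pred boxT) b s : b \in s -> ~~ P b -> (count P s < size s)%N.
  move=> bs Pb; rewrite ltn_neqAle count_size andbT -all_count.
  by apply/negP => /allP/(_ _ bs); exact/negP.
have nz (T : eqType) (g : boxT -> T) (P : pred boxT) b s : b \in s -> P b ->
    [seq g b | b <- s & P b] != [::].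
  move=> bs Pb; rewrite -size_eq0 size_map size_filter -lt0n -has_count.
  by apply/hasP; exists b.
case: l => [|b [|b' l]]// /andP[/= /and3P[/forallP pb /forallP pb' _]].
move=> /andP[/andP[/existsP[i bb'] _] _] _.
have bl : b \in [:: b, b' & l] by rewrite inE eqxx.
have b'l : b' \in [:: b, b' & l] by rewrite !inE eqxx orbT.
case/orP: bb' => h; [exists i, (b'.1 ord0 i) | exists i, (b.1 ord0 i)].
  split; rewrite ?size_map ?size_filter.
  - by apply: nz bl _; exact: lt_le_trans h.
  - by apply: nz b'l _.
  - by apply: sz b'l _; rewrite ltxx.
  - by apply: sz bl _; rewrite -leNgt.
split; rewrite ?size_map ?size_filter.
- by apply: nz b'l _; exact: lt_le_trans h.
- by apply: nz bl _.
- by apply: sz bl _; rewrite ltxx.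
- by apply: sz b'l _; rewrite -leNgt.
Qed.

Let bm_boxes b b' (s t : R) : proper_box b -> proper_box b' -> 0 <= s -> 0 <= t ->
  s ^+ m = box_volume b -> t ^+ m = box_volume b' ->
  ((c0 * (s + t) ^+ m)%:E <= Hm (set_add (box b.1 b.2) (box b'.1 b'.2)))%E.
Proof.
move=> /forallP pb /forallP pb' s0 t0 sb tb.
have u0 i : 0 < b.2 ord0 i - b.1 ord0 i by rewrite subr_gt0.
have v0 i : 0 < b'.2 ord0 i - b'.1 ord0 i by rewrite subr_gt0.
have := prod_root_superadditive m_gt0 u0 v0 s0 t0 sb tb.
set P := \prod_i _ => stP.
apply: (@le_trans _ _ (c0 * P)%:E).
  by rewrite lee_fin ler_wpM2l// ltW// cube_const_gt0.
apply: (@le_trans _ _ (Hm (box (b.1 + b'.1) (b.2 + b'.2)))).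
  rewrite (_ : P = \prod_i ((b.2 + b'.2) ord0 i - (b.1 + b'.1) ord0 i)).
    by apply: box_volume_le => // i; rewrite !mxE lerD// ltW.
  by apply: eq_bigr => i _; rewrite !mxE opprD addrACA.
apply: hausdorff_measureS => x hx.
(* Relative position of [x] in the box of the sums; both summands are placed at this same relative
   position in their own boxes. *)
pose r i := (x ord0 i - b.1 ord0 i - b'.1 ord0 i) /
  ((b.2 ord0 i - b.1 ord0 i) + (b'.2 ord0 i - b'.1 ord0 i)).
have r01 i : 0 <= r i < 1.
  have := hx i; rewrite !mxE => /andP[h1 h2].
  have w0 := addr_gt0 (u0 i) (v0 i).
  by rewrite /r ltr_pdivrMr// ler_pdivlMr//; apply/andP; split; lra.
exists (\row_i (b.1 ord0 i + r i * (b.2 ord0 i - b.1 ord0 i))).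
  move=> i; rewrite mxE; have /andP[h1 h2] := r01 i; have := u0 i; move: h1 h2.
  by move: (r i) => ri *; apply/andP; split; nra.
exists (\row_i (b'.1 ord0 i + r i * (b'.2 ord0 i - b'.1 ord0 i))).
  move=> i; rewrite mxE; have /andP[h1 h2] := r01 i; have := v0 i; move: h1 h2.
  by move: (r i) => ri *; apply/andP; split; nra.
apply/rowP => i; rewrite !mxE addrACA -mulrDr /r divfK; first by ring.
by rewrite gt_eqF// addr_gt0// ?u0 ?v0.
Qed.

(* Hadwiger-Ohmann: cut one list along a coordinate hyperplane separating two of
   its boxes, the other one in the same volume ratio, and use induction on the
   number of boxes. *)
Lemma brunn_minkowski_box_lists l l' (s t : R) :
  box_list l -> box_list l' -> l != [::] -> l' != [::] -> 0 <= s -> 0 <= t ->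
  s ^+ m = list_volume l -> t ^+ m = list_volume l' ->
  ((c0 * (s + t) ^+ m)%:E <= Hm (set_add (list_union l) (list_union l')))%E.
Proof.
have [k] := ubnP (size l + size l'); elim: k l l' s t => // k ih l l' s t.
wlog ll' : l l' s t / (size l' <= size l)%N.
  move=> wl; case: (leqP (size l') (size l)) => [|/ltnW] hs; first exact: wl.
  move=> lk ol ol' l0 l'0 s0 t0 sl tl.
  by rewrite addrC set_addC; apply: wl => //; rewrite addnC.
rewrite ltnS => lk ol ol' l0 l'0 s0 t0 sl tl.
have [l1|l1] := leqP (size l) 1.
  case: l l0 l1 ll' lk ol sl => // b [|//] _ _ ll' lk ol sl.
  case: l' l'0 ll' lk ol' tl => // b' [|//] _ ll' lk ol' tl.
  move: sl tl ol ol'; rewrite /list_volume !big_seq1 /box_list /= !andbT => sb tb pb pb'.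
  apply: (le_trans (bm_boxes pb pb' s0 t0 sb tb)); apply: hausdorff_measureS.
  move=> _ [x bx [y by_ <-]]; exists x; first by exists b; rewrite ?inE.
  by exists y => //; exists b'; rewrite ?inE.
have [i [c [lo0 up0 lok upk]]] := separating_cut ol l1.
have [olo oup] := (lower_list_ok i c ol, upper_list_ok i c ol).
have V0 := list_volume_gt0 ol l0.
have Vlo := list_volume_gt0 olo lo0; have Vup := list_volume_gt0 oup up0.
have VE := list_volume_cut i c ol.
pose theta := list_volume (lower_list i c l) / list_volume l.
have theta01 : 0 < theta < 1.
  by rewrite divr_gt0//= ltr_pdivrMr// mul1r VE ltrDl.
have [c' Vlo'] := cut_exists i ol' theta01; case/andP: theta01 => th0 th1.
have V'0 := list_volume_gt0 ol' l'0.
have VE' := list_volume_cut i c' ol'.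
have Vup' : list_volume (upper_list i c' l') = (1 - theta) * list_volume l'.
  by rewrite mulrBl mul1r -Vlo' {1}VE' addrC addKr.
have nonempty (lst : seq boxT) : 0 < list_volume lst -> lst != [::].
  by apply: contraTneq => ->; rewrite /list_volume big_nil ltxx.
(* As both lists are cut in the ratio [theta], the roots [s] and [t] scale by the same [r] below and
   the same [r'] above. The two inductive bounds then add up to exactly the required one. *)
have [r r0 rm] := exists_root m_gt0 (ltW th0).
have [r' r'0 r'm] := exists_root m_gt0 (ltW (etrans (subr_gt0 _ _) th1)).
have bnd u v : (size u < size l)%N -> (size v <= size l')%N -> (size u + size v < k)%N.
  move=> h1 h2; apply: (@leq_trans (size l + size l')%N) => //.
  by rewrite -addSn leq_add.
have h1 : ((c0 * (r * s + r * t) ^+ m)%:E <=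
    Hm (set_add (list_union (lower_list i c l)) (list_union (lower_list i c' l'))))%E.
  apply: ih; rewrite ?bnd ?size_lower_list ?lower_list_ok ?mulr_ge0//.
  - by apply: nonempty; rewrite Vlo' mulr_gt0.
  - by rewrite exprMn rm sl divfK// gt_eqF.
  - by rewrite exprMn rm tl Vlo'.
have h2 : ((c0 * (r' * s + r' * t) ^+ m)%:E <=
    Hm (set_add (list_union (upper_list i c l)) (list_union (upper_list i c' l'))))%E.
  apply: ih; rewrite ?bnd ?size_upper_list ?upper_list_ok ?mulr_ge0//.
  - by apply: nonempty; rewrite Vup' mulr_gt0// subr_gt0.
  - rewrite exprMn r'm sl mulrBl mul1r divfK ?gt_eqF//.
    by rewrite {1}VE addrC addKr.
  - by rewrite exprMn r'm tl Vup'.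
(* Sums of lower parts lie below the hyperplane at [c + c'], sums of upper parts on or above it. *)
apply: (le_trans _ (hausdorff_measure_halfspaces _ i (c + c'))).
apply: (@le_trans _ _ ((c0 * (r * s + r * t) ^+ m)%:E + (c0 * (r' * s + r' * t) ^+ m)%:E)%E).
  rewrite -EFinD lee_fin -!mulrDr !exprMn rm r'm -mulrDl.
  by rewrite [theta + _]addrC subrK mul1r.
apply: leeD; [apply: (le_trans h1) | apply: (le_trans h2)]; apply: hausdorff_measureS.
  move=> _ [x /lower_list_union[lx /= xc] [y /lower_list_union[l'y /= yc] <-]].
  by split; [exists x => //; exists y | rewrite /= mxE ltrD].
move=> _ [x /upper_list_union[lx /= xc] [y /upper_list_union[l'y /= yc] <-]].
by split; [exists x => //; exists y | rewrite /= mxE lerD].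
Qed.

End box_lists.

(** * Sections by linear planes *)

Lemma invn_trunc_lt (R : realType) (x : R) : 0 < x -> (Num.trunc x^-1).+1%:R^-1 < x.
Proof.
move=> x0; have xi : 0 <= x^-1 by rewrite invr_ge0 ltW.
have /andP[_ h] := truncn_itv xi.
by rewrite -[ltRHS]invrK ltf_pV2 ?posrE ?invr_gt0// ltr0n.
Qed.

Section closed_neighbourhoods.
Context (R : realType) (n : nat).
Implicit Types K S : set 'rV[R]_n.

Definition closed_nbhd (r : R) K : set 'rV[R]_n := [set x | exists2 y, K y & `|x - y| <= r].

Lemma closed_mem_limit K x : closed K ->
  (forall r, 0 < r -> exists2 y, K y & `|x - y| <= r) -> K x.
Proof.
move=> /closure_id cK h; rewrite cK => B /nbhs_ballP[e /= e0 eB].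
have e20 : 0 < e / 2 by rewrite divr_gt0.
have [y Ky xy] := h _ e20.
exists y; split => //; apply: eB; rewrite -ball_normE /=.
by rewrite (le_lt_trans xy)// ltr_pdivrMr// ltr_pMr// ltr1n.
Qed.

Lemma compact_bound K : compact K -> exists2 D, 0 < D & forall x, K x -> `|x| <= D.
Proof.
move=> /compact_bounded[M [_ hM]]; exists (`|M| + 1); first by rewrite ltr_wpDl.
by move=> x Kx; apply: hM => //; rewrite (le_lt_trans (ler_norm M))// ltrDl.
Qed.

Lemma closed_nbhd_bounded K r D : (forall x, K x -> `|x| <= D) ->
  forall x, closed_nbhd r K x -> `|x| <= r + D.
Proof.
move=> KD x [y Ky xy]; rewrite -[x](subrK y) (le_trans (ler_normD _ _))//.
by rewrite lerD// KD.
Qed.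

(** The factor [S] is the whole space in the Brunn-Minkowski inequality for compact sets and a plane
    in the semicontinuity of section volumes. *)
Lemma closed_nbhd_cvg m S K (e : R) : closed K -> 0 < e ->
  (hausdorff_measure m (S `&` closed_nbhd 1 K) < +oo)%E ->
  exists2 r, 0 < r & (hausdorff_measure m (S `&` closed_nbhd r K) <=
    hausdorff_measure m (S `&` K) + e%:E)%E.
Proof.
move=> cK e0 fin; pose A k := S `&` closed_nbhd k.+1%:R^-1 K.
have inv_lt k : (k.+2%:R^-1 < k.+1%:R^-1 :> R) by rewrite ltf_pV2 ?posrE ?ltr_nat.
have [||k|k Ak] := @hausdorff_measure_cvg R n m A e e0.
- by rewrite /A invr1.
- move=> k x [Sx [y Ky xy]]; split => //; exists y => //.
  by rewrite (le_trans xy)// ltW.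
- exists (k.+2%:R^-1 - k.+3%:R^-1); first by rewrite subr_gt0 inv_lt.
  move=> x y [[Sx _] nx] [Sy [z Kz yz]].
  have : k.+2%:R^-1 < `|x - z|.
    by rewrite ltNge; apply/negP => h; apply: nx; split => //; exists z.
  have := ler_distD y x z; move: yz.
  by move: (k.+2%:R^-1) (k.+3%:R^-1) => c d; lra.
exists k.+1%:R^-1; first by rewrite invr_gt0.
rewrite (le_trans Ak)// leeD2r// hausdorff_measureS// => x Ax.
have [Sx _] := Ax 0%N I; split => //; apply: closed_mem_limit => // r r0.
have [_ [y Ky xy]] := Ax (Num.trunc r^-1) I; exists y => //.
by rewrite (le_trans xy)// ltW// invn_trunc_lt.
Qed.

End closed_neighbourhoods.

(** * From box lists to compact sets *)

Section compact_brunn_minkowski.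
Context (R : realType) (m : nat) (m_gt0 : (0 < m)%N).
Local Notation Hm := (@hausdorff_measure R m m).
Local Notation c0 := (cube_const R m).
Implicit Types A B : set 'rV[R]_m.

(** The list consists of the grid cells of side [h] that meet [A]; being half-open, they are
    disjoint and still cover. *)
Lemma outer_box_list A (D h : R) : 0 < h -> A !=set0 -> (forall x, A x -> `|x| <= D) ->
  exists l, [/\ box_list l, l != [::], list_union l `<=` closed_nbhd h A,
    A `<=` list_union l & (Hm A <= (c0 * list_volume l)%:E)%E].
Proof.
move=> h0 [x0 Ax0] AD; pose N := (Num.trunc (2 * D / h)).+1.
have D0 : 0 <= D by rewrite (le_trans _ (AD _ Ax0)).
have DN : 2 * D < N%:R * h.
  have /andP[_] := @truncn_itv R (2 * D / h) (divr_ge0 (mulr_ge0 (ler0n _ 2) D0) (ltW h0)).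
  by rewrite ltr_pdivrMr.
pose a : 'rV[R]_m := const_mx (- D).
pose g (f : {ffun 'I_m -> 'I_N}) : 'rV[R]_m * 'rV[R]_m :=
  (a + h *: \row_i (f i)%:R, a + h *: \row_i (f i).+1%:R).
have gE f : (g f).2 = (g f).1 + const_mx h.
  by apply/rowP => i; rewrite !mxE -natr1 mulrDr mulr1 addrA.
have vol_g f : box_volume (g f) = h ^+ m.
  rewrite -[m in RHS]card_ord -prodr_const; apply: eq_bigr => i _.
  by rewrite gE mxE addrAC subrr add0r mxE.
pose P f := `[< exists2 x, A x & box (g f).1 (g f).2 x >].
pose l := [seq g f | f <- enum {ffun 'I_m -> 'I_N} & P f].
have Al : A `<=` list_union l.
  move=> x Ax; have [|f fx] := @grid_cell_cover R m a h N x h0.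
    move=> i; rewrite mxE; have := AD _ Ax; have := ler_norm_coord x i.
    by rewrite ler_norml => /andP[h1 h2] h3; apply/andP; split; lra.
  exists (g f) => //; apply/mapP; exists f => //.
  by rewrite mem_filter mem_enum andbT; apply/asboolP; exists x.
exists l; split => //.
- apply/andP; split.
    apply/allP => b /mapP[f _ ->]; apply/forallP => i.
    by rewrite gE [ltRHS]mxE [X in _ < _ + X]mxE ltrDl.
  rewrite pairwise_map pairwise_filter//.
  have := enum_uniq {ffun 'I_m -> 'I_N}; rewrite uniq_pairwise.
  apply: sub_pairwise => f f' /= ff'.
  have [i fi] : exists i, f i != f' i.
    apply/existsP; apply: contraR ff' => /existsPn h'; apply/eqP/ffunP => i.
    by have := h' i; rewrite negbK => /eqP.
  apply/existsP; exists i; rewrite /= !mxE !lerD2l !ler_pM2l// !ler_nat.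
  by move: fi; rewrite -val_eqE neq_ltn.
- have [b bl _] := Al _ Ax0; apply/eqP => l0; by rewrite l0 in bl.
- move=> x [_ /mapP[f + ->] fx]; rewrite mem_filter => /andP[/asboolP[y Ay fy] _].
  by exists y => //; exact: grid_cell_diff h0 fx fy.
- apply: (@le_trans _ _ (\sum_(b <- l) Hm (box b.1 b.2))%E).
    rewrite (le_trans _ (outer_measure_bigU _ _ _ _))// hausdorff_measureS//.
    by rewrite -bigcup_seq => x /Al[b bl bx]; exists b.
  rewrite /list_volume !big_map mulr_sumr -sumEFin le_eqVlt; apply/orP; left; apply/eqP.
  by apply: eq_bigr => f _; rewrite vol_g gE hausdorff_measure_cube.
Qed.

Lemma compact_set_add A B : compact A -> compact B -> compact (set_add A B).
Proof.
move=> cA cB.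
have addc : continuous (fun z : 'rV[R]_m * 'rV[R]_m => z.1 + z.2).
  by move=> z; exact: add_continuous.
have := continuous_compact (continuous_subspaceT addc) (compact_setX cA cB).
congr compact; apply/seteqP; split; first by move=> _ [[x y] [Ax By] <-]; exists x => //; exists y.
by move=> _ [x Ax [y By <-]]; exists (x, y).
Qed.

(** Outer approximations at mesh [r / 2] have their sum in the closed [r]-neighbourhood of
    [set_add A B], which has almost the measure of that compact set. Lower bounds of the form
    [c0 * s ^+ m] avoid roots of extended reals. *)
Lemma brunn_minkowski_compact A B (s t : R) : compact A -> compact B ->
  A !=set0 -> B !=set0 -> 0 <= s -> 0 <= t ->
  ((c0 * s ^+ m)%:E <= Hm A)%E -> ((c0 * t ^+ m)%:E <= Hm B)%E ->
  ((c0 * (s + t) ^+ m)%:E <= Hm (set_add A B))%E.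
Proof.
move=> cA cB A0 B0 s0 t0 sA tB.
have [DA _ hA] := compact_bound cA; have [DB _ hB] := compact_bound cB.
have cAB := compact_set_add cA cB; have [D _ hD] := compact_bound cAB.
apply/lee_addgt0Pr => e e0.
have [||r r0] := @closed_nbhd_cvg R m m setT (set_add A B) e _ e0.
- exact: compact_closed (@norm_hausdorff _ _) cAB.
- by rewrite setTI; apply: (hausdorff_measure_bounded_lty (closed_nbhd_bounded hD)).
rewrite !setTI; apply: le_trans.
have r2 : 0 < r / 2 by rewrite divr_gt0.
have [l [ol l0 lA Al vl]] := outer_box_list r2 A0 hA.
have [l' [ol' l'0 lB Bl vl']] := outer_box_list r2 B0 hB.
have [s' s'0 s'l] := exists_root m_gt0 (list_volume_ge0 ol).
have [t' t'0 t'l] := exists_root m_gt0 (list_volume_ge0 ol').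
have c00 := cube_const_gt0 R m_gt0.
have le_root (u u' v : R) (X : set 'rV[R]_m) : 0 <= u -> 0 <= u' -> u' ^+ m = v ->
    ((c0 * u ^+ m)%:E <= Hm X)%E -> (Hm X <= (c0 * v)%:E)%E -> u <= u'.
  move=> u0 u'0 <- h1 h2; have := le_trans h1 h2.
  by rewrite lee_fin ler_pM2l// ler_pXn2r.
have ss' := le_root _ _ _ _ s0 s'0 s'l sA vl.
have tt' := le_root _ _ _ _ t0 t'0 t'l tB vl'.
apply: (@le_trans _ _ (c0 * (s' + t') ^+ m)%:E).
  by rewrite lee_fin ler_pM2l// lerXn2r ?nnegrE ?addr_ge0// lerD.
apply: (le_trans (brunn_minkowski_box_lists m_gt0 ol ol' l0 l'0 s'0 t'0 s'l t'l)).
apply: hausdorff_measureS => _ [x /lA[a Aa xa] [y /lB[b Bb yb] <-]].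
exists (a + b); first by exists a => //; exists b.
by rewrite opprD addrACA (le_trans (ler_normD _ _))// [leRHS]splitr lerD.
Qed.

End compact_brunn_minkowski.

(** * Orthonormal frames of planes *)

Section mulmx_norm.
Context (R : realType).

Lemma norm_mulmx_le m n (y : 'rV[R]_m) (M : 'M[R]_(m, n)) :
  `|y *m M| <= m%:R * `|y| * `|M|.
Proof.
apply: norm_rV_le => [|j]; first by rewrite !mulr_ge0.
rewrite mxE (le_trans (ler_norm_sum _ _ _))//.
rewrite (_ : _ * `|M| = \sum_(i < m) `|y| * `|M|); last first.
  by rewrite sumr_const card_ord -[RHS]mulr_natl mulrA.
apply: ler_sum => i _; rewrite normrM ler_pM// ?ler_norm_coord//.
rewrite [leRHS]/Num.norm /= mx_normrE.
by apply/bigmax_geP; right => /=; exists (i, j).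
Qed.

Lemma mulmxr_continuous m n (M : 'M[R]_(m, n)) :
  continuous (fun y : 'rV[R]_m => y *m M).
Proof.
move=> x; have F := nbhs_filter x.
apply/(@cvgrPdist_lt _ _ _ (nbhs x) F (fun y : 'rV[R]_m => y *m M) (x *m M)) => e e0.
have C0 : 0 < m%:R * `|M| + 1 by rewrite ltr_wpDl// mulr_ge0.
near=> y; rewrite -mulmxBl (le_lt_trans (norm_mulmx_le _ _))//.
rewrite mulrAC (@le_lt_trans _ _ ((m%:R * `|M| + 1) * `|x - y|))//.
  by rewrite ler_wpM2r// lerDl.
rewrite mulrC -ltr_pdivlMr//; near: y.
have := nbhsx_ballx x _ (divr_gt0 e0 C0); apply: filterS => y.
by rewrite -ball_normE.
Unshelve. all: by end_near. Qed.

Lemma enorm_continuous n : continuous (@enorm R n : 'rV[R]_n -> R).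
Proof.
move=> y; have F := nbhs_filter y.
have n0 : 0 < n%:R + 1 :> R by rewrite ltr_wpDl.
apply/(@cvgrPdist_lt _ R _ (nbhs y) F (@enorm R n) (enorm y)) => e e0; near=> z.
apply: (@le_lt_trans _ _ ((n%:R + 1) * `|y - z|)).
  apply: (@le_trans _ _ (n%:R * `|y - z|)); last by rewrite ler_wpM2r// lerDl.
  rewrite (le_trans _ (enorm_le_norm _))// ler_norml; apply/andP; split.
    by have := enormD (z - y) y; rewrite subrK -opprB enormN; lra.
  by have := enormD (y - z) z; rewrite subrK; lra.
rewrite mulrC -ltr_pdivlMr//; near: z.
have := nbhsx_ballx y _ (divr_gt0 e0 n0); apply: filterS => z.
by rewrite -ball_normE.
Unshelve. all: by end_near. Qed.

Lemma mem_row_space m n (M : 'M[R]_(m, n)) (x : 'rV[R]_n) :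
  x \in row_space M <-> exists y, x = y *m M.
Proof.
split => [/memv_imgP[y _ ->]|[y ->]]; first by exists y; rewrite lfunE.
by apply/memv_imgP; exists y; rewrite ?memvf// lfunE.
Qed.

Lemma gram_schmidt m n (M : 'M[R]_(m, n)) : row_free M ->
  exists2 Q : 'M[R]_(m, n), Q *m Q^T = 1%:M & (Q == M)%MS.
Proof.
elim: m M => [|m ih] M fM.
  by exists M => //; rewrite ?submx_refl//; apply/matrixP => -[].
rewrite -[M](@vsubmxK _ 1 m) in fM *.
set v := @usubmx _ 1 m n M in fM *; set N := @dsubmx _ 1 m n M in fM *.
have rk : \rank (col_mx v N) = m.+1 by exact/eqP.
have rkvN : (\rank (col_mx v N) <= \rank v + \rank N)%N.
  by rewrite -addsmxE (mxrank_adds_leqif v N).1.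
have fN : row_free N.
  rewrite /row_free eqn_leq rank_leq_row -ltnS -rk (leq_trans rkvN)//.
  exact: (leq_add (rank_leq_row v) (leqnn _)).
have [Q QQ /eqmxP QN] := ih N fN.
have vQ : ~~ (v <= Q)%MS.
  apply/negP => vQ; have : (col_mx v N <= Q)%MS.
    by rewrite col_mx_sub vQ QN submx_refl.
  by move=> /mxrankS; rewrite rk => /leq_trans/(_ (rank_leq_row _)); rewrite ltnn.
pose w := v - v *m Q^T *m Q.
have wQ : w *m Q^T = 0 by rewrite mulmxBl -!mulmxA QQ mulmx1 subrr.
have w0 : w != 0.
  apply: contra vQ => /eqP w0; have -> : v = (v *m Q^T) *m Q.
    by apply/eqP; rewrite -subr_eq0 -/w w0.
  exact: submxMl.
have nw : 0 < enorm w by rewrite lt_neqAle eq_sym enorm_eq0 w0 enorm_ge0.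
pose e := (enorm w)^-1 *: w.
have ee : e *m e^T = 1%:M.
  apply/matrixP => i j; rewrite !ord1 -edotE edotZl edotZr -sqr_enorm mxE eqxx.
  by rewrite expr2 mulKf ?gt_eqF// mulVf// gt_eqF.
have eQ : e *m Q^T = 0 by rewrite -scalemxAl wQ scaler0.
have Qe : Q *m e^T = 0 by rewrite -[RHS]trmx0 -eQ trmx_mul trmxK.
have orth : col_mx e Q *m (col_mx e Q)^T = 1%:M.
  by rewrite tr_col_mx mul_col_row ee QQ eQ Qe -scalar_mx_block.
exists (col_mx e Q) => //.
have sub : (col_mx e Q <= col_mx v N)%MS.
  have Nc : (N <= col_mx v N)%MS by rewrite -addsmxE addsmxSr.
  have vc : (v <= col_mx v N)%MS by rewrite -addsmxE addsmxSl.
  rewrite col_mx_sub; apply/andP; split; last by rewrite QN.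
  by rewrite scalemx_sub// addmx_sub// eqmx_opp (submx_trans (submxMl _ _))// QN.
rewrite -(geq_leqif (mxrank_leqif_eq sub)) (leq_trans (rank_leq_row _))//.
have /eqP -> : row_free (col_mx e Q); last by [].
by apply/row_freeP; exists (col_mx e Q)^T.
Qed.

Lemma orthonormal_frame m n (U : {vspace 'rV[R]_n}) : \dim U = m ->
  exists2 Q : 'M[R]_(m, n), Q *m Q^T = 1%:M & U = row_space Q.
Proof.
move=> <-; pose M := \matrix_(i < \dim U) (vbasis U)`_i.
have ME y : y *m M = \sum_(i < \dim U) y ord0 i *: (vbasis U)`_i.
  by rewrite mulmx_sum_row; apply: eq_bigr => i _; rewrite rowK.
have fM : row_free M.
  rewrite -kermx_eq0; apply/rowV0P => y /sub_kermxP; rewrite ME => y0.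
  have /freeP/(_ _ y0) h := basis_free (vbasisP U).
  by apply/rowP => i; rewrite h mxE.
have [Q QQ QM] := gram_schmidt fM; exists Q => //.
apply/vspaceP => x; apply/idP/idP.
  move=> /coord_vbasis xE; apply/mem_row_space.
  have : (x <= Q)%MS.
    rewrite (eqmxP QM); apply/submxP; exists (\row_i coord (vbasis U) i x).
    by rewrite ME {1}xE; apply: eq_bigr => i _; rewrite mxE.
  by move=> /submxP[y ->]; exists y.
move=> /mem_row_space[y ->].
have : (y *m Q <= M)%MS by rewrite -(eqmxP QM) submxMl.
move=> /submxP[z ->]; rewrite ME; apply: memv_suml => i _; apply: memvZ.
by apply: vbasis_mem; apply: mem_nth; rewrite size_tuple.
Qed.

Lemma enorm_mulmx_orthonormal m n (Q : 'M[R]_(m, n)) (y : 'rV[R]_m) :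
  Q *m Q^T = 1%:M -> enorm (y *m Q) = enorm y.
Proof.
move=> QQ; rewrite /enorm !edotE trmx_mul -mulmxA (mulmxA Q) QQ mul1mx//.
Qed.

End mulmx_norm.

(** * Hausdorff measure of sections *)

Section sections.
Context (R : realType) (m n : nat) (m_gt0 : (0 < m)%N).
Local Notation Hm := (@hausdorff_measure R n m).
Local Notation c0 := (cube_const R m).
Implicit Types (U : {vspace 'rV[R]_n}) (A B K : set 'rV[R]_n).

(** Both the map by [Q] and its inverse on the image, the map by [Q^T], are 1-Lipschitz. *)
Lemma hausdorff_measure_isometry (Q : 'M[R]_(m, n)) (A : set 'rV[R]_m) :
  Q *m Q^T = 1%:M -> Hm [set y *m Q | y in A] = hausdorff_measure m A.
Proof.
move=> QQ; apply/eqP; rewrite eq_le; apply/andP; split.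
  have := @hausdorff_measure_lipschitz R m n m (fun y => y *m Q) 1 A ltr01.
  rewrite expr1n mul1e; apply => x y _ _.
  by rewrite mul1r -mulmxBl enorm_mulmx_orthonormal.
have := @hausdorff_measure_lipschitz R n m m (fun x => x *m Q^T) 1 [set y *m Q | y in A] ltr01.
rewrite expr1n mul1e image_comp (_ : (_ \o _) @` A = A); last first.
  apply/seteqP; split => [_ [y Ay <-]|y Ay] /=; last exists y => //=.
    by rewrite -mulmxA QQ mulmx1.
  by rewrite -mulmxA QQ mulmx1.
apply => _ _ [x Ax <-] [y Ay <-].
by rewrite mul1r -!mulmxBl -mulmxA QQ mulmx1 enorm_mulmx_orthonormal.
Qed.

Lemma section_image (Q : 'M[R]_(m, n)) A : A `<=` [set` row_space Q] ->
  A = [set y *m Q | y in [set y | A (y *m Q)]].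
Proof.
move=> AQ; apply/seteqP; split => [x Ax|_ [y Ay <-]//].
by have /mem_row_space[y xE] := AQ _ Ax; exists y => //=; rewrite -xE.
Qed.

Lemma orthonormal_norm_le (Q : 'M[R]_(m, n)) (y : 'rV[R]_m) : Q *m Q^T = 1%:M ->
  `|y| <= n%:R * `|y *m Q| /\ `|y *m Q| <= m%:R * `|y|.
Proof.
move=> QQ; split.
  by rewrite (le_trans (norm_le_enorm _))// -(enorm_mulmx_orthonormal y QQ) enorm_le_norm.
by rewrite (le_trans (norm_le_enorm _))// (enorm_mulmx_orthonormal y QQ) enorm_le_norm.
Qed.

Lemma compact_frame_preimage (Q : 'M[R]_(m, n)) A : Q *m Q^T = 1%:M -> compact A ->
  compact [set y : 'rV[R]_m | A (y *m Q)].
Proof.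
move=> QQ cA; have [D D0 AD] := compact_bound cA; apply: bounded_closed_compact.
  exists (n%:R * D); split; first exact: num_real.
  move=> x hx y Ay /=; rewrite (le_trans (orthonormal_norm_le y QQ).1)//.
  by rewrite (le_trans _ (ltW hx))// ler_wpM2l// AD.
have /continuous_closedP : continuous (fun y : 'rV[R]_m => y *m Q).
  exact: mulmxr_continuous.
apply.
exact: compact_closed (@norm_hausdorff _ _) cA.
Qed.

Lemma section_measure_bounded K (D : R) : (forall x, K x -> `|x| <= D) ->
  exists C : R, forall U, \dim U = m -> (Hm ([set` U] `&` K) <= C%:E)%E.
Proof.
move=> KD; pose B : set 'rV[R]_m := [set y | `|y| <= n%:R * D].
have Bfin : (hausdorff_measure m B < +oo)%E.
  exact: (@hausdorff_measure_bounded_lty _ _ B (n%:R * D)).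
exists (fine (hausdorff_measure m B)) => U dU.
rewrite fineK ?ge0_fin_numE ?hausdorff_measure_ge0//.
have [Q QQ UQ] := orthonormal_frame dU.
rewrite UQ (@section_image Q ([set` row_space Q] `&` K)); last exact: subIsetl.
rewrite hausdorff_measure_isometry// hausdorff_measureS// => y [_ Ky] /=.
by rewrite /B /= (le_trans (orthonormal_norm_le y QQ).1)// ler_wpM2l// KD.
Qed.

(** The bound is uniform over planes: in orthonormal coordinates, a cube of side [r / m] at the
    origin always maps into the ball of radius [r]. *)
Lemma section_measure_lbound K (r : R) : 0 < r -> (forall x, `|x| <= r -> K x) ->
  exists2 C : R, 0 < C & forall U, \dim U = m -> (C%:E <= Hm ([set` U] `&` K))%E.
Proof.
move=> r0 rK; have rm0 : 0 < r / m%:R by rewrite divr_gt0// ltr0n.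
exists (c0 * (r / m%:R) ^+ m); first by rewrite mulr_gt0 ?cube_const_gt0 ?exprn_gt0.
move=> U dU; have [Q QQ UQ] := orthonormal_frame dU.
rewrite UQ (@section_image Q ([set` row_space Q] `&` K)); last exact: subIsetl.
rewrite hausdorff_measure_isometry// -(hausdorff_measure_cube 0 rm0).
apply: hausdorff_measureS => y hy; split; first by apply/mem_row_space; exists y.
apply: rK; rewrite (le_trans (orthonormal_norm_le y QQ).2)//.
rewrite mulrC -ler_pdivlMr ?ltr0n//; apply: norm_rV_le => [|i]; first exact: ltW.
have := hy i; rewrite !mxE add0r => /andP[h1 h2].
by rewrite ger0_norm// ltW.
Qed.

Lemma section_measure_gt0 U A (x0 : 'rV[R]_n) (r : R) : \dim U = m -> x0 \in U -> 0 < r ->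
  (forall x, x \in U -> `|x - x0| <= r -> A x) -> (0 < Hm A)%E.
Proof.
move=> dU x0U r0 rA.
have [C C0 hC] := @section_measure_lbound [set x | `|x| <= r] r r0 (fun x h => h).
apply: (@lt_le_trans _ _ C%:E); first by rewrite lte_fin.
rewrite (le_trans (hC U dU))// -(hausdorff_measure_translate _ _ x0).
apply: hausdorff_measureS => _ [x [xU xr] <-]; apply: rA; first exact: memvD.
by rewrite addrK.
Qed.

Lemma section_brunn_minkowski U A B (s t : R) : \dim U = m ->
  A `<=` [set` U] -> B `<=` [set` U] -> compact A -> compact B ->
  A !=set0 -> B !=set0 -> 0 <= s -> 0 <= t ->
  ((c0 * s ^+ m)%:E <= Hm A)%E -> ((c0 * t ^+ m)%:E <= Hm B)%E ->
  ((c0 * (s + t) ^+ m)%:E <= Hm (set_add A B))%E.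
Proof.
move=> dU; have [Q QQ ->] := orthonormal_frame dU.
move=> AU BU cA cB [a Aa] [b Bb] s0 t0.
have AE := section_image AU; have BE := section_image BU.
rewrite {1}AE {1}BE !hausdorff_measure_isometry//.
set A' := [set y | A _]; set B' := [set y | B _] => sA tB.
have := brunn_minkowski_compact m_gt0 (compact_frame_preimage QQ cA)
  (compact_frame_preimage QQ cB) _ _ s0 t0 sA tB.
move=> h; apply: (le_trans (h _ _)).
- by have /mem_row_space[y aE] := AU _ Aa; exists y; rewrite /A' /= -aE.
- by have /mem_row_space[y bE] := BU _ Bb; exists y; rewrite /B' /= -bE.
rewrite -(hausdorff_measure_isometry _ QQ); apply: hausdorff_measureS.
move=> _ [_ [x Ax [y By <-]] <-]; rewrite mulmxDl.
by exists (x *m Q) => //; exists (y *m Q).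
Qed.

(** By convexity [D] contains a copy of the ball about [x0] shrunk towards [x]. Shrunk enough, it
    stays at positive distance from [C], and its section by [U] adds positive measure. *)
Lemma section_measure_strict U C D (x x0 : 'rV[R]_n) (r : R) : \dim U = m ->
  compact C -> C `<=` D -> (Hm C < +oo)%E ->
  (forall y z t, 0 <= t <= 1 -> D y -> D z -> D (t *: y + (1 - t) *: z)) ->
  x \in U -> D x -> ~ C x -> x0 \in U -> 0 < r ->
  (forall y, y \in U -> `|y - x0| <= r -> D y) ->
  (Hm C < Hm D)%E.
Proof.
move=> dU cC CD Cfin convD xU Dx nCx x0U r0 rD.
have clC : closed C by exact: compact_closed (@norm_hausdorff _ _) cC.
have [e e0 eC] : exists2 e, 0 < e & forall y, C y -> e <= `|x - y|.
  apply: contrapT => h; apply: nCx; apply: closed_mem_limit => // e e0.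
  apply: contrapT => h'; apply: h; exists e => // y Cy.
  by rewrite leNgt; apply/negP => h; apply: h'; exists y => //; exact: ltW.
pose L := `|x0 - x| + r.
have L0 : 0 < L by rewrite ltr_wpDl.
(* [L] bounds the distance from [x] to points of the ball about [x0], so the shrunk copy lies within
   [e / 2] of [x]. *)
pose t := Num.min 1 (e / 2 / L).
have t0 : 0 < t by rewrite lt_min ltr01/= !divr_gt0.
have t1 : t <= 1 by rewrite ge_min lexx.
have tL : t * L <= e / 2 by rewrite -ler_pdivlMr// ge_min lexx orbT.
pose xt := t *: x0 + (1 - t) *: x.
pose E : set 'rV[R]_n := [set y | y \in U /\ `|y - xt| <= t * r].
have xtU : xt \in U by rewrite memvD// memvZ.
have E0 : (0 < Hm E)%E.
  by apply: (@section_measure_gt0 U E xt (t * r)) => //; rewrite mulr_gt0.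
have Ex y : E y -> `|y - x| <= t * L.
  case=> yU yxt; have := ler_distD xt y x.
  have -> : xt - x = t *: (x0 - x).
    by rewrite /xt scalerBl scale1r scalerBr; apply/rowP => i; rewrite !mxE; ring.
  by rewrite normrZ gtr0_norm// mulrDr; lra.
have ED : E `<=` D.
  move=> y [yU yxt].
  have -> : y = t *: (x0 + t^-1 *: (y - xt)) + (1 - t) *: x.
    rewrite scalerDr scalerA mulfV ?gt_eqF// scale1r addrAC -/xt.
    by rewrite addrC subrK.
  apply: convD => //; first by rewrite t1 ltW.
  apply: rD; first by rewrite memvD// memvZ// memvB.
  rewrite addrC addKr normrZ gtr0_norm ?invr_gt0//.
  by rewrite ler_pdivrMl.
have sep : (Hm C + Hm E <= Hm (C `|` E))%E.
  apply: hausdorff_measure_sep; exists (e / 2); first by rewrite divr_gt0.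
  move=> c y Cc Ey; have := Ex _ Ey; have := eC _ Cc; have := ler_distD y x c.
  by rewrite (distrC x y) (distrC y c); move: tL; move: (t * L) => tl; lra.
apply: (@lt_le_trans _ _ (Hm C + Hm E)%E); last first.
  by rewrite (le_trans sep)// hausdorff_measureS// => y [/CD|/ED].
by rewrite lteDl// ge0_fin_numE ?hausdorff_measure_ge0.
Qed.

End sections.

(** * The Haar measure of the Grassmannian *)

(** Provides room for a Lipschitz constant slightly above 1 in [section_measure_usc]. *)
Lemma exists_factor_gt1 (R : realType) (m : nat) (b t : \bar R) : (0 < m)%N ->
  (0 <= b)%E -> (b < t)%E -> exists2 L : R, 1 < L & ((L ^+ m)%:E * b < t)%E.
Proof.
move=> m0; case: b => [b b0 bt||//]; last by move=> _; rewrite ltNge leey.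
have [rho rho1 rhob] : exists2 rho : R, 1 < rho & ((rho * b)%:E < t)%E.
  rewrite lee_fin in b0; case: t bt => [t bt|_|//]; last first.
    by exists 2; rewrite ?ltr1n// ltry.
  rewrite lte_fin in bt; have [->|bn0] := eqVneq b 0.
    by exists 2; rewrite ?ltr1n// mulr0 lte_fin (le_lt_trans b0).
  have bp : 0 < b by rewrite lt_neqAle eq_sym bn0.
  exists ((b + t) / (2 * b)); first by rewrite ltr_pdivlMr ?mulr_gt0//; lra.
  by rewrite lte_fin (_ : _ * b = (b + t) / 2); [lra | field].
have [L L0 Lm] := exists_root m0 (ltW (lt_trans ltr01 rho1)).
exists L; last by rewrite Lm -EFinM.
rewrite ltNge; apply/negP => L1; have : L ^+ m <= 1 by rewrite exprn_ile1.
by rewrite Lm leNgt rho1.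
Qed.

(** * Dependence of sections on the frame *)

Section frames.
Context (R : realType) (n m : nat) (m_gt0 : (0 < m)%N).
Implicit Types (M : 'M[R]_(m, n)) (K : set 'rV[R]_n).
Local Notation Hm := (@hausdorff_measure R n m).

(** Upper semicontinuity, the source of measurability. With [B] a right inverse of [M], the map by
    [B *m M'] carries the plane of [M] to that of [M']. For [M'] near [M] it is [L]-Lipschitz and
    displaces the relevant points by at most [r], so the new section lies in the image of a slightly
    thickened old one. *)
Lemma section_measure_usc M K (t : \bar R) : row_free M -> compact K ->
  (Hm ([set` row_space M] `&` K) < t)%E ->
  exists2 d : R, 0 < d & forall M' : 'M[R]_(m, n), `|M' - M| < d ->
    (Hm ([set` row_space M'] `&` K) < t)%E.
Proof.
move=> fM cK Kt; have [B MB] := row_freeP fM.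
have [D D0 KD] := compact_bound cK.
have [C hC] := section_measure_bounded m (closed_nbhd_bounded (r := 1) KD).
have dM := eqP (dim_row_space fM).
have [r r0 rt] : exists2 r, 0 < r &
    (Hm ([set` row_space M] `&` closed_nbhd r K) < t)%E.
  have [e e0 et] : exists2 e : R, 0 < e & (Hm ([set` row_space M] `&` K) + e%:E < t)%E.
    have : (Hm ([set` row_space M] `&` K) \is a fin_num).
      rewrite ge0_fin_numE ?hausdorff_measure_ge0// (le_lt_trans _ (ltry C))//.
      rewrite (le_trans _ (hC _ dM))// hausdorff_measureS// => x [Mx Kx]; split => //.
      by exists x => //; rewrite subrr normr0.
    move: Kt; case: (Hm _) => [a at_ _|//|//].
    case: t at_ => [t|_|//]; last by exists 1 => //; rewrite ltry.
    rewrite lte_fin => at_; exists ((t - a) / 2); first by rewrite divr_gt0// subr_gt0.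
    by rewrite -EFinD lte_fin; lra.
  have [||r r0 rK] := @closed_nbhd_cvg R n m [set` row_space M] K e _ e0.
  - exact: compact_closed (@norm_hausdorff _ _) cK.
  - by rewrite (le_lt_trans (hC _ dM))// ltry.
  by exists r => //; rewrite (le_lt_trans rK).
have [L L1 Lt] := exists_factor_gt1 m_gt0 (hausdorff_measure_ge0 _ _) rt.
pose be := n%:R * `|B| + 1.
have be0 : 0 < be by rewrite ltr_wpDl// mulr_ge0.
have yB (y : 'rV[R]_m) : `|y| <= be * `|y *m M|.
  rewrite -{1}[y]mulmx1 -MB mulmxA (le_trans (norm_mulmx_le _ _))//.
  by rewrite mulrAC ler_wpM2r// lerDl.
have n0 : (0 < n)%N by rewrite (leq_trans m_gt0)// -(eqP fM) rank_leq_col.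
have m1 : 1 <= m%:R :> R by rewrite ler1n.
have n1 : 1 <= n%:R :> R by rewrite ler1n.
(* One constant for three demands: [le1] gives norm at most [2 * D] to the points that [M'] sends
   into [K], [leD] keeps their displacement below [r], and [len] keeps the Lipschitz constant below
   [L]. *)
pose C1 := 2 * n%:R * m%:R * be * (D + 1).
have D10 : 0 < D + 1 by rewrite addr_gt0.
have C10 : 0 < C1 by rewrite !mulr_gt0// ltr0n.
pose d := Num.min 1 (Num.min r (L - 1)) / C1.
have d0 : 0 < d by rewrite divr_gt0// !lt_min ltr01 r0 subr_gt0 L1.
have dC1 : d * C1 = Num.min 1 (Num.min r (L - 1)) by rewrite divfK// gt_eqF.
have h1 : d * C1 <= 1 by rewrite dC1 ge_min lexx.
have hr : d * C1 <= r by rewrite dC1 !ge_min lexx !orbT.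
have hL : d * C1 <= L - 1 by rewrite dC1 !ge_min lexx !orbT.
clearbody d be.
have le1 : 2 * (m%:R * be * d) <= d * C1.
  rewrite (_ : d * C1 = (2 * (m%:R * be * d)) * (n%:R * (D + 1))); last by rewrite /C1; ring.
  rewrite ler_peMr//; [by rewrite !mulr_ge0// ltW|].
  by rewrite mulr_ege1// lerDr ltW.
have leD : 2 * m%:R * be * d * D <= d * C1.
  rewrite (_ : d * C1 = 2 * m%:R * be * d * ((D + 1) * n%:R)); last by rewrite /C1; ring.
  rewrite ler_wpM2l//; first by rewrite !mulr_ge0// ltW.
  by rewrite (@le_trans _ _ (D + 1))// ?lerDl// ler_peMr// addr_ge0// ltW.
have len : n%:R * m%:R * be * d <= d * C1.
  rewrite (_ : d * C1 = n%:R * m%:R * be * d * (2 * (D + 1))); last by rewrite /C1; ring.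
  rewrite ler_peMr//; [by rewrite !mulr_ge0// ltW|].
  by move: D0; lra.
exists d => // M' M'd.
have diff (y : 'rV[R]_m) : `|y *m M' - y *m M| <= m%:R * be * d * `|y *m M|.
  rewrite -mulmxBr (le_trans (norm_mulmx_le _ _))//.
  rewrite (_ : m%:R * be * d * _ = m%:R * (be * `|y *m M|) * d); last by ring.
  by rewrite ler_pM ?mulr_ge0// ?ler_wpM2l// ltW.
apply: le_lt_trans Lt.
apply: (@le_trans _ _ (Hm [set x *m (B *m M') | x in [set` row_space M] `&` closed_nbhd r K])).
  apply: hausdorff_measureS => _ [/mem_row_space[y ->] Ky].
  exists (y *m M); last by rewrite mulmxA -(mulmxA y) MB mulmx1.
  split; first by apply/mem_row_space; exists y.
  exists (y *m M') => //; rewrite distrC.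
  have := diff y; have := KD _ Ky; have := ler_distD (y *m M') (y *m M) 0.
  rewrite !subr0 (distrC (y *m M)).
  move: (`|_ - _|) (`|y *m M|) (`|y *m M'|) (normr_ge0 (y *m M)) => u v w v0 h2 h3 h4.
  have vD : v <= 2 * D.
    have : 2 * (m%:R * be * d) * v <= 1 * v by rewrite ler_wpM2r// (le_trans le1).
    by lra.
  rewrite (le_trans h4)// (le_trans _ hr)// (le_trans _ leD)//.
  rewrite (_ : 2 * m%:R * be * d * D = m%:R * be * d * (2 * D)); last by ring.
  by rewrite ler_wpM2l// !mulr_ge0// ltW.
apply: hausdorff_measure_lipschitz; first by rewrite (lt_trans ltr01).
move=> _ _ [/mem_row_space[y ->] _] [/mem_row_space[z ->] _].
rewrite -!mulmxBl !mulmxA -(mulmxA _ M) MB mulmx1.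
move: (y - z) => {y z} y; rewrite -[y *m M'](subrK (y *m M)).
rewrite (le_trans (enormD _ _))// -[L](subrK 1) mulrDl mul1r lerD2r.
rewrite (le_trans (enorm_le_norm _))//.
apply: (@le_trans _ _ (n%:R * (m%:R * be * d * `|y *m M|))); first by rewrite ler_wpM2l.
rewrite !mulrA (le_trans (ler_wpM2r _ len))// (le_trans (ler_wpM2r _ hL))//.
by rewrite ler_wpM2l ?norm_le_enorm// subr_ge0 ltW.
Qed.

Lemma row_space_meets_open M (O : set 'rV[R]_n) : open O ->
  (exists2 x, x \in row_space M & O x) ->
  exists2 d : R, 0 < d & forall M' : 'M[R]_(m, n), `|M' - M| < d ->
    exists2 x, x \in row_space M' & O x.
Proof.
move=> oO [_ /mem_row_space[y ->] Oy].
have /nbhs_ballP[e /= e0 eO] : nbhs (y *m M) O by exact: open_nbhs_nbhs.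
have C0 : 0 < m%:R * `|y| + 1 by rewrite ltr_wpDl// mulr_ge0.
exists (e / (m%:R * `|y| + 1)); first by rewrite divr_gt0.
move=> M' M'd; exists (y *m M'); first by apply/mem_row_space; exists y.
apply: eO; rewrite -ball_normE /= -mulmxBr (le_lt_trans (norm_mulmx_le _ _))//.
rewrite distrC (@le_lt_trans _ _ ((m%:R * `|y| + 1) * `|M' - M|))//.
  by rewrite ler_wpM2r// lerDl.
by rewrite mulrC -ltr_pdivlMr.
Qed.

End frames.

Section grassmannian_borel.
Context (R : realType) (n m : nat) (m_gt0 : (0 < m)%N) (h : (m <= n)%N).
Local Notation G := (grassmannian R h).
Local Notation BG := (borel_grassmannian R h).
Local Notation Hm := (@hausdorff_measure R n m).

Lemma dim_grassmannian (xi : G) : \dim (val xi) = m.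
Proof. exact/eqP/(valP xi). Qed.

Lemma open_grassmannian (P : {vspace 'rV[R]_n} -> Prop) :
  (forall M : 'M[R]_(m, n), row_free M -> P (row_space M) ->
    exists2 d : R, 0 < d & forall M' : 'M[R]_(m, n), `|M' - M| < d -> P (row_space M')) ->
  open [set xi : G | P (val xi)].
Proof.
move=> hP; suff : grassmannian_open [set xi : G | P (val xi)] by [].
have frE M : row_free M -> frames [set xi : G | P (val xi)] M <-> P (row_space M).
  move=> fM; split => [[U PU <-]//|PM].
  by exists (exist _ (row_space M) (dim_row_space fM)).
apply/open_subspaceP; exists (interior [set M | P (row_space M)]).
  exact: open_interior.
apply/seteqP; split => M [PM fM]; split => //.
  by apply/frE => //; apply: interior_subset PM.
move/(frE _ fM) : PM => /(hP _ fM)[d d0 dP]; apply/nbhs_ballP; exists d => // M'.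
by rewrite -ball_normE /= distrC; exact: dP.
Qed.

Lemma open_measurable_grassmannian (A : set G) : open A -> measurable (A : set BG).
Proof. exact: sub_sigma_algebra. Qed.

Definition section_measure (K : set 'rV[R]_n) (xi : BG) : \bar R :=
  Hm ([set` val (xi : G)] `&` K).

(** By upper semicontinuity, the planes with section measure below [a] form an open set. *)
Lemma measurable_section_measure (K : set 'rV[R]_n) : compact K ->
  measurable_fun [set: BG] (section_measure K).
Proof.
move=> cK; apply: (measurability _ (ErealGenInftyO.measurableE R)).
move=> /= _ [_ [a ->]] <-; rewrite setTI.
apply: open_measurable_grassmannian.
rewrite (_ : _ @^-1` _ = [set xi : G | (Hm ([set` val xi] `&` K) < a%:E)%E]).
  apply: (@open_grassmannian (fun U => (Hm ([set` U] `&` K) < a%:E)%E)) => M fM.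
  exact: section_measure_usc.
by apply/seteqP; split => xi /=; rewrite in_itv.
Qed.

Definition meeting_planes (O : set 'rV[R]_n) : set G := 
  [set xi : G | exists2 x, x \in (val xi : {vspace 'rV[R]_n}) & O x].

Lemma measurable_meeting_planes O : open O -> measurable (meeting_planes O : set BG).
Proof.
move=> oO; apply: open_measurable_grassmannian.
apply: (@open_grassmannian (fun U => exists2 x, x \in U & O x)) => M _.
exact: row_space_meets_open.
Qed.

Lemma rotate_meeting_planes (Q : 'M[R]_n) O : Q *m Q^T = 1%:M ->
  rotate Q (meeting_planes O) = meeting_planes [set x *m Q | x in O].
Proof.
move=> QQ; have QQ' : Q^T *m Q = 1%:M by exact: mulmx1C.
apply/seteqP; split => [V [U [x Ux Ox] VE]|V [y Vx [x Ox yE]]].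
  exists (x *m Q); last by exists x.
  by rewrite VE; apply/memv_imgP; exists x => //; rewrite lfunE.
rewrite -{y}yE in Vx; pose f S := linfun (mulmxr S : 'rV[R]_n -> 'rV[R]_n).
have fE S y : f S y = y *m S by rewrite lfunE.
have dU : \dim (f Q^T @: val V)%VS == m.
  rewrite limg_dim_eq ?(dim_grassmannian V)//; apply/eqP.
  rewrite -subv0; apply/subvP => y; rewrite memv_cap => /andP[_].
  rewrite memv_ker fE => /eqP y0; rewrite memv0 -[y]mulmx1 -QQ' mulmxA y0 mul0mx.
  by [].
exists (exist (fun U : {vspace 'rV[R]_n} => \dim U == m) _ dU).
  exists x => //=; apply/memv_imgP; exists (x *m Q) => //.
  by rewrite fE -mulmxA QQ mulmx1.
apply/vspaceP => y; apply/idP/idP => [Vy|/memv_imgP[z /memv_imgP[w Vw ->] ->]].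
  apply/memv_imgP; exists (y *m Q^T); last by rewrite fE -mulmxA QQ' mulmx1.
  by apply/memv_imgP; exists y => //; rewrite fE.
by rewrite !fE -mulmxA QQ' mulmx1.
Qed.

End grassmannian_borel.

(* The Householder reflection in the hyperplane orthogonal to x - y. *)
Lemma exists_orthogonal_map (R : realType) (n : nat) (x y : 'rV[R]_n) :
  enorm x = enorm y -> exists2 Q : 'M[R]_n, Q *m Q^T = 1%:M & x *m Q = y.
Proof.
move=> xy; have [<-|nxy] := eqVneq x y.
  by exists 1%:M; rewrite ?trmx1 mulmx1.
pose w := x - y; have w0 : edot w w != 0 by rewrite edot_eq0 subr_eq0.
have dotxy : edot x x = edot y y by rewrite -!sqr_enorm xy.
have ww : w *m w^T = (edot w w)%:M.
  by apply/matrixP => i j; rewrite !ord1 -edotE !mxE eqxx.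
pose c := 2 / edot w w.
pose Q : 'M[R]_n := 1%:M - c *: (w^T *m w).
have QT : Q^T = Q by rewrite /Q linearB /= trmx1 linearZ /= trmx_mul trmxK.
exists Q.
  have PP : (w^T *m w) *m (w^T *m w) = edot w w *: (w^T *m w).
    by rewrite -mulmxA (mulmxA w) ww mul_scalar_mx -scalemxAr.
  rewrite QT /Q; move: (w^T *m w) PP => P PP.
  rewrite mulmxBl mul1mx mulmxBr mulmx1 -scalemxAl -scalemxAr PP !scalerA.
  rewrite (_ : c * c * edot w w = c + c); last by rewrite /c; field.
  by rewrite scalerDl opprB addrK subrK.
rewrite /Q mulmxBr mulmx1 -scalemxAr mulmxA.
have -> : x *m w^T = (edot x w)%:M.
  by apply/matrixP => i j; rewrite !ord1 -edotE !mxE eqxx.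
rewrite mul_scalar_mx scalerA (_ : c * edot x w = 1).
  by rewrite scale1r opprB addrCA subrr addr0.
have -> : edot x w = edot w w / 2.
  by rewrite /w !(edotDl, edotDr, edotNl, edotNr) -dotxy (edotC y x); field.
by rewrite /c; field.
Qed.

Section haar.
Context (R : realType) (n m : nat) (m_gt0 : (0 < m)%N) (h : (m <= n)%N).
Context (nu : probability (borel_grassmannian R h) R) (hnu : haar_probability nu).

(** Finitely many rotated copies of [O] cover the sphere through one of its nonzero points. Every
    plane contains a point of that sphere, hence meets one of the copies. By invariance the planes
    meeting a copy have the measure of those meeting [O], which cannot be 0 as finitely many such
    sets exhaust the Grassmannian. *)
Lemma haar_meeting_planes_gt0 (O : set 'rV[R]_n) : open O -> O !=set0 -> (0 < nu (meeting_planes O))%E.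
Proof.
move=> oO [x0 Ox0].
have n_gt0 : (0 < n)%N := leq_trans m_gt0 h.
have [x Ox xn0] : exists2 x, O x & x != 0.
  have [x00|] := eqVneq x0 0; last by exists x0.
  have /nbhs_ballP[e /= e0 eO] : nbhs x0 O by exact: open_nbhs_nbhs.
  exists (const_mx (e / 2)).
    apply: eO; rewrite -ball_normE /= x00 sub0r normrN.
    apply: norm_rV_lt => // i; rewrite mxE gtr0_norm ?divr_gt0//.
    by rewrite ltr_pdivrMr// ltr_pMr// ltr1n.
  apply/eqP => /rowP/(_ (Ordinal n_gt0)); rewrite !mxE => /eqP.
  by rewrite gt_eqF// divr_gt0.
have nx : 0 < enorm x by rewrite lt_neqAle eq_sym enorm_eq0 xn0 enorm_ge0.
pose S := [set y : 'rV[R]_n | enorm y = enorm x].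
have cS : compact S.
  apply: bounded_closed_compact.
    exists (enorm x); split; first exact: num_real.
    by move=> z hz y /= yS; rewrite (le_trans (norm_le_enorm _))// yS ltW.
  have /continuous_closedP/(_ [set enorm x]) := @enorm_continuous R n; apply.
  exact: accessible_closed_set1 (hausdorff_accessible (@norm_hausdorff _ R^o)) _.
have [Q hQ] : {Q : 'rV[R]_n -> 'M[R]_n & forall y, S y -> Q y *m (Q y)^T = 1%:M /\ x *m Q y = y}.
  apply: (@choice _ _ (fun y Qy => S y -> Qy *m Qy^T = 1%:M /\ x *m Qy = y)) => y.
  have [Sy|nSy] := pselect (S y); last by exists 0.
  by have [Q QQ xQ] := exists_orthogonal_map (esym Sy); exists Q.
pose OQ y := [set z *m Q y | z in O].
have oOQ y : S y -> open (OQ y).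
  move=> Sy; have [QQ _] := hQ y Sy; have QQ' := mulmx1C QQ.
  rewrite (_ : OQ y = (fun z => z *m (Q y)^T) @^-1` O).
    by apply: open_comp oO => z _; exact: mulmxr_continuous.
  apply/seteqP; split => [_ [z Oz <-] /=|z Oz]; first by rewrite -mulmxA QQ mulmx1.
  by exists (z *m (Q y)^T) => //; rewrite -mulmxA QQ' mulmx1.
have nuOQ y : S y -> nu (meeting_planes (OQ y)) = nu (meeting_planes O).
  move=> Sy; rewrite -rotate_meeting_planes ?(hQ y Sy).1//; apply: hnu; first exact: (hQ y Sy).1.
  exact: measurable_meeting_planes.
move: cS; rewrite compact_cover => /(_ _ S OQ oOQ)[|F FS SF].
  by move=> y Sy; exists y => //; exists x => //; exact: (hQ y Sy).2.
rewrite lt_neqAle measure_ge0 andbT eq_sym; apply/eqP => nu0.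
suff : (nu setT <= 0)%E by rewrite probability_setT lee_fin ler10.
have mF y : y \in F -> measurable (meeting_planes (OQ y) : set (borel_grassmannian R h)).
  by move=> yF; apply: measurable_meeting_planes; apply: oOQ; exact: set_mem (FS _ yF).
pose B := \big[setU/set0]_(y <- enum_fset F) (meeting_planes (OQ y) : set (borel_grassmannian R h)).
have [mB nuB] : measurable B /\ nu B = 0%E.
  rewrite /B big_seq; elim/big_rec: _ => [|y C yF [mC nC]]; first by rewrite measure0.
  split; first by apply: measurableU => //; exact: mF.
  rewrite measureU0//; last exact: mF.
  by apply: etrans nu0; apply: nuOQ; exact: set_mem (FS _ yF).
rewrite -nuB; apply: le_measure; [exact/mem_set/measurableT | exact/mem_set |] => xi _.
have /subvPn[y yxi y0] : ~~ (val (xi : grassmannian R h) <= 0)%VS.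
  apply/negP; rewrite subv0 => /eqP v0; have := dim_grassmannian xi.
  by rewrite v0 dimv0 => m0; have := m_gt0; rewrite -m0.
rewrite memv0 in y0.
have ny : 0 < enorm y by rewrite lt_neqAle eq_sym enorm_eq0 y0 enorm_ge0.
pose z := (enorm x / enorm y) *: y.
have Sz : S z by rewrite /S /= enormZ gtr0_norm ?divr_gt0// divfK// gt_eqF.
have [w wF OQz] := SF _ Sz; rewrite /B -bigcup_seq; exists w => //; exists z => //.
exact: memvZ.
Qed.

End haar.

(** * L_p means *)

Section power_inequalities.
Context (R : realType).
Implicit Types (a b s w x y p : R).

(** Strict Bernoulli inequality, from [1 + x < expR x] at [(1 - s) * ln w] and at [- (s * ln w)]:
    with weights [s] and [1 - s] the logarithms cancel. *)
Lemma powR_lt_tangent s w : 0 < s < 1 -> 0 <= w -> w != 1 -> w `^ s < 1 + s * (w - 1).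
Proof.
move=> /andP[s0 s1] w0 w1; have [->|wn0] := eqVneq w 0.
  by rewrite powR0 ?gt_eqF//; lra.
have wp : 0 < w by rewrite lt_neqAle eq_sym wn0.
have lw0 : ln w != 0 by rewrite ln_eq0.
have g0 : 0 < w `^ s by rewrite powR_gt0.
have h1 : 1 + (1 - s) * ln w < w / w `^ s.
  have -> : w / w `^ s = expR ((1 - s) * ln w).
    rewrite /powR gt_eqF// -expRN mulrBl mul1r expRD lnK ?posrE//.
  by rewrite expR_gt1Dx// mulf_neq0// gt_eqF// subr_gt0.
have h2 : 1 - s * ln w < (w `^ s)^-1.
  rewrite /powR gt_eqF// -expRN (lt_le_trans (expR_gt1Dx _))//.
  by rewrite oppr_eq0 mulf_neq0// gt_eqF.
have h : 1 < s * (w / w `^ s) + (1 - s) * (w `^ s)^-1.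
  have e1 : s * (1 + (1 - s) * ln w) < s * (w / w `^ s) by rewrite ltr_pM2l.
  have e2 : (1 - s) * (1 - s * ln w) < (1 - s) * (w `^ s)^-1.
    by rewrite ltr_pM2l// subr_gt0.
  by lra.
have -> : 1 + s * (w - 1) = (s * (w / w `^ s) + (1 - s) * (w `^ s)^-1) * w `^ s.
  by field; rewrite gt_eqF.
by rewrite -[ltLHS]mul1r ltr_pM2r.
Qed.

(** The previous inequality for the exponent [s^-1], taken at [powR w s]. *)
Lemma powR_gt_tangent s w : 1 < s -> 0 <= w -> w != 1 -> 1 + s * (w - 1) < w `^ s.
Proof.
move=> s1 w0 w1; have s0 : 0 < s by rewrite (lt_trans ltr01).
have u1 : w `^ s != 1.
  by rewrite powR_eq1 !negb_or w1 -leNgt w0 gt_eqF.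
have si : 0 < s^-1 < 1 by rewrite invr_gt0 s0 invf_lt1.
have := powR_lt_tangent si (powR_ge0 w s) u1.
rewrite -powRrM mulfV ?gt_eqF// powRr1// => h.
have : s * w < s * (1 + s^-1 * (w `^ s - 1)) by rewrite ltr_pM2l.
rewrite mulrDr mulrA mulfV ?gt_eqF//; lra.
Qed.

Lemma powR_gt_tangent_neg s w : s < 0 -> 0 < w -> w != 1 -> 1 + s * (w - 1) < w `^ s.
Proof.
move=> s0 w0 w1; have lw0 : ln w != 0 by rewrite ln_eq0.
have h1 : 1 + ln w < w by rewrite -[ltRHS]lnK ?posrE// expR_gt1Dx.
have h2 : 1 + s * ln w < w `^ s.
  by rewrite /powR gt_eqF// expR_gt1Dx// mulf_neq0// lt_eqF.
have : s * w < s * (1 + ln w) by rewrite ltr_nM2l.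
by lra.
Qed.

(* Jensen's inequality for two points from the tangent line at their mean;
   sg = 1 and sg = -1 are the concave and the convex case. *)
Lemma jensen2_of_tangent (sg s theta a b : R) : 0 < theta < 1 -> 0 <= a -> 0 <= b ->
  0 < theta * a + (1 - theta) * b ->
  (forall w, w = a / (theta * a + (1 - theta) * b) \/
             w = b / (theta * a + (1 - theta) * b) ->
     w != 1 -> sg * w `^ s < sg * (1 + s * (w - 1))) ->
  sg * (theta * a `^ s + (1 - theta) * b `^ s) <= sg * (theta * a + (1 - theta) * b) `^ s /\
  (theta * a `^ s + (1 - theta) * b `^ s = (theta * a + (1 - theta) * b) `^ s -> a = b).
Proof.
move=> /andP[th0 th1] a0 b0; set Z := theta * a + _ => Z0 tangent.
have Zs : 0 < Z `^ s by rewrite powR_gt0.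
have th' : 0 < 1 - theta by rewrite subr_gt0.
have powE c : 0 <= c -> c `^ s = (c / Z) `^ s * Z `^ s.
  by move=> c0; rewrite -powRM ?divr_ge0 ?(ltW Z0)// divfK// gt_eqF.
(* Height of the tangent line over the power at [c / Z]. In the weighted sum of the two gaps the
   linear terms cancel, since [a / Z] and [b / Z] have weighted mean 1. *)
pose gap c := sg * (1 + s * (c / Z - 1)) - sg * (c / Z) `^ s.
have gap_ge0 c : c = a \/ c = b -> 0 <= gap c.
  move=> cab; rewrite subr_ge0; have [->|w1] := eqVneq (c / Z) 1.
    by rewrite powR1 subrr mulr0 addr0.
  by apply/ltW/tangent => //; case: cab => ->; [left|right].
have gap_eq0 c : c = a \/ c = b -> gap c = 0 -> c = Z.
  move=> cab /eqP; rewrite subr_eq0 => /eqP g0; apply/eqP.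
  rewrite -[Z]mul1r -(can2_eq (divfK (negbT (gt_eqF Z0))) (mulfK (negbT (gt_eqF Z0)))).
  apply: contraT => w1; have : c / Z = a / Z \/ c / Z = b / Z.
    by case: cab => ->; [left|right].
  by move=> /tangent /(_ w1); rewrite g0 ltxx.
have diffE : sg * Z `^ s - sg * (theta * a `^ s + (1 - theta) * b `^ s) =
    (theta * gap a + (1 - theta) * gap b) * Z `^ s.
  rewrite (powE a)// (powE b)// /gap.
  have E : theta * (a / Z) + (1 - theta) * (b / Z) = 1.
    by rewrite !mulrA -mulrDl mulfV// gt_eqF.
  move: ((a / Z) `^ s) ((b / Z) `^ s) (Z `^ s) (a / Z) (b / Z) E => u v z x y E.
  have -> : y = (1 - theta * x) / (1 - theta).
    have <- : (1 - theta) * y = 1 - theta * x by lra.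
    by rewrite mulrC mulKf// gt_eqF.
  by field; rewrite gt_eqF.
have ga := gap_ge0 a (or_introl erefl); have gb := gap_ge0 b (or_intror erefl).
split.
  rewrite -subr_ge0 diffE mulr_ge0 ?(ltW Zs)// addr_ge0// mulr_ge0// ltW//.
move=> eqZ; move/eqP: diffE; rewrite eqZ subrr eq_sym mulf_eq0 (gt_eqF Zs) orbF.
rewrite paddr_eq0 ?mulr_ge0 ?(ltW th0) ?(ltW th')//.
rewrite !mulf_eq0 (gt_eqF th0) (gt_eqF th')/= => /andP[/eqP ga0 /eqP gb0].
by rewrite (gap_eq0 a)//; [rewrite (gap_eq0 b)//; right | left].
Qed.

Lemma powR_concave2 s theta a b : 0 < s < 1 -> 0 < theta < 1 -> 0 <= a -> 0 <= b ->
  theta * a `^ s + (1 - theta) * b `^ s <= (theta * a + (1 - theta) * b) `^ s /\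
  (theta * a `^ s + (1 - theta) * b `^ s = (theta * a + (1 - theta) * b) `^ s -> a = b).
Proof.
move=> s01 th a0 b0; have /andP[th0 th1] := th; have /andP[s0 s1] := s01.
have ta : 0 <= theta * a by rewrite mulr_ge0// ltW.
have tb : 0 <= (1 - theta) * b by rewrite mulr_ge0// subr_ge0 ltW.
have [/eqP|Z0] := eqVneq (theta * a + (1 - theta) * b) 0.
  rewrite paddr_eq0// !mulf_eq0 (gt_eqF th0) subr_eq0 (gt_eqF th1)/=.
  by move=> /andP[/eqP -> /eqP ->]; rewrite !powR0 ?gt_eqF// !mulr0 addr0 powR0 ?gt_eqF.
have := @jensen2_of_tangent 1 s theta a b th a0 b0; rewrite !mul1r; apply.
  by rewrite lt_neqAle eq_sym Z0 addr_ge0.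
move=> w wE w1; rewrite !mul1r; apply: powR_lt_tangent => //.
by case: wE => ->; rewrite divr_ge0// addr_ge0.
Qed.

Lemma powR_convex2 s theta a b : 1 < s -> 0 < theta < 1 -> 0 <= a -> 0 <= b ->
  (theta * a + (1 - theta) * b) `^ s <= theta * a `^ s + (1 - theta) * b `^ s /\
  (theta * a `^ s + (1 - theta) * b `^ s = (theta * a + (1 - theta) * b) `^ s -> a = b).
Proof.
move=> s1 th a0 b0; have /andP[th0 th1] := th; have s0 : 0 < s by rewrite (lt_trans ltr01).
have ta : 0 <= theta * a by rewrite mulr_ge0// ltW.
have tb : 0 <= (1 - theta) * b by rewrite mulr_ge0// subr_ge0 ltW.
have [/eqP|Z0] := eqVneq (theta * a + (1 - theta) * b) 0.
  rewrite paddr_eq0// !mulf_eq0 (gt_eqF th0) subr_eq0 (gt_eqF th1)/=.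
  by move=> /andP[/eqP -> /eqP ->]; rewrite !powR0 ?gt_eqF// !mulr0 addr0 powR0 ?gt_eqF.
have := @jensen2_of_tangent (-1) s theta a b th a0 b0; rewrite !mulN1r lerN2; apply.
  by rewrite lt_neqAle eq_sym Z0 addr_ge0.
move=> w wE w1; rewrite !mulN1r ltrN2; apply: powR_gt_tangent => //.
by case: wE => ->; rewrite divr_ge0// addr_ge0.
Qed.

Lemma powR_convex2_neg s theta a b : s < 0 -> 0 < theta < 1 -> 0 < a -> 0 < b ->
  (theta * a + (1 - theta) * b) `^ s <= theta * a `^ s + (1 - theta) * b `^ s /\
  (theta * a `^ s + (1 - theta) * b `^ s = (theta * a + (1 - theta) * b) `^ s -> a = b).
Proof.
move=> s0 th a0 b0; have /andP[th0 th1] := th.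
have Z0 : 0 < theta * a + (1 - theta) * b by rewrite addr_gt0// mulr_gt0// subr_gt0.
have := @jensen2_of_tangent (-1) s theta a b th (ltW a0) (ltW b0) Z0.
rewrite !mulN1r lerN2; apply => w wE w1; rewrite !mulN1r ltrN2.
by apply: powR_gt_tangent_neg => //; case: wE => ->; rewrite divr_gt0.
Qed.

Definition lp_mean p alpha beta x y : R := (alpha * x `^ p + beta * y `^ p) `^ p^-1.

Section lp_mean.
Context (p alpha beta : R) (p1 : 1 < p) (alpha0 : 0 < alpha) (beta0 : 0 < beta).
Local Notation mean := (lp_mean p alpha beta).

Let p0 : 0 < p. Proof. exact: lt_trans ltr01 p1. Qed.
Let pn0 : p != 0. Proof. by rewrite gt_eqF. Qed.

Let sum_ge0 x y : 0 <= alpha * x `^ p + beta * y `^ p.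
Proof. by rewrite addr_ge0// mulr_ge0 ?powR_ge0// ltW. Qed.

Lemma lp_mean_ge0 x y : 0 <= mean x y.
Proof. exact: powR_ge0. Qed.

Lemma lp_mean_pow x y : mean x y `^ p = alpha * x `^ p + beta * y `^ p.
Proof. by rewrite -powRrM mulVf// powRr1. Qed.

Lemma lp_mean_le x y x' y' : 0 <= x <= x' -> 0 <= y <= y' -> mean x y <= mean x' y'.
Proof.
move=> /andP[x0 xx] /andP[y0 yy]; apply: ge0_ler_powR; rewrite ?nnegrE ?sum_ge0 ?invr_ge0 ?(ltW p0)//.
have x'0 := le_trans x0 xx; have y'0 := le_trans y0 yy.
by apply: lerD; rewrite ler_pM2l//; apply: ge0_ler_powR; rewrite ?nnegrE ?(ltW p0).
Qed.

Lemma lp_meanZ c x y : 0 <= c -> 0 <= x -> 0 <= y -> mean (c * x) (c * y) = c * mean x y.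
Proof.
move=> c0 x0 y0; rewrite /lp_mean !powRM// ![_ * (c `^ p * _)]mulrCA -mulrDr.
by rewrite powRM ?powR_ge0// -powRrM mulfV// powRr1.
Qed.

Lemma lp_mean_left x y : 0 <= x -> alpha `^ p^-1 * x <= mean x y.
Proof.
move=> x0; rewrite -[x in leLHS](powRr1 x0) -(mulfV pn0) powRrM -powRM ?powR_ge0 ?(ltW alpha0)//.
apply: ge0_ler_powR; rewrite ?nnegrE ?sum_ge0 ?invr_ge0 ?(ltW p0)//.
  by rewrite mulr_ge0 ?powR_ge0// ltW.
by rewrite lerDl mulr_ge0 ?powR_ge0// ltW.
Qed.

Lemma lp_mean_right x y : 0 <= y -> beta `^ p^-1 * y <= mean x y.
Proof.
move=> y0; rewrite -[y in leLHS](powRr1 y0) -(mulfV pn0) powRrM -powRM ?powR_ge0 ?(ltW beta0)//.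
apply: ge0_ler_powR; rewrite ?nnegrE ?sum_ge0 ?invr_ge0 ?(ltW p0)//.
  by rewrite mulr_ge0 ?powR_ge0// ltW.
by rewrite lerDr mulr_ge0 ?powR_ge0// ltW.
Qed.

(* Hölder's inequality: (s, t) is the normal of the unit sphere of the weighted
   l_p norm at (a, b). *)
Lemma lp_mean_supporting a b : 0 < a -> 0 < b ->
  exists s t, [/\ 0 < s, 0 < t, s * a + t * b = mean a b &
    forall x y, 0 <= x -> 0 <= y -> s * x + t * y <= mean x y /\
      (s * x + t * y = mean x y -> x * b = y * a)].
Proof.
move=> a0 b0; pose D := mean a b.
have ap : 0 < alpha * a `^ p by rewrite mulr_gt0// powR_gt0.
have bp : 0 < beta * b `^ p by rewrite mulr_gt0// powR_gt0.
have D0 : 0 < D by rewrite powR_gt0// addr_gt0.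
have Dp : D `^ p = alpha * a `^ p + beta * b `^ p by exact: lp_mean_pow.
have Dp0 : 0 < D `^ p by rewrite powR_gt0.
(* With the weights [th] and [1 - th] the claim becomes convexity of the p-th power at the points
   [x / a] and [y / b]; the normal consists of these weights rescaled by [D / a] and [D / b]. *)
pose th := alpha * a `^ p / D `^ p.
have th'E : 1 - th = beta * b `^ p / D `^ p.
  by rewrite /th -[X in X - _](mulfV (negbT (gt_eqF Dp0))) -mulrBl {1}Dp addrAC subrr add0r.
have th0 : 0 < th by rewrite divr_gt0.
have th'0 : 0 < 1 - th by rewrite th'E divr_gt0.
have th01 : 0 < th < 1 by rewrite th0 -subr_gt0.
exists (th * D / a), ((1 - th) * D / b); split.
- by rewrite divr_gt0// mulr_gt0.
- by rewrite divr_gt0// mulr_gt0.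
- by rewrite !divfK ?gt_eqF// -mulrDl addrCA subrr addr0 mul1r.
move=> x y x0 y0.
have [le eqc] := powR_convex2 p1 th01 (divr_ge0 x0 (ltW a0)) (divr_ge0 y0 (ltW b0)).
have sumE : th * D / a * x + (1 - th) * D / b * y = D * (th * (x / a) + (1 - th) * (y / b)).
  by field; rewrite !gt_eqF.
have meanE : mean x y = D * (th * (x / a) `^ p + (1 - th) * (y / b) `^ p) `^ p^-1.
  set S := th * _ + _; have S0 : 0 <= S.
    by rewrite addr_ge0// mulr_ge0 ?powR_ge0// ltW.
  have -> : mean x y = (D `^ p * S) `^ p^-1.
    rewrite /S th'E /th /lp_mean; congr (_ `^ _).
    have -> : x `^ p = a `^ p * (x / a) `^ p.
      by rewrite -powRM ?divr_ge0 ?(ltW a0)// mulrC divfK// gt_eqF.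
    have -> : y `^ p = b `^ p * (y / b) `^ p.
      by rewrite -powRM ?divr_ge0 ?(ltW b0)// mulrC divfK// gt_eqF.
    by field; rewrite gt_eqF.
  by rewrite powRM ?powR_ge0// -powRrM mulfV// powRr1// ltW.
have Z0 : 0 <= th * (x / a) + (1 - th) * (y / b).
  by rewrite addr_ge0// mulr_ge0 ?divr_ge0// ltW.
have zE : (th * (x / a) + (1 - th) * (y / b)) `^ p `^ p^-1 = th * (x / a) + (1 - th) * (y / b).
  by rewrite -powRrM mulfV// powRr1.
rewrite sumE meanE; split.
  rewrite (ler_pM2l D0) -{1}zE; apply: ge0_ler_powR _ _ _ le; rewrite ?nnegrE.
  - by rewrite invr_ge0 ltW.
  - exact: powR_ge0.
  - by rewrite addr_ge0// mulr_ge0 ?powR_ge0// ltW.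
move=> /(mulfI (negbT (gt_eqF D0))) eqD.
have : x / a = y / b.
  apply: eqc; rewrite eqD -powRrM mulVf// powRr1// addr_ge0// mulr_ge0 ?powR_ge0// ltW//.
by move=> /eqP; rewrite eqr_div ?(negbT (gt_eqF a0)) ?(negbT (gt_eqF b0))// => /eqP.
Qed.

End lp_mean.

End power_inequalities.

(** * L_p combinations *)

Section support_functions.
Context (R : realType) (n : nat).
Implicit Types (K L : set 'rV[R]_n) (x y u : 'rV[R]_n).

Definition segment_closed K := forall y z t, 0 <= t <= 1 -> K y -> K z ->
  K (t *: y + (1 - t) *: z).

Lemma convex_set_segment_closed K :
  convex_set (K : set (convex_lmodType 'rV[R]_n)) -> segment_closed K.
Proof.
move=> cK y z t /andP[t0 t1] Ky Kz.
exact: set_mem (cK y z (Itv01 t0 t1) (mem_set Ky) (mem_set Kz)).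
Qed.

Lemma segment_closed_scale K c : segment_closed K -> segment_closed [set c *: x | x in K].
Proof.
move=> sK _ _ t t01 [y Ky <-] [z Kz <-]; exists (t *: y + (1 - t) *: z); first exact: sK.
by rewrite scalerDr !scalerA ![c * _]mulrC.
Qed.

Lemma compact_scale K c : compact K -> compact [set c *: x | x in K].
Proof.
move=> cK; apply: continuous_compact => //; apply: continuous_subspaceT.
exact: scaler_continuous.
Qed.

Lemma edot_continuous u : continuous (fun x => edot x u).
Proof.
have -> : (fun x => edot x u) = (fun z : 'rV[R]_1 => z ord0 ord0) \o (fun x => x *m u^T).
  by apply/funext => x /=; rewrite edotE.
move=> x; apply: continuous_comp; first exact: mulmxr_continuous.
exact: coord_continuous.
Qed.

Lemma support_fun_attained K u : compact K -> K !=set0 ->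
  exists2 x, K x & edot x u = support_fun K u /\ forall y, K y -> edot y u <= edot x u.
Proof.
move=> cK K0.
have [x + hx] := EVT_max_rV K0 cK (continuous_subspaceT (@edot_continuous u)).
move=> /set_mem Kx; have hx' y : K y -> edot y u <= edot x u by move=> /mem_set/hx.
exists x => //; split => //; apply/eqP; rewrite eq_le; apply/andP; split.
  by apply: ub_le_sup; [exists (edot x u) => _ [y Ky <-]; exact: hx' | exists x].
by apply: ge_sup => [|_ [y Ky <-]]; [exists (edot x u); exists x | exact: hx'].
Qed.

Lemma support_fun_ge K x u : compact K -> K x -> edot x u <= support_fun K u.
Proof.
move=> cK Kx; have K0 : K !=set0 by exists x.
by have [y _ [<- h]] := support_fun_attained u cK K0; exact: h.
Qed.

Lemma support_fun_ge0 K u : compact K -> K 0 -> 0 <= support_fun K u.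
Proof. by move=> cK K0; have := support_fun_ge u cK K0; rewrite edot0l. Qed.

Lemma support_fun_scale K c u : 0 < c -> compact K -> K !=set0 ->
  support_fun [set c *: x | x in K] u = c * support_fun K u.
Proof.
move=> c0 cK K0; have [x Kx [<- hx]] := support_fun_attained u cK K0.
have cK0 : [set c *: x | x in K] !=set0 by exists (c *: x); exists x.
have [_ [y Ky <-] [<- hy]] := support_fun_attained u (@compact_scale K c cK) cK0.
apply/eqP; rewrite eq_le; apply/andP; split.
  by rewrite edotZl ler_pM2l// hx.
by rewrite -edotZl hy//; exists x.
Qed.

(** [t] minimizes the quadratic [enorm (w - t *: v) ^+ 2], cut off at 1 so as to stay on a segment
    of a convex set. *)
Lemma enorm_decreasing_step (v w : 'rV[R]_n) : 0 < edot v w ->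
  exists2 t, 0 <= t <= 1 & enorm (w - t *: v) < enorm w.
Proof.
move=> vw; have v0 : 0 < edot v v.
  rewrite lt_neqAle edot_ge0 andbT eq_sym edot_eq0; apply/eqP => v0.
  by rewrite v0 edot0l ltxx in vw.
pose t := Num.min 1 (edot v w / edot v v).
have t0 : 0 < t by rewrite lt_min ltr01 divr_gt0.
have t1 : t <= 1 by rewrite ge_min lexx.
have tv : t * edot v v <= edot v w by rewrite -ler_pdivlMr// ge_min lexx orbT.
exists t; first by rewrite t1 ltW.
rewrite -(@ltr_pXn2r _ 2)// ?nnegrE ?enorm_ge0// !sqr_enorm.
rewrite !(edotDl, edotDr, edotNl, edotNr, edotZl, edotZr) (edotC w v).
have : t * (t * edot v v) <= t * edot v w by rewrite ler_pM2l.
have : 0 < t * edot v w by rewrite mulr_gt0.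
by lra.
Qed.

(** The normal points from the nearest point [y] of [K] to [x]. A point of [K] further in this
    direction would yield, on its segment to [y], a point nearer to [x]. *)
Lemma strict_separation K x : compact K -> segment_closed K -> K !=set0 -> ~ K x ->
  exists2 u, enorm u = 1 & support_fun K u < edot x u.
Proof.
move=> cK sK K0 nKx.
have fc : continuous (fun y => enorm (x - y)).
  move=> y; apply: (@continuous_comp _ _ _ (fun y => x - y) (@enorm R n)).
    have F := nbhs_filter y.
    exact: (@cvgB _ _ _ (nbhs y) F _ _ _ _ (@cvg_cst _ _ _ (nbhs y) F) (@cvg_id _ (nbhs y))).
  exact: enorm_continuous.
have [y + hy] := EVT_min_rV K0 cK (continuous_subspaceT fc).
move=> /set_mem Ky; pose w := x - y.
have w0 : w != 0 by apply/eqP => /subr0_eq xy; apply: nKx; rewrite xy.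
have nw : 0 < enorm w by rewrite lt_neqAle eq_sym enorm_eq0 w0 enorm_ge0.
have key z : K z -> edot z w <= edot y w.
  move=> Kz; rewrite -subr_le0 -edotNl -edotDl; set v := z - y.
  rewrite leNgt; apply/negP => /enorm_decreasing_step[t t01].
  rewrite ltNge => /negP; apply.
  have -> : w - t *: v = x - (t *: z + (1 - t) *: y).
    by apply/rowP => i; rewrite !mxE; ring.
  by apply/hy/mem_set/sK.
exists ((enorm w)^-1 *: w).
  by rewrite enormZ gtr0_norm ?invr_gt0// mulVf// gt_eqF.
have [z Kz [<- _]] := support_fun_attained ((enorm w)^-1 *: w) cK K0.
rewrite !edotZr ltr_pM2l ?invr_gt0//; apply: (le_lt_trans (key _ Kz)).
by rewrite -subr_gt0 -edotNl -edotDl -/w lt_neqAle eq_sym edot_eq0 w0 edot_ge0.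
Qed.

Lemma mem_support_fun K x : compact K -> segment_closed K -> K !=set0 ->
  (forall u, enorm u = 1 -> edot x u <= support_fun K u) -> K x.
Proof.
move=> cK sK K0 h; apply: contrapT => nKx.
have [u u1] := strict_separation cK sK K0 nKx.
by rewrite ltNge h.
Qed.

Lemma support_fun_inj K L : compact K -> compact L -> segment_closed K -> segment_closed L ->
  K !=set0 -> L !=set0 ->
  (forall u, enorm u = 1 -> support_fun K u = support_fun L u) -> K = L.
Proof.
move=> cK cL sK sL K0 L0 h; apply/seteqP; split => x.
  by move=> Kx; apply: mem_support_fun => // u u1; rewrite -h// support_fun_ge.
by move=> Lx; apply: mem_support_fun => // u u1; rewrite h// support_fun_ge.
Qed.

End support_functions.

Section Lp_combination.
Context (R : realType) (n : nat) (p alpha beta : R).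
Context (p1 : 1 < p) (alpha0 : 0 < alpha) (beta0 : 0 < beta).
Context (K L : set 'rV[R]_n) (cK : compact K) (cL : compact L) (K0 : K 0) (L0 : L 0).
Local Notation M := (Lp_comb p alpha beta K L).
Local Notation mean := (lp_mean p alpha beta).

Let hK u : 0 <= support_fun K u. Proof. exact: support_fun_ge0. Qed.
Let hL u : 0 <= support_fun L u. Proof. exact: support_fun_ge0. Qed.

Lemma Lp_comb_supporting s t : 0 <= s -> 0 <= t ->
  (forall x y, 0 <= x -> 0 <= y -> s * x + t * y <= mean x y) ->
  set_add [set s *: x | x in K] [set t *: y | y in L] `<=` M.
Proof.
move=> s0 t0 st _ [_ [x Kx <-] [_ [y Ly <-] <-]] u u1.
rewrite edotDl !edotZl (le_trans _ (st _ _ (hK u) (hL u)))//.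
by rewrite lerD// ler_wpM2l// support_fun_ge.
Qed.

Lemma Lp_comb_left : [set alpha `^ p^-1 *: x | x in K] `<=` M.
Proof.
move=> _ [x Kx <-]; apply: (@Lp_comb_supporting (alpha `^ p^-1) 0); rewrite ?powR_ge0//.
  by move=> y z y0 z0; rewrite mul0r addr0 lp_mean_left.
exists (alpha `^ p^-1 *: x); first by exists x.
by exists 0; [exists 0; rewrite ?scaler0 | rewrite addr0].
Qed.

Lemma Lp_comb0 : M 0.
Proof. by move=> u _; rewrite edot0l powR_ge0. Qed.

Lemma segment_closed_Lp_comb : segment_closed M.
Proof.
move=> y z t /andP[t0 t1] My Mz u u1; rewrite edotDl !edotZl.
set E := (X in _ <= X).
have -> : E = t * E + (1 - t) * E by ring.
by rewrite lerD// ler_wpM2l ?subr_ge0//; [exact: My | exact: Mz].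
Qed.

Lemma Lp_comb_compact : compact M.
Proof.
have [D D0 KD] := compact_bound cK; have [D' D'0 LD] := compact_bound cL.
have hD (A : set 'rV[R]_n) (r : R) u : compact A -> A 0 -> (forall x, A x -> `|x| <= r) -> enorm u = 1 ->
    support_fun A u <= n%:R * r.
  move=> cA A0 Ar u1.
  have [x Ax [<- _]] := support_fun_attained u cA (ex_intro _ _ A0).
  rewrite (le_trans (edot_le_enorm _ _))// u1 mulr1 (le_trans (enorm_le_norm _))//.
  by rewrite ler_wpM2l// Ar.
apply: bounded_closed_compact.
  exists (mean (n%:R * D) (n%:R * D')); split; first exact: num_real.
  move=> r hr x Mx /=; rewrite (le_trans _ (ltW hr))//.
  have [->|x0] := eqVneq x 0; first by rewrite normr0 powR_ge0.
  have nx : 0 < enorm x by rewrite lt_neqAle eq_sym enorm_eq0 x0 enorm_ge0.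
  have u1 : enorm ((enorm x)^-1 *: x) = 1.
    by rewrite enormZ gtr0_norm ?invr_gt0// mulVf// gt_eqF.
  rewrite (le_trans (norm_le_enorm _))//.
  have -> : enorm x = edot x ((enorm x)^-1 *: x).
    by rewrite edotZr -sqr_enorm expr2 mulKf// gt_eqF.
  apply: (le_trans (Mx _ u1)); apply: lp_mean_le => //.
    by rewrite hK/=; exact: hD.
  by rewrite hL/=; exact: hD.
rewrite closure_id; apply/seteqP; split; first exact: subset_closure.
move=> x clx u u1; apply/ler_addgt0Pr => e e0.
have e1 : 0 < e / (n%:R + 1) by rewrite divr_gt0// ltr_wpDl.
have [y [My]] := clx _ (nbhsx_ballx x _ e1); rewrite -ball_normE /= => xy.
rewrite -[x](subrK y) edotDl addrC lerD//; first exact: My.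
rewrite (le_trans (edot_le_enorm _ _))// u1 mulr1 (le_trans (enorm_le_norm _))//.
rewrite (@le_trans _ _ ((n%:R + 1) * `|x - y|))//; first by rewrite ler_wpM2r// lerDl.
by rewrite mulrC -ler_pdivlMr ?ltW// ltr_wpDl.
Qed.

(** For dilates the mean of the support functions is, by homogeneity, a multiple of that of [L],
    hence itself a support function, and so it determines [M]. *)
Lemma Lp_comb_dilates lambda : segment_closed L -> 0 < lambda ->
  K = [set lambda *: x | x in L] ->
  M = [set mean lambda 1 *: x | x in L].
Proof.
move=> sL l0 KE.
have c0 : 0 < mean lambda 1.
  by rewrite powR_gt0// addr_gt0// mulr_gt0// powR_gt0.
have Ln : L !=set0 by exists 0.
have scL : compact [set mean lambda 1 *: x | x in L] by exact: compact_scale.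
have ME u : mean (support_fun K u) (support_fun L u) =
    support_fun [set mean lambda 1 *: x | x in L] u.
  rewrite KE !support_fun_scale// -[support_fun L u in X in lp_mean _ _ _ _ X]mul1r.
  rewrite ![_ * support_fun L u]mulrC lp_meanZ//; exact: ltW.
apply/seteqP; split => x Mx.
  apply: mem_support_fun => //; first exact: segment_closed_scale.
    by exists 0; exists 0; rewrite ?scaler0.
  by move=> u u1; rewrite -ME; exact: Mx.
by move=> u u1; rewrite -/(mean _ _) ME support_fun_ge.
Qed.

End Lp_combination.

Section power_comparison.
Context (R : realType).

Lemma powR_inj (s x y : R) : s != 0 -> 0 <= x -> 0 <= y -> x `^ s = y `^ s -> x = y.
Proof.
move=> s0 x0 y0 /(congr1 (fun z => z `^ s^-1)).
by rewrite -!powRrM mulfV// !powRr1.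
Qed.

Lemma powR_decreasing (s x y : R) : s < 0 -> 0 < x -> x <= y -> y `^ s <= x `^ s.
Proof.
move=> s0 x0 xy; have y0 := lt_le_trans x0 xy.
rewrite -[s]opprK !(powRN _ (- s)) lef_pV2 ?posrE ?powR_gt0//.
by apply: ge0_ler_powR; rewrite ?nnegrE ?oppr_ge0 ?(ltW s0) ?(ltW x0) ?(ltW y0).
Qed.

(** At a vanishing coordinate the Hölder normal degenerates to a coordinate direction. Such points
    occur: a section may have measure 0, and a support function may vanish. *)
Lemma lp_mean_supporting_ge0 (p alpha beta a b : R) :
  1 < p -> 0 < alpha -> 0 < beta -> 0 <= a -> 0 <= b ->
  exists s t, [/\ 0 <= s, 0 <= t, s * a + t * b = lp_mean p alpha beta a b &
    forall x y, 0 <= x -> 0 <= y -> s * x + t * y <= lp_mean p alpha beta x y].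
Proof.
move=> p1 al0 be0; have p0 : p != 0 by rewrite gt_eqF// (lt_trans ltr01).
have root c z : 0 < c -> 0 <= z -> (c * z `^ p) `^ p^-1 = c `^ p^-1 * z.
  by move=> c0 z0; rewrite powRM ?powR_ge0 ?(ltW c0)// -powRrM mulfV// powRr1.
rewrite [0 <= a]le_eqVlt => /orP[/eqP <- b0|a0].
  exists 0, (beta `^ p^-1); split; rewrite ?powR_ge0//.
    by rewrite mulr0 add0r /lp_mean powR0// mulr0 add0r root.
  by move=> x y x0 y0; rewrite mul0r add0r lp_mean_right.
rewrite le_eqVlt => /orP[/eqP <-|b0].
  exists (alpha `^ p^-1), 0; split; rewrite ?powR_ge0//.
    by rewrite mulr0 addr0 /lp_mean powR0// mulr0 addr0 root// ltW.
  by move=> x y x0 y0; rewrite mul0r addr0 lp_mean_left.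
have [s [t [s0 t0 st h]]] := lp_mean_supporting p1 al0 be0 a0 b0.
exists s, t; split; rewrite ?(ltW s0) ?(ltW t0)// => x y x0 y0.
exact: (h x y x0 y0).1.
Qed.

(* F t is the integrand of Psi at a section of volume c t ^ m; as a function of
   t ^ p it is concave for q > 0 and convex for q < 0. *)
Lemma power_mean_comparison (m : nat) (p q alpha beta c a b : R) (F : R -> R) (k l v : R) :
  (0 < m)%N -> 0 < c -> F = (fun t => (c * t ^+ m) `^ q) ->
  q != 0 -> 1 < p -> m%:R * q < p -> 0 < alpha -> 0 < beta -> 0 < a -> 0 < b ->
  0 <= k -> 0 <= l -> (q < 0 -> 0 < k /\ 0 < l) ->
  lp_mean p alpha beta k l <= v ->
  let d := lp_mean p alpha beta a b in
  let theta := alpha * a `^ p / d `^ p in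
  let G := F d * (theta * (F k / F a) + (1 - theta) * (F l / F b)) in
  [/\ 0 < q -> G <= F v, q < 0 -> F v <= G &
    G = F v -> k / a = l / b /\ v / d = k / a].
Proof.
move=> m0 c0 FE q0 p1 mqp al0 be0 a0 b0 k0 l0 kl0 klv d theta G.
have thE : theta = alpha * a `^ p / d `^ p by [].
rewrite {}/G; have dE : d = lp_mean p alpha beta a b by [].
clearbody theta d.
have p0 : 0 < p by exact: lt_trans ltr01 p1.
have d0 : 0 < d by rewrite dE powR_gt0// addr_gt0// mulr_gt0// powR_gt0.
have v0 : 0 <= v by exact: le_trans (lp_mean_ge0 _ _ _ _ _) klv.
have dp : d `^ p = alpha * a `^ p + beta * b `^ p by rewrite dE lp_mean_pow.
have kvp : alpha * k `^ p + beta * l `^ p <= v `^ p.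
  rewrite -(lp_mean_pow p1 al0 be0).
  by apply: ge0_ler_powR => //; rewrite ?nnegrE ?(ltW p0)// lp_mean_ge0.
move=> {klv dE}.
have m0' : 0 < m%:R :> R by rewrite ltr0n.
have dp0 : 0 < d `^ p by rewrite powR_gt0.
have th'E : 1 - theta = beta * b `^ p / d `^ p.
  by rewrite thE -[X in X - _](mulfV (negbT (gt_eqF dp0))) -mulrBl {1}dp addrAC subrr add0r.
have th01 : 0 < theta < 1.
  rewrite -(subr_gt0 theta 1) th'E thE.
  by rewrite !divr_gt0// mulr_gt0// powR_gt0.
(* [s] is the exponent of [F] in the variable [powR t p]. Its sign is that of [q], and it is below 1
   as [m * q < p]. *)
have [s [s0 sE s1 Fs]] : exists s, [/\ s != 0, (0 < s) = (0 < q), s < 1 &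
    forall t, 0 <= t -> F t = c `^ q * (t `^ p) `^ s].
  exists (m%:R * q / p); split.
  - by rewrite !mulf_neq0// ?invr_neq0// gt_eqF.
  - by rewrite pmulr_lgt0 ?invr_gt0// pmulr_rgt0.
  - by rewrite ltr_pdivrMr// mul1r.
  move=> t t0; have -> : F t = (c * t ^+ m) `^ q by rewrite FE.
  rewrite powRM; [|exact: ltW|exact: exprn_ge0].
  rewrite -(powR_mulrn m t0) -!powRrM [p * _]mulrC divfK; first by [].
  by rewrite gt_eqF.
have F0 t : 0 < t -> 0 < F t by move=> t0; rewrite FE powR_gt0// mulr_gt0// exprn_gt0.
have ratio t z : 0 <= t -> 0 < z -> F t / F z = ((t / z) `^ p) `^ s.
  move=> t0 z0; have zs : 0 < (z `^ p) `^ s by rewrite !powR_gt0.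
  rewrite (Fs t t0) (Fs z (ltW z0)) -mulf_div mulfV ?gt_eqF ?powR_gt0// mul1r.
  apply: (canLR (mulfK _)); first by rewrite gt_eqF.
  have -> : t `^ p = (t / z) `^ p * z `^ p.
    rewrite -[t in LHS](divfK (negbT (gt_eqF z0))).
    by rewrite powRM; [|exact: divr_ge0 t0 (ltW z0)|exact: ltW].
  by rewrite powRM; [|exact: powR_ge0|exact: powR_ge0].
pose x := (k / a) `^ p; pose y := (l / b) `^ p; pose w := (v / d) `^ p.
have GE : F d * (theta * (F k / F a) + (1 - theta) * (F l / F b)) =
  F d * (theta * x `^ s + (1 - theta) * y `^ s) by rewrite !ratio.
have FvE : F v = F d * w `^ s by rewrite -ratio// mulrC divfK// gt_eqF// F0.
have x0 : 0 <= x by exact: powR_ge0.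
have y0 : 0 <= y by exact: powR_ge0.
have w0 : 0 <= w by exact: powR_ge0.
pose Z := theta * x + (1 - theta) * y.
have /andP[th0 th1] := th01; have th'0 : 0 < 1 - theta by rewrite subr_gt0.
have Z0 : 0 <= Z by rewrite addr_ge0// mulr_ge0// ltW.
(* The weight [theta] is chosen so that the assumed bound on [v] turns into this comparison of a
   weighted mean of [x] and [y] with [w]. *)
have Zw : Z <= w.
  move: kvp; rewrite -(ler_pM2r (etrans (invr_gt0 _) dp0)).
  suff [-> ->] : Z = (alpha * k `^ p + beta * l `^ p) / d `^ p /\ w = v `^ p / d `^ p by [].
  have div t z : 0 <= t -> 0 < z -> (t / z) `^ p = t `^ p / z `^ p.
    move=> t0 z0; apply: (canRL (mulfK _)); first by rewrite gt_eqF// powR_gt0.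
    by rewrite -powRM ?divr_ge0 ?(ltW z0)// divfK// gt_eqF.
  split; last exact: div.
  rewrite /Z th'E thE /x /y !div//; field.
  by rewrite !gt_eqF// powR_gt0.
have final : x = y -> Z = w -> k / a = l / b /\ v / d = k / a.
  move=> xy Zw'; split.
    apply: (powR_inj (negbT (gt_eqF p0)) _ _ xy); first exact: divr_ge0 k0 (ltW a0).
    exact: divr_ge0 l0 (ltW b0).
  apply: (powR_inj (negbT (gt_eqF p0))); first exact: divr_ge0 v0 (ltW d0).
    exact: divr_ge0 k0 (ltW a0).
  by rewrite -/x -/w -Zw' /Z -xy -mulrDl addrC subrK mul1r.
have [qpos|qneg|q00] := ltgtP 0 q; last by rewrite q00 eqxx in q0.
  have spos : 0 < s by rewrite sE.
  have s01 : 0 < s < 1 by rewrite spos.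
  have [le eqc] := powR_concave2 s01 th01 x0 y0.
  have le2 : Z `^ s <= w `^ s by apply: ge0_ler_powR; rewrite ?nnegrE ?(ltW spos).
  split => // [_|].
    by rewrite GE FvE ler_pM2l ?F0// (le_trans le le2).
  rewrite GE FvE => /(mulfI (negbT (gt_eqF (F0 _ d0)))) eqG.
  have eqZ : theta * x `^ s + (1 - theta) * y `^ s = Z `^ s.
    by apply/eqP; rewrite eq_le le/= eqG.
  by apply: final; [exact: eqc | apply: (powR_inj s0) => //; rewrite -eqZ].
have sneg : s < 0 by rewrite lt_neqAle s0 leNgt sE -leNgt ltW.
have [kp lp] := kl0 qneg.
have xp : 0 < x by rewrite powR_gt0// divr_gt0.
have yp : 0 < y by rewrite powR_gt0// divr_gt0.
have Zp : 0 < Z by rewrite addr_gt0// mulr_gt0.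
have [le eqc] := powR_convex2_neg sneg th01 xp yp.
have le2 : w `^ s <= Z `^ s by exact: powR_decreasing.
split => // [_|].
  by rewrite GE FvE ler_pM2l ?F0// (le_trans le2 le).
rewrite GE FvE => /(mulfI (negbT (gt_eqF (F0 _ d0)))) eqG.
have eqZ : theta * x `^ s + (1 - theta) * y `^ s = Z `^ s.
  by apply/eqP; rewrite eq_le le andbT eqG.
by apply: final; [exact: eqc | apply: (powR_inj s0) => //; rewrite -eqZ].
Qed.

End power_comparison.

(** * Sections of bodies and of their L_p combinations *)

Section section_geometry.
Context (R : realType) (m n : nat) (m_gt0 : (0 < m)%N).
Context (U : {vspace 'rV[R]_n}) (dU : \dim U = m).
Local Notation Hm := (@hausdorff_measure R n m).
Local Notation c0 := (cube_const R m).
Implicit Types (K L M : set 'rV[R]_n).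

(** Edge length of the [m]-dimensional cube with the measure of the section. *)
Definition section_root K : R := (fine (Hm ([set` U] `&` K)) / c0) `^ m%:R^-1.

Let c0_gt0 : 0 < c0. Proof. exact: cube_const_gt0. Qed.

Lemma section_root_ge0 K : 0 <= section_root K.
Proof. exact: powR_ge0. Qed.

Lemma section_measure_fin K : compact K -> Hm ([set` U] `&` K) \is a fin_num.
Proof.
move=> /compact_bound[D _ KD]; have [C hC] := section_measure_bounded m KD.
by rewrite ge0_fin_numE ?hausdorff_measure_ge0// (le_lt_trans (hC U dU))// ltry.
Qed.

Lemma section_rootE K : compact K ->
  Hm ([set` U] `&` K) = (c0 * section_root K ^+ m)%:E.
Proof.
move=> cK; rewrite -(fineK (section_measure_fin cK)); congr _%:E.
have V0 : 0 <= fine (Hm ([set` U] `&` K)) / c0.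
  by rewrite divr_ge0 ?(ltW c0_gt0)// fine_ge0// hausdorff_measure_ge0.
rewrite /section_root -powR_mulrn ?powR_ge0// -powRrM mulVf ?pnatr_eq0 -?lt0n//.
by rewrite powRr1// mulrC divfK// gt_eqF.
Qed.

Lemma vspace_closed : closed [set` U].
Proof.
have [Q QQ UQ] := orthonormal_frame dU.
have -> : [set` U] = (fun x => x *m (1%:M - Q^T *m Q)) @^-1` [set 0].
  apply/seteqP; split => x /=; rewrite UQ mulmxBr mulmx1.
    by move=> /mem_row_space[y ->]; rewrite mulmxA -(mulmxA y) QQ mulmx1 subrr.
  by move=> /subr0_eq xE; apply/mem_row_space; exists (x *m Q^T); rewrite -mulmxA.
have /continuous_closedP : continuous (fun x : 'rV[R]_n => x *m (1%:M - Q^T *m Q)).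
  exact: mulmxr_continuous.
by apply; exact: accessible_closed_set1 (hausdorff_accessible (@norm_hausdorff _ _)) _.
Qed.

Lemma compact_section K : compact K -> compact ([set` U] `&` K).
Proof. by move=> cK; rewrite setIC; apply: compact_closedI => //; exact: vspace_closed. Qed.

Lemma segment_closed_section K : segment_closed K -> segment_closed ([set` U] `&` K).
Proof.
move=> sK y z t t01 [Uy Ky] [Uz Kz]; split; last exact: sK.
by rewrite /= memvD// memvZ.
Qed.

Lemma section_add K L M s t : set_add [set s *: x | x in K] [set t *: y | y in L] `<=` M ->
  set_add [set s *: x | x in [set` U] `&` K] [set t *: y | y in [set` U] `&` L]
    `<=` [set` U] `&` M.
Proof.
move=> KLM _ [_ [x [Ux Kx] <-] [_ [y [Uy Ly] <-] <-]]; split.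
  by rewrite /= memvD// memvZ.
apply: KLM; exists (s *: x); first by exists x.
by exists (t *: y) => //; exists y.
Qed.

Let scale_bound K s : compact K -> 0 <= s ->
  ((c0 * (s * section_root K) ^+ m)%:E <= Hm [set s *: x | x in [set` U] `&` K])%E.
Proof.
move=> cK; rewrite le_eqVlt => /orP[/eqP <-|s0].
  by rewrite mul0r expr0n gtn_eqF// mulr0 hausdorff_measure_ge0.
rewrite hausdorff_measure_scale// section_rootE// -EFinM lee_fin exprMn.
by rewrite mulrCA.
Qed.

Lemma section_add_bound K L s t : compact K -> compact L -> K 0 -> L 0 -> 0 <= s -> 0 <= t ->
  ((c0 * (s * section_root K + t * section_root L) ^+ m)%:E <=
   Hm (set_add [set s *: x | x in [set` U] `&` K] [set t *: y | y in [set` U] `&` L]))%E.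
Proof.
move=> cK cL K0 L0 s0 t0.
have sub A r : [set r *: x | x in [set` U] `&` A] `<=` [set` U].
  by move=> _ [x [Ux _] <-]; exact: memvZ.
apply: (section_brunn_minkowski m_gt0 dU (@sub K s) (@sub L t));
  rewrite ?mulr_ge0 ?section_root_ge0//.
- by apply: compact_scale; exact: compact_section.
- by apply: compact_scale; exact: compact_section.
- by exists (s *: 0); exists 0 => //; split => //; exact: mem0v.
- by exists (t *: 0); exists 0 => //; split => //; exact: mem0v.
- exact: scale_bound.
- exact: scale_bound.
Qed.

Lemma section_root_add K L M s t : compact K -> compact L -> compact M -> K 0 -> L 0 ->
  0 <= s -> 0 <= t -> set_add [set s *: x | x in K] [set t *: y | y in L] `<=` M ->
  s * section_root K + t * section_root L <= section_root M.
Proof.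
move=> cK cL cM K0 L0 s0 t0 KLM.
have := le_trans (section_add_bound cK cL K0 L0 s0 t0) (hausdorff_measureS m (section_add KLM)).
rewrite section_rootE// lee_fin ler_pM2l// ler_pXn2r// nnegrE ?section_root_ge0//.
by rewrite addr_ge0// mulr_ge0// section_root_ge0.
Qed.

Lemma section_root_scale K c : compact K -> 0 < c ->
  section_root [set c *: x | x in K] = c * section_root K.
Proof.
move=> cK c1; have ccK := @compact_scale _ _ K c cK.
have : ((c0 * section_root [set c *: x | x in K] ^+ m)%:E = (c0 * (c * section_root K) ^+ m)%:E)%E.
  rewrite -section_rootE// exprMn mulrCA EFinM -section_rootE// -hausdorff_measure_scale//.
  congr (Hm _); apply/seteqP; split => [y [Uy [x Kx xE]]|_ [x [Ux Kx] <-]].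
    exists x => //; split => //.
    by rewrite /= -[x](scalerK (negbT (gt_eqF c1))) xE; exact: memvZ.
  by split; [exact: memvZ | exists x].
case=> /(mulfI (negbT (gt_eqF c0_gt0))) /eqP.
by rewrite eqrXn2 ?mulr_ge0 ?section_root_ge0 ?(ltW c1)// => /eqP.
Qed.

End section_geometry.

Section Lp_section.
Context (R : realType) (m n : nat) (m_gt0 : (0 < m)%N).
Context (U : {vspace 'rV[R]_n}) (dU : \dim U = m).
Context (p alpha beta : R) (p1 : 1 < p) (alpha0 : 0 < alpha) (beta0 : 0 < beta).
Context (K L : set 'rV[R]_n) (cK : compact K) (cL : compact L) (K0 : K 0) (L0 : L 0).
Local Notation Hm := (@hausdorff_measure R n m).
Local Notation c0 := (cube_const R m).
Local Notation M := (Lp_comb p alpha beta K L).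
Local Notation mean := (lp_mean p alpha beta).
Local Notation root := (@section_root R m n U).

Lemma section_root_Lp_comb : mean (root K) (root L) <= root M.
Proof.
have [s [t [s0 t0 <- h]]] := lp_mean_supporting_ge0 p1 alpha0 beta0
  (section_root_ge0 m U K) (section_root_ge0 m U L).
apply: section_root_add => //; first exact: Lp_comb_compact.
exact: Lp_comb_supporting.
Qed.

Context (sK : segment_closed K) (sL : segment_closed L).

(** A ball in one of the two bodies is enough: the other contains the origin, so the sum [C] of the
    scaled sections contains a ball of the plane, as [section_measure_strict] requires. *)
Lemma section_Lp_equality (a b : R) (x0 : 'rV[R]_n) (r : R) : 0 < a -> 0 < b ->
  root K / a = root L / b -> root M / mean a b = root K / a ->
  x0 \in U -> 0 < r ->
  (forall y, `|y - x0| <= r -> K y) \/ (forall y, `|y - x0| <= r -> L y) ->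
  forall x, x \in U -> K x <-> [set (a / b) *: z | z in L] x.
Proof.
move=> a0 b0 kl vd x0U r0 ball.
have d0 : 0 < mean a b by rewrite powR_gt0// addr_gt0// mulr_gt0// powR_gt0.
have [s [t [s0 t0 st h]]] := lp_mean_supporting p1 alpha0 beta0 a0 b0.
pose K' := [set` U] `&` K; pose L' := [set` U] `&` L; pose M' := [set` U] `&` M.
have cM := Lp_comb_compact p1 alpha0 beta0 cK cL K0 L0.
have cK' : compact K' by exact: compact_section.
have cL' : compact L' by exact: compact_section.
have K'0 : K' 0 by split => //; exact: mem0v.
have L'0 : L' 0 by split => //; exact: mem0v.
pose C := set_add [set s *: x | x in K'] [set t *: y | y in L'].
have CM : C `<=` M'.
  apply: section_add; apply: (Lp_comb_supporting cK cL K0 L0 (ltW s0) (ltW t0)).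
  by move=> x y x0' y0'; exact: (h x y x0' y0').1.
have cC : compact C by apply: compact_set_add; exact: compact_scale.
(* By the two ratio hypotheses, the Brunn-Minkowski lower bound for [C] is exactly the measure of
   [M']. *)
have HM : (Hm M' <= Hm C)%E.
  have := section_add_bound m_gt0 dU cK cL K0 L0 (ltW s0) (ltW t0); rewrite -/C.
  suff -> : s * root K + t * root L = root M by rewrite -section_rootE.
  have lE : root L = root K / a * b by rewrite kl divfK// gt_eqF.
  have -> : root M = root K / a * mean a b by rewrite -vd divfK// gt_eqF.
  by rewrite lE -st; field; rewrite gt_eqF.
have MC : M' `<=` C.
  move=> x M'x; apply: contrapT => nCx.
  have [y0 [e [y0U e0 eC]]] : exists y0 e, [/\ y0 \in U, 0 < e &
      forall y, y \in U -> `|y - y0| <= e -> C y].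
    have scal (c : R) (y : 'rV[R]_n) : 0 < c -> `|y - c *: x0| <= c * r ->
        `|c^-1 *: y - x0| <= r.
      move=> c1 yr; have -> : c^-1 *: y - x0 = c^-1 *: (y - c *: x0).
        by rewrite scalerBr scalerA mulVf ?gt_eqF// scale1r.
      by rewrite normrZ gtr0_norm ?invr_gt0// ler_pdivrMl.
    case: ball => ball.
      exists (s *: x0), (s * r); split; rewrite ?mulr_gt0 ?memvZ// => y yU yr.
      exists y; last by exists 0; [exists 0; rewrite ?scaler0 | rewrite addr0].
      exists (s^-1 *: y); last by rewrite scalerA mulfV ?gt_eqF// scale1r.
      by split; [exact: memvZ | apply: ball; exact: scal].
    exists (t *: x0), (t * r); split; rewrite ?mulr_gt0 ?memvZ// => y yU yr.
    exists 0; first by exists 0; rewrite ?scaler0.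
    exists y; last by rewrite add0r.
    exists (t^-1 *: y); last by rewrite scalerA mulfV ?gt_eqF// scale1r.
    by split; [exact: memvZ | apply: ball; exact: scal].
  have Cfin : (Hm C < +oo)%E.
    rewrite (le_lt_trans (hausdorff_measureS m CM))//.
    by rewrite -ge0_fin_numE ?hausdorff_measure_ge0// section_measure_fin.
  have := section_measure_strict m_gt0 dU cC CM Cfin
    (segment_closed_section (segment_closed_Lp_comb (K := K) (L := L))) M'x.1 M'x nCx y0U e0
    (fun y yU ye => CM y (eC y yU ye)).
  by rewrite ltNge HM.
have hKL u : support_fun K' u * b = support_fun L' u * a.
  have [x1 K'x1 [x1E x1h]] := support_fun_attained u cK' (ex_intro _ _ K'0).
  have [y1 L'y1 [y1E y1h]] := support_fun_attained u cL' (ex_intro _ _ L'0).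
  have X0 : 0 <= support_fun K' u by exact: support_fun_ge0.
  have Y0 : 0 <= support_fun L' u by exact: support_fun_ge0.
  (* The normal at the two support values gives a point of [M'] whose product with [u] is their
     mean. As this point lies in [C], the mean is at most its linear minorant with coefficients [s]
     and [t]: the equality case of Hölder's inequality. *)
  have [s' [t' [s'0 t'0 st' h']]] := lp_mean_supporting_ge0 p1 alpha0 beta0 X0 Y0.
  have [le eqc] := h _ _ X0 Y0; apply: eqc; apply/eqP; rewrite eq_le le/= -st'.
  have : C (s' *: x1 + t' *: y1).
    apply: MC; apply: (section_add (Lp_comb_supporting cK cL K0 L0 s'0 t'0 h')).
    by exists (s' *: x1); [exists x1 | exists (t' *: y1) => //; exists y1].
  case=> _ [x2 K'x2 <-] [_ [y2 L'y2 <-]] /(congr1 (fun z => edot z u)).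
  rewrite !edotDl !edotZl x1E y1E => <-.
  by rewrite lerD// ler_pM2l// -?x1E -?y1E; [exact: x1h | exact: y1h].
have E : K' = [set (a / b) *: z | z in L'].
  have ab : 0 < a / b by rewrite divr_gt0.
  apply: support_fun_inj => //.
  - exact: compact_scale.
  - exact: segment_closed_section.
  - by apply: segment_closed_scale; exact: segment_closed_section.
  - by exists 0.
  - by exists ((a / b) *: 0); exists 0.
  move=> u _; rewrite support_fun_scale//; last by exists 0.
  by rewrite mulrAC [a * _]mulrC -hKL mulfK// gt_eqF.
move=> x xU; have ab : a / b != 0 by rewrite gt_eqF// divr_gt0.
split => [Kx|[z Lz zx]].
  have : K' x by split.
  by rewrite E => -[z [_ Lz] <-]; exists z.
suff : K' x by case.
rewrite E; exists z => //; split => //.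
by rewrite -[z](scalerK ab) zx; exact: memvZ.
Qed.

End Lp_section.

(** * The dual quermassintegrals *)

Section integral_equality.
Context d (T : measurableType d) (R : realType) (mu : {measure set T -> \bar R}).
Local Open Scope ereal_scope.

Lemma integral_eq0_negligible (f : T -> R) : measurable_fun [set: T] f ->
  (forall x, (0 <= f x)%R) -> \int[mu]_x (f x)%:E = 0 -> mu.-negligible [set x | f x != 0%R].
Proof.
move=> mf f0 intf.
have mEf : measurable_fun [set: T] (EFin \o f) by exact/measurable_EFinP.
have [+ _] := ae_eq_integral_abs mu measurableT mEf.
rewrite (eq_integral (fun x => (f x)%:E)) => [|x _]; last by rewrite /= ger0_norm.
move=> /(_ intf); apply: negligibleS => x /= fx; apply: contra_not (elimN eqP fx).
by move=> /(_ I) [].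
Qed.

Lemma integral_le_eq_negligible (f g : T -> R) :
  measurable_fun [set: T] f -> measurable_fun [set: T] g ->
  (forall x, (0 <= f x <= g x)%R) -> \int[mu]_x (g x)%:E < +oo ->
  \int[mu]_x (f x)%:E = \int[mu]_x (g x)%:E -> mu.-negligible [set x | f x != g x].
Proof.
move=> mf mg fg goo fgE.
have f0 x : (0 <= f x)%R by have /andP[] := fg x.
have h0 x : (0 <= g x - f x)%R by rewrite subr_ge0; have /andP[] := fg x.
have mh : measurable_fun [set: T] (g \- f)%R by exact: measurable_funB.
have int0 : 0 <= \int[mu]_x (f x)%:E by apply: integral_ge0 => x _; rewrite lee_fin.
have : mu.-negligible [set x | (g \- f)%R x != 0%R].
  apply: integral_eq0_negligible => //.
  have : \int[mu]_x (g x)%:E = \int[mu]_x (f x)%:E + \int[mu]_x ((g \- f)%R x)%:E.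
    rewrite -ge0_integralD//.
    - by apply: eq_integral => x _; rewrite -EFinD addrC subrK.
    - by move=> x _; rewrite lee_fin.
    - exact/measurable_EFinP.
    - by move=> x _; rewrite lee_fin h0.
    - exact: (measurable_EFinP _ _).2 mh.
  have fin : \int[mu]_x (f x)%:E \is a fin_num by rewrite ge0_fin_numE// fgE.
  rewrite -fgE => /(congr1 (fun z => z - \int[mu]_x (f x)%:E)).
  by rewrite subee// addeAC subee// add0e.
by apply: negligibleS => x /=; rewrite eq_sym -subr_eq0.
Qed.

Lemma integral_gt0 (f : T -> R) (A : set T) : measurable_fun [set: T] f ->
  (forall x, (0 <= f x)%R) -> measurable A -> 0 < mu A -> (forall x, A x -> (0 < f x)%R) ->
  0 < \int[mu]_x (f x)%:E.
Proof.
move=> mf f0 mA muA fA.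
have int0 : 0 <= \int[mu]_x (f x)%:E by apply: integral_ge0 => x _; rewrite lee_fin.
rewrite lt_neqAle int0 andbT eq_sym; apply/eqP => /(integral_eq0_negligible mf f0).
move=> neg; have : mu A = 0.
  by apply/(negligibleP mu mA); apply: negligibleS neg => x /fA; rewrite /= => /gt_eqF ->.
by move=> A0; rewrite A0 ltxx in muA.
Qed.

Lemma integral_combination (f g : T -> R) (a b : R) :
  measurable_fun [set: T] f -> measurable_fun [set: T] g ->
  (forall x, (0 <= f x)%R) -> (forall x, (0 <= g x)%R) -> (0 <= a)%R -> (0 <= b)%R ->
  \int[mu]_x (a * f x + b * g x)%:E = a%:E * \int[mu]_x (f x)%:E + b%:E * \int[mu]_x (g x)%:E.
Proof.
move=> mf mg f0 g0 a0 b0.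
rewrite -!ge0_integralZl//; try (exact/measurable_EFinP); try by move=> x _; rewrite lee_fin.
rewrite -ge0_integralD//.
- by move=> x _; rewrite lee_fin mulr_ge0.
- by apply/measurable_EFinP; apply: measurable_funM.
- by move=> x _; rewrite lee_fin mulr_ge0.
- by apply/measurable_EFinP; apply: measurable_funM.
Qed.

(** Integrates the pointwise bound for the integrand of the L_p combination; the two directions
    serve [q > 0] and [q < 0]. *)
Lemma integral_combination_comparison (f g u : T -> R) (a b x y w : R) :
  measurable_fun [set: T] f -> measurable_fun [set: T] g -> measurable_fun [set: T] u ->
  (forall z, (0 <= f z)%R) -> (forall z, (0 <= g z)%R) -> (forall z, (0 <= u z)%R) ->
  (0 <= a)%R -> (0 <= b)%R -> \int[mu]_z (f z)%:E = x%:E -> \int[mu]_z (g z)%:E = y%:E ->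
  \int[mu]_z (u z)%:E = w%:E ->
  let G z := (a * f z + b * g z)%R in
  [/\ (forall z, (G z <= u z)%R) -> (a * x + b * y <= w)%R,
      (forall z, (u z <= G z)%R) -> (w <= a * x + b * y)%R &
      (forall z, (G z <= u z)%R) \/ (forall z, (u z <= G z)%R) -> w = (a * x + b * y)%R ->
        mu.-negligible [set z | G z != u z]].
Proof.
move=> mf mg mu' f0 g0 u0 a0 b0 fE gE uE G.
have mG : measurable_fun [set: T] G by apply: measurable_funD; exact: measurable_funM.
have G0 z : (0 <= G z)%R by rewrite addr_ge0// mulr_ge0.
have GE : \int[mu]_z (G z)%:E = (a * x + b * y)%:E.
  by rewrite integral_combination// fE gE.
split.
- move=> Gu; rewrite -lee_fin -GE -uE; apply: ge0_le_integral => //.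
  + by move=> z _; rewrite lee_fin.
  + exact/measurable_EFinP.
  + exact/measurable_EFinP.
  + by move=> z _; rewrite lee_fin.
- move=> uG; rewrite -lee_fin -GE -uE; apply: ge0_le_integral => //.
  + by move=> z _; rewrite lee_fin.
  + exact/measurable_EFinP.
  + exact/measurable_EFinP.
  + by move=> z _; rewrite lee_fin.
case=> cmp wE.
  apply: integral_le_eq_negligible => //.
  - by move=> z; rewrite G0/=.
  - by rewrite uE ltry.
  - by rewrite GE uE wE.
have -> : [set z | G z != u z] = [set z | u z != G z].
  by apply/seteqP; split => z /=; rewrite eq_sym.
apply: integral_le_eq_negligible => //.
- by move=> z; rewrite u0/=.
- by rewrite GE ltry.
- by rewrite GE uE wE.
Qed.

End integral_equality.

Section admissible_bodies.
Context (R : realType) (n : nat).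
Implicit Types K L : set 'rV[R]_n.

(* Covers both parts of the theorem: o is an interior point when q < 0, and just
   a point when q > 0. *)
Definition admissible_body (q : R) K : Prop := [/\ compact K, segment_closed K, K 0 &
  exists x0 r, [/\ 0 < r, forall y, `|y - x0| <= r -> K y & q < 0 -> x0 = 0]].

Lemma interior_ball K x : interior K x -> exists2 r : R, 0 < r & forall y, `|y - x| <= r -> K y.
Proof.
move=> /nbhs_ballP[e /= e0 eK]; exists (e / 2); first by rewrite divr_gt0.
move=> y yx; apply: eK; rewrite -ball_normE /= distrC (le_lt_trans yx)//.
by rewrite ltr_pdivrMr// ltr_pMr// ltr1n.
Qed.

Lemma convex_body_admissible q K : convex_body K -> K 0 -> (q < 0 -> interior K 0) ->
  admissible_body q K.
Proof.
move=> [cK sK [x xK]] K0 q0; split => //; first exact: convex_set_segment_closed.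
have [/q0/interior_ball[r r0 rK]|qpos] := boolP (q < 0).
  by exists 0, r; split.
have [r r0 rK] := interior_ball xK.
by exists x, r; split => // q0'; rewrite q0' in qpos.
Qed.

Lemma admissible_Lp_comb q p alpha beta K L : 1 < p -> 0 < alpha -> 0 < beta ->
  admissible_body q K -> admissible_body q L -> admissible_body q (Lp_comb p alpha beta K L).
Proof.
move=> p1 al0 be0 [cK sK K0 [x0 [r [r0 rK q0]]]] [cL sL L0 _]; split.
- exact: Lp_comb_compact.
- exact: segment_closed_Lp_comb.
- exact: Lp_comb0.
pose c := alpha `^ p^-1; have c0 : 0 < c by rewrite powR_gt0.
exists (c *: x0), (c * r); split; first by rewrite mulr_gt0.
  move=> y yr; apply: (Lp_comb_left p1 al0 be0 cK cL K0 L0).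
  exists (c^-1 *: y); last by rewrite scalerA mulfV ?gt_eqF// scale1r.
  apply: rK; have -> : c^-1 *: y - x0 = c^-1 *: (y - c *: x0).
    by rewrite scalerBr scalerA mulVf ?gt_eqF// scale1r.
  by rewrite normrZ gtr0_norm ?invr_gt0// ler_pdivrMl.
by move=> /q0 ->; rewrite scaler0.
Qed.

(* x is a limit of interior points of K, on the segment towards x0. *)
Lemma interior_ball_outside K C x : segment_closed K -> closed C ->
  (exists x0 r, 0 < r /\ forall y, `|y - x0| <= r -> K y) -> K x -> ~ C x ->
  exists x1 e, 0 < e /\ forall y, `|y - x1| <= e -> K y /\ ~ C y.
Proof.
move=> sK cC [x0 [r [r0 rK]]] Kx nCx.
have [e e0 eC] : exists2 e, 0 < e & forall y, C y -> e <= `|x - y|.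
  apply: contrapT => h; apply: nCx; apply: closed_mem_limit => // e e0.
  apply: contrapT => h'; apply: h; exists e => // y Cy.
  by rewrite leNgt; apply/negP => h; apply: h'; exists y => //; exact: ltW.
pose L := `|x0 - x| + r; have L0 : 0 < L by rewrite ltr_wpDl.
pose t := Num.min 1 (e / 2 / L).
have t0 : 0 < t by rewrite lt_min ltr01/= !divr_gt0.
have t1 : t <= 1 by rewrite ge_min lexx.
have tL : t * L <= e / 2 by rewrite -ler_pdivlMr// ge_min lexx orbT.
clearbody t; pose xt := t *: x0 + (1 - t) *: x.
exists xt, (t * r); split; first by rewrite mulr_gt0.
move=> y yr; split.
  have -> : y = t *: (x0 + t^-1 *: (y - xt)) + (1 - t) *: x.
    rewrite scalerDr scalerA mulfV ?gt_eqF// scale1r addrAC -/xt.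
    by rewrite addrC subrK.
  apply: sK => //; first by rewrite t1 ltW.
  apply: rK; rewrite addrC addKr normrZ gtr0_norm ?invr_gt0//.
  by rewrite ler_pdivrMl.
move=> /eC; rewrite leNgt => /negP; apply.
have := ler_distD xt x y; rewrite (distrC xt y) (distrC x xt).
have -> : xt - x = t *: (x0 - x).
  by rewrite /xt; apply/rowP => i; rewrite !mxE; ring.
rewrite normrZ gtr0_norm//; move: tL yr; rewrite /L mulrDr.
by move: (t * `|_|) (t * r) => u v; lra.
Qed.

End admissible_bodies.

(** * Finiteness, positivity and homogeneity of the integrals *)

Section Psi_integrals.
Context (R : realType) (n m : nat) (m_gt0 : (0 < m)%N) (h : (m <= n)%N).
Context (nu : probability (borel_grassmannian R h) R) (hnu : haar_probability nu).
Context (q : R).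
Local Notation BG := (borel_grassmannian R h).
Local Notation c0 := (cube_const R m).
Implicit Types K L : set 'rV[R]_n.

Definition Psi_integrand K (xi : BG) : R := fine (section_measure K xi) `^ q.

Lemma Psi_integrand_ge0 K xi : 0 <= Psi_integrand K xi.
Proof. exact: powR_ge0. Qed.

Lemma measurable_Psi_integrand K : compact K -> measurable_fun [set: BG] (Psi_integrand K).
Proof.
move=> cK; apply: (measurableT_comp (measurable_powR q)).
apply: measurableT_comp; first exact: fine_measurable.
exact: measurable_section_measure.
Qed.

Lemma PsiE K : compact K -> Psi nu q K = (\int[nu]_xi (Psi_integrand K xi)%:E)%E.
Proof.
move=> cK; apply: eq_integral => xi _; rewrite -poweR_EFin; congr (_ `^ _)%E.
by rewrite fineK// section_measure_fin// dim_grassmannian.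
Qed.

Lemma Psi_integrandE K xi : compact K ->
  Psi_integrand K xi = (c0 * section_root m (val (xi : grassmannian R h)) K ^+ m) `^ q.
Proof.
by move=> cK; rewrite /Psi_integrand /section_measure section_rootE// dim_grassmannian.
Qed.

(** For [q < 0] the power decreases, and the ball about the origin bounds section volumes away from
    0; otherwise boundedness of [K] is used. *)
Lemma Psi_integrand_bounded K : admissible_body q K ->
  exists C, forall xi, Psi_integrand K xi <= C.
Proof.
move=> [cK _ K0 [x0 [r [r0 rK x00]]]].
have V_fin (xi : BG) : section_measure K xi \is a fin_num.
  by rewrite section_measure_fin// dim_grassmannian.
have [qneg|] := boolP (q < 0).
  rewrite (x00 qneg) in rK.
  have rK' y : `|y| <= r -> K y by move=> yr; apply: rK; rewrite subr0.
  have [C C0 hC] := @section_measure_lbound R m n m_gt0 K r r0 rK'.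
  exists (C `^ q) => xi; apply: powR_decreasing => //.
  by rewrite -lee_fin fineK// hC// dim_grassmannian.
rewrite -leNgt => qpos; have [D _ KD] := compact_bound cK.
have [C hC] := section_measure_bounded m KD.
exists (C `^ q) => xi.
have le : fine (section_measure K xi) <= C.
  by rewrite -lee_fin fineK// hC// dim_grassmannian.
have V0 : 0 <= fine (section_measure K xi) by rewrite fine_ge0// hausdorff_measure_ge0.
by apply: ge0_ler_powR => //; rewrite nnegrE// (le_trans V0).
Qed.

Lemma section_measure_pos (xi : BG) K x r : x \in val (xi : grassmannian R h) -> 0 < r ->
  (forall y, `|y - x| <= r -> K y) -> (0 < section_measure K xi)%E.
Proof.
move=> xxi r0 rK; apply: (section_measure_gt0 m_gt0 (@dim_grassmannian R n m h xi) xxi r0).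
by move=> y yxi yr; split => //; exact: rK.
Qed.

(** Positivity comes from the planes that meet the open ball inside [K]: their sections have
    positive measure, and the set of these planes has positive measure. *)
Lemma Psi_gt0_lty K : admissible_body q K -> exists2 J : R, 0 < J & Psi nu q K = J%:E.
Proof.
move=> aK; have [cK _ K0 [x0 [r [r0 rK x00]]]] := aK; have [C hC] := Psi_integrand_bounded aK.
have mu := measurable_Psi_integrand cK.
have lty : (Psi nu q K < +oo)%E.
  apply: (@le_lt_trans _ _ C%:E); last exact: ltry.
  rewrite PsiE// (le_trans (_ : _ <= \int[nu]_(xi in [set: BG]) (cst C%:E xi))%E)//.
    apply: ge0_le_integral => //.
    - by move=> xi _; rewrite lee_fin Psi_integrand_ge0.
    - exact/measurable_EFinP.
    - by move=> xi _; rewrite lee_fin hC.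
  by rewrite integral_cst// [X in (_ * X)%E]probability_setT mule1.
have gt0 : (0 < Psi nu q K)%E.
  rewrite PsiE//; apply: (@integral_gt0 _ BG R nu (Psi_integrand K) (meeting_planes (ball x0 r))) => //.
  - by move=> xi; exact: Psi_integrand_ge0.
  - by apply: measurable_meeting_planes; exact: ball_open.
  - by apply: haar_meeting_planes_gt0 => //; [exact: ball_open | exists x0; exact: ballxx].
  move=> xi [x xxi]; rewrite -ball_normE /= distrC => xr.
  rewrite /Psi_integrand powR_gt0// fine_gt0//.
  rewrite -ge0_fin_numE ?hausdorff_measure_ge0// section_measure_fin ?dim_grassmannian// andbT.
  apply: (@section_measure_pos xi K x (r - `|x - x0|)) => //; first by rewrite subr_gt0.
  by move=> y yx; apply: rK; rewrite (le_trans (ler_distD x _ _))// -lerBrDr.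
exists (fine (Psi nu q K)); last by rewrite fineK// gt0_fin_numE.
by rewrite fine_gt0// gt0 lty.
Qed.

Lemma Psi_scale L (c : R) : admissible_body q L -> 0 < c ->
  Psi nu q [set c *: x | x in L] = (((c ^+ m) `^ q)%:E * Psi nu q L)%E.
Proof.
move=> [cL _ _ _] c1; have ccL := @compact_scale _ _ L c cL.
rewrite !PsiE// -ge0_integralZl//.
- apply: eq_integral => xi _; rewrite -EFinM; congr _%:E.
  rewrite !Psi_integrandE// section_root_scale ?dim_grassmannian//.
  have cr0 : 0 <= c0 * section_root m (val (xi : grassmannian R h)) L ^+ m.
    apply: mulr_ge0; first exact: ltW (cube_const_gt0 R m_gt0).
    by apply: exprn_ge0; exact: section_root_ge0.
  by rewrite exprMn (mulrCA c0); apply: powRM; [apply: exprn_ge0; exact: ltW | exact: cr0].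
- by apply/measurable_EFinP; exact: measurable_Psi_integrand.
- by move=> xi _; rewrite lee_fin Psi_integrand_ge0.
- by rewrite lee_fin powR_ge0.
Qed.

End Psi_integrals.

Lemma EFin_combination (R : realType) (a b u v w : R) (x y z : \bar R) :
  z = w%:E -> x = u%:E -> y = v%:E -> w = a * u + b * v -> (z = a%:E * x + b%:E * y)%E.
Proof. by move=> -> -> -> ->. Qed.

(** * The inequality and its equality case *)

Section Psi_inequality.
Context (R : realType) (n m : nat) (m_gt0 : (0 < m)%N) (h : (m <= n)%N).
Context (nu : probability (borel_grassmannian R h) R) (hnu : haar_probability nu).
Context (q p alpha beta : R) (q0 : q != 0) (p1 : 1 < p) (mqp : m%:R * q < p).
Context (alpha0 : 0 < alpha) (beta0 : 0 < beta).
Context (K L : set 'rV[R]_n) (aK : admissible_body q K) (aL : admissible_body q L).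
Local Notation BG := (borel_grassmannian R h).
Local Notation c0 := (cube_const R m).
Local Notation M := (Lp_comb p alpha beta K L).
Local Notation mean := (lp_mean p alpha beta).
Local Notation root xi := (section_root m (val (xi : grassmannian R h))).
Local Notation e := (p / (m%:R * q)).

Let c0_gt0 : 0 < c0. Proof. exact: cube_const_gt0. Qed.
Let p_gt0 : 0 < p. Proof. exact: lt_trans ltr01 p1. Qed.
Let aM : admissible_body q M. Proof. exact: admissible_Lp_comb. Qed.

Definition volume_power (t : R) := (c0 * t ^+ m) `^ q.
Local Notation F := volume_power.

Lemma volume_power_gt0 t : 0 < t -> 0 < F t.
Proof. by move=> t0; rewrite powR_gt0// mulr_gt0// exprn_gt0. Qed.

(** The reason for the exponent [e]: it turns [F] of an [lp_mean] into a linear combination. *)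
Lemma volume_power_powR t : 0 <= t -> F t `^ e = c0 `^ (p / m%:R) * t `^ p.
Proof.
move=> t0; have m0 : m%:R != 0 :> R by rewrite pnatr_eq0 -lt0n.
rewrite /volume_power -powRrM.
have -> : q * e = p / m%:R by field; rewrite m0 q0.
rewrite powRM; [|exact: ltW|exact: exprn_ge0].
by rewrite -(powR_mulrn m t0) -powRrM mulrC (mulrC m%:R) divfK// mulrC.
Qed.

(** Allows the values of [Psi] to be written as [F a] and [F b], as if all sections had the constant
    roots [a] and [b]. *)
Lemma volume_power_surj (J : R) : 0 < J -> exists2 a, 0 < a & F a = J.
Proof.
move=> J0; have m0 : m%:R != 0 :> R by rewrite pnatr_eq0 -lt0n.
pose z := J `^ q^-1 / c0; have z0 : 0 < z by rewrite divr_gt0// powR_gt0.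
exists (z `^ m%:R^-1); first exact: powR_gt0.
rewrite /volume_power -powR_mulrn ?powR_ge0// -powRrM mulVf// powRr1 ?(ltW z0)//.
by rewrite /z mulrC divfK ?gt_eqF// -powRrM mulVf// powRr1// ltW.
Qed.

Lemma Psi_comparison (a b J : R) : 0 < a -> 0 < b ->
  Psi nu q K = (F a)%:E -> Psi nu q L = (F b)%:E -> Psi nu q M = J%:E ->
  [/\ 0 < q -> F (mean a b) <= J, q < 0 -> J <= F (mean a b) &
    J = F (mean a b) -> nu.-negligible [set xi : BG |
      ~ (root xi K / a = root xi L / b /\ root xi M / mean a b = root xi K / a)]].
Proof.
move=> a0 b0 KE LE ME.
have [cK sK K0 _] := aK; have [cL sL L0 _] := aL; have [cM _ _ _] := aM.
set d := mean a b; have d0 : 0 < d by rewrite powR_gt0// addr_gt0// mulr_gt0// powR_gt0.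
have Fa0 := volume_power_gt0 a0; have Fb0 := volume_power_gt0 b0.
have Fd0 := volume_power_gt0 d0.
pose theta := alpha * a `^ p / d `^ p.
have th0 : 0 <= theta.
  by rewrite divr_ge0 ?powR_ge0// mulr_ge0 ?powR_ge0// ltW.
have th1 : theta <= 1.
  rewrite /theta ler_pdivrMr; last exact: powR_gt0.
  rewrite mul1r lp_mean_pow// lerDl.
  by rewrite mulr_ge0 ?powR_ge0// ltW.
(* Coefficients of the integrands of [K] and [L] in the bound of [power_mean_comparison]; by [cE]
   its integral is [F d]. *)
pose c1 := F d * theta / F a; pose c2 := F d * (1 - theta) / F b.
have c10 : 0 <= c1 by rewrite divr_ge0 ?powR_ge0// mulr_ge0 ?powR_ge0.
have c20 : 0 <= c2 by rewrite divr_ge0 ?powR_ge0// mulr_ge0 ?powR_ge0// subr_ge0.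
have cE : c1 * F a + c2 * F b = F d.
  rewrite /c1 /c2 (divfK (negbT (gt_eqF Fa0))) (divfK (negbT (gt_eqF Fb0))).
  by rewrite -(mulrDr (F d)) addrC subrK mulr1.
pose G (xi : BG) := c1 * Psi_integrand q K xi + c2 * Psi_integrand q L xi.
have lin (x y z w t u v : R) : x * t / y * u + x * w / z * v = x * (t * (u / y) + w * (v / z)).
  by rewrite mulrDr !mulrA (mulrAC _ u) (mulrAC _ v).
have comp (xi : BG) : [/\ 0 < q -> G xi <= Psi_integrand q M xi,
    q < 0 -> Psi_integrand q M xi <= G xi & G xi = Psi_integrand q M xi ->
    root xi K / a = root xi L / b /\ root xi M / d = root xi K / a].
  have dxi : \dim (val (xi : grassmannian R h)) = m by exact: dim_grassmannian.
  have GE : G xi = F d * (theta * (F (root xi K) / F a) + (1 - theta) * (F (root xi L) / F b)).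
    rewrite /G /c1 /c2 (Psi_integrandE m_gt0 q xi cK) (Psi_integrandE m_gt0 q xi cL).
    exact: lin.
  rewrite GE (Psi_integrandE m_gt0 q xi cM).
  apply: (power_mean_comparison m_gt0 c0_gt0 (erefl F) q0 p1 mqp alpha0 beta0 a0 b0
     (section_root_ge0 _ _ _) (section_root_ge0 _ _ _)); last first.
    exact: section_root_Lp_comb.
  have pos A : admissible_body q A -> q < 0 -> 0 < root xi A.
    move=> [cA _ _ [x0 [r [r0 rA x00]]]] qneg.
    have : (0 < section_measure A xi)%E.
      apply: (@section_measure_pos R n m m_gt0 h xi A x0 r) => //.
      by rewrite (x00 qneg) mem0v.
    rewrite /section_measure section_rootE// lte_fin pmulr_rgt0//.
    rewrite !lt_neqAle section_root_ge0 andbT => /andP[+ _].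
    by apply: contraNN => /eqP <-; rewrite expr0n gtn_eqF// eqxx.
  by move=> qneg; split; exact: pos.
have mK : measurable_fun [set: BG] (Psi_integrand q K) := measurable_Psi_integrand m_gt0 q cK.
have mL : measurable_fun [set: BG] (Psi_integrand q L) := measurable_Psi_integrand m_gt0 q cL.
have mM : measurable_fun [set: BG] (Psi_integrand q M) := measurable_Psi_integrand m_gt0 q cM.
have [le ge eqn] := integral_combination_comparison mK mL mM (Psi_integrand_ge0 q K)
  (Psi_integrand_ge0 q L) (Psi_integrand_ge0 q M) c10 c20 (etrans (esym (PsiE nu q cK)) KE)
  (etrans (esym (PsiE nu q cL)) LE) (etrans (esym (PsiE nu q cM)) ME).
rewrite cE in le ge eqn; split.
- by move=> qpos; apply: le => xi; have [+ _ _] := comp xi; apply.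
- by move=> qneg; apply: ge => xi; have [_ + _] := comp xi; apply.
move=> JE; apply: (negligibleS _ (eqn _ JE)).
  by move=> xi /= nxi; apply/eqP => Gxi; apply: nxi; have [_ _ /(_ Gxi)] := comp xi.
have [qpos|qneg|qe] := ltgtP 0 q; last by move: q0; rewrite qe eqxx.
  by left => xi; have [+ _ _] := comp xi; apply.
by right => xi; have [_ + _] := comp xi; apply.
Qed.

(* A failure of the dilation relation at one point spreads to an open set,
   which a set of planes of positive measure meets. *)
Lemma dilates_of_sections (a b : R) : 0 < a -> 0 < b ->
  nu.-negligible [set xi : BG |
    ~ (root xi K / a = root xi L / b /\ root xi M / mean a b = root xi K / a)] ->
  K = [set (a / b) *: x | x in L].
Proof.
move=> a0 b0 neg; have ab : 0 < a / b by rewrite divr_gt0.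
have [cK sK K0 [xK [rK [rK0 bK _]]]] := aK.
have [cL sL L0 [xL [rL [rL0 bL _]]]] := aL.
set C := [set _ | _ in L].
have cC : compact C by exact: compact_scale.
have sC : segment_closed C by exact: segment_closed_scale.
have CL x : C x -> L ((a / b)^-1 *: x).
  by move=> [z Lz <-]; rewrite scalerA mulVf ?gt_eqF// scale1r.
have good (x1 : 'rV[R]_n) (r : R) : 0 < r -> exists2 xi : BG,
    (exists2 y, y \in val (xi : grassmannian R h) & `|y - x1| < r) &
    root xi K / a = root xi L / b /\ root xi M / mean a b = root xi K / a.
  move=> r0; apply: contrapT => hno.
  have oB : open (ball x1 r) by exact: ball_open.
  have := haar_meeting_planes_gt0 m_gt0 hnu oB (ex_intro _ x1 (ballxx x1 r0)).
  suff -> : nu (meeting_planes (ball x1 r)) = 0%E by rewrite ltxx.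
  apply/negligibleP; first exact: measurable_meeting_planes.
  apply: negligibleS neg => xi [y yxi]; rewrite -ball_normE /= distrC => yr eqs.
  by apply: hno; exists xi => //; exists y.
(* Every ball inside one of the two sets contains a point at which membership in [K] and in [C]
   agrees, so no ball lies in one of them and misses the other. *)
have key (x1 : 'rV[R]_n) (r : R) : 0 < r -> (forall y, `|y - x1| <= r -> K y) \/ (forall y, `|y - x1| <= r -> C y) ->
    exists2 y, `|y - x1| <= r & (K y <-> C y).
  move=> r0 ball; have [xi [y yxi yr] [kl vd]] := good x1 r r0.
  exists y; first exact: ltW.
  have dxi : \dim (val (xi : grassmannian R h)) = m by exact: dim_grassmannian.
  pose s := r - `|y - x1|; have s0 : 0 < s by rewrite subr_gt0.
  have near z : `|z - y| <= s -> `|z - x1| <= r.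
    by move=> zy; rewrite (le_trans (ler_distD y _ _))// -lerBrDr.
  case: ball => ball.
    apply: (section_Lp_equality m_gt0 dxi p1 alpha0 beta0 cK cL K0 L0 sK sL a0 b0 kl vd yxi s0 _ yxi).
    by left => z /near /ball.
  apply: (section_Lp_equality m_gt0 dxi p1 alpha0 beta0 cK cL K0 L0 sK sL a0 b0 kl vd
    (x0 := (a / b)^-1 *: y) (r := (a / b)^-1 * s) _ _ _ yxi).
  - exact: memvZ.
  - by rewrite mulr_gt0// invr_gt0.
  right => z zy; have := CL ((a / b) *: z).
  rewrite scalerA mulVf ?gt_eqF// scale1r; apply; apply: ball; apply: near.
  rewrite -[y](scalerKV (negbT (gt_eqF ab))) -scalerBr normrZ gtr0_norm//.
  by rewrite -ler_pdivlMl.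
apply/seteqP; split => x.
  move=> Kx; apply: contrapT => nCx.
  have clC : closed C by apply: compact_closed => //; exact: norm_hausdorff.
  have [x1 [r [r0 out]]] := interior_ball_outside sK clC
    (ex_intro _ xK (ex_intro _ rK (conj rK0 bK))) Kx nCx.
  have [y /out[Ky nCy] KC] := key x1 r r0 (or_introl (fun y yr => (out y yr).1)).
  by apply: nCy; apply/KC.
move=> Cx; apply: contrapT => nKx.
have clK : closed K by apply: compact_closed => //; exact: norm_hausdorff.
have ballC : exists x0 r, 0 < r /\ forall y, `|y - x0| <= r -> C y.
  exists ((a / b) *: xL), ((a / b) * rL); split; first by rewrite mulr_gt0.
  move=> y yr; exists ((a / b)^-1 *: y); last by rewrite scalerA mulfV ?gt_eqF// scale1r.
  apply: bL; rewrite -[xL](scalerK (negbT (gt_eqF ab))) -scalerBr normrZ gtr0_norm ?invr_gt0//.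
  by rewrite ler_pdivrMl.
have [x1 [r [r0 out]]] := interior_ball_outside sC clK ballC Cx nKx.
have [y /out[Cy nKy] KC] := key x1 r r0 (or_intror (fun y yr => (out y yr).1)).
by apply: nKy; apply/KC.
Qed.

Lemma Psi_Lp_comb_dilates (lambda : R) : 0 < lambda -> K = [set lambda *: x | x in L] ->
  (Psi nu q M `^ e = alpha%:E * Psi nu q K `^ e + beta%:E * Psi nu q L `^ e)%E.
Proof.
move=> l0 KE; have [cK sK K0 _] := aK; have [cL sL L0 _] := aL.
have [J J0 LE] := Psi_gt0_lty m_gt0 hnu aL.
have m0 : m%:R != 0 :> R by rewrite pnatr_eq0 -lt0n.
have scale (c : R) : 0 < c -> (Psi nu q [set c *: x | x in L] `^ e)%E = (c `^ p * J `^ e)%:E.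
  move=> c1; rewrite (Psi_scale m_gt0 nu aL)// LE -EFinM poweR_EFin; congr _%:E.
  rewrite powRM ?powR_ge0 ?(ltW J0)//; congr (_ * _).
  rewrite -powRrM -powR_mulrn ?(ltW c1)// -powRrM; congr (_ `^ _).
  by field; rewrite m0 q0.
have mu0 : 0 < mean lambda 1 by rewrite powR_gt0// addr_gt0// mulr_gt0// powR_gt0.
have PK : (Psi nu q K `^ e = (lambda `^ p * J `^ e)%:E)%E by rewrite -(scale _ l0) -KE.
have PM : (Psi nu q M `^ e = ((mean lambda 1) `^ p * J `^ e)%:E)%E.
  by rewrite -(scale _ mu0) -(Lp_comb_dilates p1 alpha0 beta0 cL L0 sL l0 KE).
have PL : (Psi nu q L `^ e = (J `^ e)%:E)%E by rewrite LE poweR_EFin.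
have muE : (mean lambda 1) `^ p = alpha * lambda `^ p + beta.
  by rewrite lp_mean_pow// powR1 mulr1.
have sumE : (mean lambda 1) `^ p * J `^ e = alpha * (lambda `^ p * J `^ e) + beta * J `^ e.
  by rewrite muE mulrDl mulrA.
exact: EFin_combination PM PK PL sumE.
Qed.

Lemma Psi_Lp_comb_inequality :
  (alpha%:E * Psi nu q K `^ e + beta%:E * Psi nu q L `^ e <= Psi nu q M `^ e)%E /\
  ((Psi nu q M `^ e = alpha%:E * Psi nu q K `^ e + beta%:E * Psi nu q L `^ e)%E
     <-> dilates K L).
Proof.
have [_ /volume_power_surj[a a0 <-] KE] := Psi_gt0_lty m_gt0 hnu aK.
have [_ /volume_power_surj[b b0 <-] LE] := Psi_gt0_lty m_gt0 hnu aL.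
have [J J0 ME] := Psi_gt0_lty m_gt0 hnu aM.
have [pos neg eqn] := Psi_comparison a0 b0 KE LE ME.
have m0 : 0 < m%:R :> R by rewrite ltr0n.
have m0' : m%:R != 0 :> R by rewrite gt_eqF.
have e0 : e != 0.
  by apply: mulf_neq0; [rewrite gt_eqF | rewrite invr_neq0 ?mulf_neq0].
have pow A x : Psi nu q A = x%:E -> (Psi nu q A `^ e = (x `^ e)%:E)%E.
  by move=> ->; rewrite poweR_EFin.
have PK := pow _ _ KE; have PL := pow _ _ LE; have PM := pow _ _ ME.
have sumE : F (mean a b) `^ e = alpha * F a `^ e + beta * F b `^ e.
  rewrite (volume_power_powR (lp_mean_ge0 _ _ _ _ _)) (volume_power_powR (ltW a0)).
  rewrite (volume_power_powR (ltW b0)) lp_mean_pow//.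
  by rewrite mulrDr (mulrCA alpha) (mulrCA beta).
have PS := esym (EFin_combination (erefl _) PK PL sumE).
have pp : 0 < p * (m%:R)^-1 by rewrite divr_gt0.
have eE : e = p * (m%:R)^-1 * q^-1 by rewrite invfM mulrA.
split.
  rewrite PS PM lee_fin.
  have [qpos|qneg|qe] := ltgtP 0 q; last by move: q0; rewrite qe eqxx.
    have e1 : 0 <= e by rewrite eE mulr_ge0// ?invr_ge0 ltW.
    apply: (ge0_ler_powR e1); rewrite ?nnegrE; [exact: powR_ge0|exact: ltW|exact: pos].
  (* The negative power undoes the reversal of the comparison for [q < 0]. *)
  have e1 : e < 0 by rewrite eE pmulr_rlt0// invr_lt0.
  by apply: (powR_decreasing e1 J0); exact: neg.
split; last by move=> [lambda l0 KE']; exact: Psi_Lp_comb_dilates l0 KE'.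
rewrite PS PM => -[/(powR_inj e0 (ltW J0) (powR_ge0 _ _))/eqn ne].
by exists (a / b); [rewrite divr_gt0 | exact: dilates_of_sections].
Qed.

End Psi_inequality.

Theorem theorem1p3 (R : realType) (n m : nat) (hn : (2 <= n)%N)
    (hm : (1 <= m)%N) (hmn : (m < n)%N)
    (nu : probability (borel_grassmannian R (ltnW hmn)) R)
    (hnu : haar_probability nu)
    (q p : R) (hq : q != 0) (hp : Num.max m%:R (m%:R * q) < p) :
  (forall (K L : set 'rV[R]_n) (alpha beta : R),
     convex_body K -> interior K 0 -> convex_body L -> interior L 0 ->
     0 < alpha -> 0 < beta ->
     ((alpha%:E * Psi nu q K `^ (p / (m%:R * q))
         + beta%:E * Psi nu q L `^ (p / (m%:R * q))
       <= Psi nu q (Lp_comb p alpha beta K L) `^ (p / (m%:R * q)))%E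
      /\ ((Psi nu q (Lp_comb p alpha beta K L) `^ (p / (m%:R * q))
            = alpha%:E * Psi nu q K `^ (p / (m%:R * q))
              + beta%:E * Psi nu q L `^ (p / (m%:R * q)))%E
          <-> dilates K L)))
  /\
  (0 < q ->
   forall (K L : set 'rV[R]_n) (alpha beta : R),
     convex_body K -> K 0 -> convex_body L -> L 0 ->
     0 < alpha -> 0 < beta ->
     ((alpha%:E * Psi nu q K `^ (p / (m%:R * q))
         + beta%:E * Psi nu q L `^ (p / (m%:R * q))
       <= Psi nu q (Lp_comb p alpha beta K L) `^ (p / (m%:R * q)))%E
      /\ ((Psi nu q (Lp_comb p alpha beta K L) `^ (p / (m%:R * q))
            = alpha%:E * Psi nu q K `^ (p / (m%:R * q))
              + beta%:E * Psi nu q L `^ (p / (m%:R * q)))%E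
          <-> dilates K L))).
Proof.
have /andP[pm mqp] : (m%:R < p) && (m%:R * q < p) by rewrite -gt_max.
have p1 : 1 < p by rewrite (le_lt_trans _ pm)// ler1n.
split=> [K L alpha beta bK oK bL oL al0 be0|q0 K L alpha beta bK oK bL oL al0 be0].
  by apply: Psi_Lp_comb_inequality => //; apply: convex_body_admissible => //; exact: interior_subset.
by apply: Psi_Lp_comb_inequality => //; apply: convex_body_admissible => //; rewrite ltNge (ltW q0).
Qed.
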